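(* Let $\frac13<a<1$, and let $E_a(z)=\sum_{n=0}^\infty \frac{z^n}{\Gamma(an+1)}$ be the Mittag-Leffler function. For $x>0$ put $X=x^{1/a}$, and let $M=M(x)$ be the optimal truncation index, that is, a positive integer with $aM=X+\nu$, where $\nu=\nu(x)$ is real and remains bounded as $x\to+\infty$. Put $\omega=\pi(1-a)/a$, and let $c$ and $B_{2k}$ ($k\ge 0$) be the quantities defined in the context (depending on $a$, and in the case of $B_{2k}$ also on $\nu$). Then $$E_a(-x)=-\sum_{k=1}^{M}\frac{(-x)^{-k}}{\Gamma(1-ak)}+R_M(a;-x),$$ where, as $x\to+\infty$, the remainder $R_M(a;-x)$ has the exponentially small asymptotic expansion $$R_M(a;-x)\sim\frac{2}{a}\,\mathrm{Re}\left\{\frac{\exp\left[Xe^{\pi i/a}\right]}{2}\,\mathrm{erfc}\left[c\sqrt{X/2}\,\right]-\frac{i\,e^{-X-i\omega X}}{\sqrt{2\pi X}}\sum_{k=0}^\infty B_{2k}\,\left(\tfrac12\right)_k\left(\tfrac12 X\right)^{-k}\right\}.$$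
   Context: Notation: $\mathrm{erfc}(\xi)=\frac{2}{\sqrt\pi}\int_\xi^\infty e^{-s^2}\,ds$ is the complementary error function (an entire function of $\xi$); $(\frac12)_k=\Gamma(k+\frac12)/\Gamma(\frac12)$ is the Pochhammer symbol; $1/\Gamma(1-ak)$ is interpreted as $0$ when $1-ak$ is a non-positive integer. Standing parameters: $\frac13<a<1$ is fixed, $\omega=\pi(1-a)/a$, and $t_0=e^{i\omega}$, with powers of $t_0$ understood as $t_0^s=e^{is\omega}$. The quantity $c$: it is defined by $\frac12c^2=1+i\omega-e^{i\omega}$, where the branch of the square root is the one depending continuously on $\omega>0$ for which, as $\omega\to0$ (i.e. $a\to1$), $$c=\omega+\tfrac16 i\omega^2-\tfrac1{36}\omega^3-\tfrac1{270}i\omega^4+\tfrac1{2592}\omega^5+\cdots.$$ The coefficients $B_{2k}$: let $t=t(u)$ be the inverse, analytic near $u=0$, of the relation $\frac12u^2=t-\log t-1$ with $t(0)=1$ and $t-1=u+\frac13u^2+\frac1{36}u^3-\cdots$. For a real number $\nu$ define, near $u=0$, $$f(u)=\frac{t^{a+\nu-1}}{t^a-t_0^a}\,\frac{dt}{du}=\frac{u\,t^{a+\nu}}{(t-1)(t^a-t_0^a)}=\sum_{r=0}^\infty\alpha_r u^r ,$$ with principal powers of $t$ near $t=1$ and with $t_0^a=e^{ia\omega}$. Put $u_0=ic$ and $A=e^{i\nu\omega}/a$. The coefficients $B_r$ are defined by $$f(u)=A\left\{\frac{1}{u-u_0}+\sum_{r=0}^\infty B_r u^r\right\}$$ near $u=0$;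 equivalently, $$B_{2k}=a\,e^{-i\nu\omega}\,\alpha_{2k}+\frac{1}{(ic)^{2k+1}}\qquad(k\ge0).$$ In the expansion, $\nu$ is the number $\nu=aM-X$. Meaning of the expansion: the symbol $\sim$ is understood in the usual Poincaré sense for fixed $a$ and bounded $\nu$: for every integer $N\ge0$, if the infinite sum is replaced by the sum over $0\le k\le N-1$, the difference between $R_M(a;-x)$ and the right-hand side is $O(e^{-X}X^{-N-1/2})$ as $x\to+\infty$. *)

(* Defs.v *)
(* Stdlib reals and Coquelicot; complex numbers are Coquelicot's C = R * R. *)
From Stdlib Require Import Reals.
From Coquelicot Require Import Coquelicot.
Open Scope R_scope.

Definition Cexp (z : C) : C :=
  (exp (Re z) * cos (Im z), exp (Re z) * sin (Im z)).

(* Principal argument, in (-PI, PI], for z <> 0. *)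
Definition Carg (z : C) : R :=
  if Rlt_dec (Im z) 0 then - acos (Re z / Cmod z) else acos (Re z / Cmod z).

Definition Clog (z : C) : C := (ln (Cmod z), Carg z).

(* Principal power of z <> 0 with real exponent s. *)
Definition Cpower (z : C) (s : R) : C := Cexp (s * Clog z)%C.

Fixpoint Csum (f : nat -> C) (N : nat) : C :=
  match N with
  | O => RtoC 0
  | S n => (Csum f n + f n)%C
  end.

(* Euler's integral; meaningful for 0 < x only. *)
Definition Gamma (x : R) : R :=
  RInt_gen (fun s => Rpower s (x - 1) * exp (- s))
           (at_right 0) (Rbar_locally p_infty).

(* Rising factorial x (x + 1) ... (x + n - 1). *)
Fixpoint rising (x : R) (n : nat) : R :=
  match n with
  | O => 1
  | S m => rising x m * (x + INR m)
  end.

(* 1 / Gamma(x) for every real x, from Gamma(x + n) = rising x n * Gamma(x)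
   with n a natural number such that 0 < x + n.  Since n > - x, the factor
   rising x n makes this 0 when x is a non-positive integer. *)
Definition inv_Gamma (x : R) : R :=
  let n := Z.to_nat (up (- x)) in rising x n / Gamma (x + INR n).

Definition half_pochhammer (k : nat) : R :=
  Gamma (INR k + 1 / 2) / Gamma (1 / 2).

(* The path of integration from xi to infinity is the horizontal ray
   xi + s, s >= 0. *)
Definition Cerfc (xi : C) : C :=
  (RtoC (2 / sqrt PI) *
   RInt_gen (V := C_R_CompleteNormedModule)
     (fun s : R => Cexp (- (xi + RtoC s) ^ 2))
     (at_point 0) (Rbar_locally p_infty))%C.

Definition mittag_leffler (a z : R) : R :=
  Series (fun n => z ^ n / Gamma (a * INR n + 1)).

Definition omega (a : R) : R := PI * (1 - a) / a.

(* The power t_0^s of t_0 = e^{i omega}, read as e^{i s omega}. *)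
Definition t0_pow (a s : R) : C := Cexp (Ci * RtoC (s * omega a))%C.

(* c, as a function of omega > 0: a continuous square root, selected by its
   expansion as omega -> 0. *)
Definition is_c_branch (c : R -> C) : Prop :=
  (forall w : R, 0 < w ->
     (/ 2 * c w ^ 2 = 1 + Ci * w - Cexp (Ci * w))%C) /\
  (forall w : R, 0 < w -> continuous c w) /\
  (exists K delta : R, 0 < delta /\
     forall w : R, 0 < w < delta ->
       Cmod (c w - (w + Ci * w ^ 2 / 6 - w ^ 3 / 36
                    - Ci * w ^ 4 / 270 + w ^ 5 / 2592))%C <= K * w ^ 6).

(* The inverse t(u), analytic at u = 0, of u^2 / 2 = t - log t - 1 for which
   t = 1 + u + u^2 / 3 + u^3 / 36 - ...  *)
Definition is_saddle_inverse (t : C -> C) : Prop :=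
  (exists tau : nat -> C,
     tau 0%nat = RtoC 1 /\ tau 1%nat = RtoC 1 /\
     tau 2%nat = RtoC (1 / 3) /\ tau 3%nat = RtoC (1 / 36) /\
     locally (RtoC 0) (fun u : C =>
       is_pseries (K := C_AbsRing) (V := C_NormedModule) tau u (t u))) /\
  locally (RtoC 0) (fun u : C => (u ^ 2 / 2 = t u - Clog (t u) - 1)%C).

Definition saddle_fun (a nu : R) (t : C -> C) (u : C) : C :=
  (Cpower (t u) (a + nu - 1) / (Cpower (t u) a - t0_pow a a)
   * C_derive t u)%C.

(* B nu r is the coefficient B_r attached to the value nu, defined by
   f(u) = A { 1 / (u - u_0) + sum_r B_r u^r } near u = 0, where u_0 = i c and
   A = e^{i nu omega} / a. *)
Definition is_B_coeffs (a : R) (c : R -> C) (t : C -> C) (B : R -> nat -> C)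
  : Prop :=
  forall nu : R,
  locally (RtoC 0) (fun u : C =>
    exists s : C,
      is_pseries (K := C_AbsRing) (V := C_NormedModule) (B nu) u s /\
      saddle_fun a nu t u =
        (t0_pow a nu / RtoC a * (/ (u - Ci * c (omega a)) + s))%C).

Definition bigX (a x : R) : R := Rpower x (1 / a).

Definition nu_of (a : R) (M : R -> nat) (x : R) : R :=
  a * INR (M x) - bigX a x.

Definition algebraic_part (a : R) (m : nat) (x : R) : R :=
  - sum_n_m (fun k => / (- x) ^ k * inv_Gamma (1 - a * INR k)) 1 m.

(* The exponentially small expansion with its series cut after N terms, for
   given values of c, of X and of the coefficients b = (B_r). *)
Definition exp_expansion (a : R) (c : C) (b : nat -> C) (N : nat) (X : R) : R :=
  2 / a *
  Re (Cexp (X * Cexp (Ci * RtoC (PI / a))) / 2 * Cerfc (c * RtoC (sqrt (X / 2)))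
      - Ci * Cexp (- X - Ci * RtoC (omega a * X)) / RtoC (sqrt (2 * PI * X))
        * Csum (fun k => b (2 * k)%nat
                         * RtoC (half_pochhammer k * / (X / 2) ^ k)) N)%C.

(* Main.v *)
(* Write [s = e^w].  The series [sum (-x)^n / Gamma(a n + 1)] is summed under
   Hankel's integral for [1 / Gamma], the inverse powers of the algebraic part
   are absorbed in the same way, and the contour then collapses onto the
   negative axis.  In the variable [s = X e^(y + i pi)], with
   [kappa = e^(- i omega (X + nu))],
     R_M = (e^(-X) / pi) int_R e^(- X (e^y - 1 - y)) Im (kappa q(y)) dy,
     q(y) = e^((a + nu) y) / (e^(a y) - t_0^a),
   a Laplace integral whose pole is off the real axis.  The substitution
   [u^2 / 2 = e^y - 1 - y], that is [t(u) = e^y], turns [q(y) dy] into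
   [f(u) du], so Watson's lemma gives an expansion in the coefficients
   [alpha_(2k) = A (B_(2k) - (i c)^(-2k-1))]; uniformity in [nu] holds because
   [f] is [t(u)^nu] times a function independent of [nu].  Since [Re c > 0],
   the asymptotic expansion of [erfc] along [c sqrt (X / 2)] is exactly the
   contribution of the terms [(i c)^(-2k-1)], so no uniformity in the position
   of the pole has to be proved. *)
Require Import Defs.
From Stdlib Require Import Reals ZArith Lra Lia Psatz ssreflect Ranalysis5 FunctionalExtensionality.
From Coquelicot Require Import Coquelicot.
Open Scope R_scope.

(** * Improper integrals of continuous functions *)

(** The hypotheses describe [t] and [B] only locally: for each [nu] the series of [B nu] is known
    near [u = 0] on a neighbourhood that may depend on [nu], whereas the error bound must be uniform
    over bounded [nu]. Hence the uniform Taylor remainder is built from the data at [nu = 0]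
    multiplied by [e^(nu x)], and its coefficients are identified afterwards, one [nu] at a time, by
    uniqueness. Likewise [t] is evaluated on the real axis only, where it must be shown to be the
    branch with [t (saddle x) = e^x]. Contour arguments are carried out on real and imaginary parts:
    Cauchy's theorem appears as Green's formula on rectangles in the variable [w = log s].
    Identifying Hankel's integral with [inv_Gamma] rests on the reflection formula, which is proved
    here by a beta integral and a Poisson kernel. The sign of [Re c] comes from
    [Re c * Im c = omega - sin omega > 0]: the curve [c] never meets an axis, so the sign visible as
    [omega -> 0] persists. *)

Notation integral_R f l :=
  (is_RInt_gen f (Rbar_locally m_infty) (Rbar_locally p_infty) l).

Lemma ex_RInt_continuous_R (f : R -> R) (a b : R) :
  (forall x, continuous f x) -> ex_RInt f a b.
Proof. by move=> H; apply: (ex_RInt_continuous (V := R_CompleteNormedModule)) => x _. Qed.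

(** Comparison test through the Cauchy criterion: moving one endpoint changes the integral of [f] by
    at most what it changes that of [g]. The bound is asked only on [D], an order-convex set that
    both endpoints eventually enter, so that the same lemma serves the whole line and rays. *)
Lemma ex_RInt_gen_dominated {Fa Fb : (R -> Prop) -> Prop}
  {FFa : ProperFilter Fa} {FFb : ProperFilter Fb} (D : R -> Prop) (f g : R -> R) :
  (forall a b x, D a -> D b -> a <= x <= b -> D x) -> Fa D -> Fb D ->
  (forall x, continuous f x) -> (forall x, continuous g x) ->
  (forall x, D x -> Rabs (f x) <= g x) ->
  ex_RInt_gen g Fa Fb -> ex_RInt_gen f Fa Fb.
Proof.
move=> HD HDa HDb Cf Cg Hfg [lg Hg].
have Ef a b := ex_RInt_continuous_R f a b Cf.
have Eg a b := ex_RInt_continuous_R g a b Cg.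
have If a b := RInt_correct (V := R_CompleteNormedModule) _ _ _ (Ef a b).
have Ig a b := RInt_correct (V := R_CompleteNormedModule) _ _ _ (Eg a b).
have Hle a b : D a -> D b -> Rabs (RInt f a b) <= Rabs (RInt g a b).
{ have Haux c d : D c -> D d -> c <= d -> Rabs (RInt f c d) <= Rabs (RInt g c d).
  { move=> Dc Dd cd.
    have H := norm_RInt_le (V := R_NormedModule) f g c d _ _ cd
      (fun x Hx => Hfg x (HD _ _ _ Dc Dd Hx)) (If c d) (Ig c d).
    apply: Rle_trans H _. apply: Rle_abs. }
  move=> Da Db.
  case: (Rle_dec a b) => [ab|ab]; first by apply: Haux.
  rewrite -(opp_RInt_swap f) // -(opp_RInt_swap g) //.
  rewrite /opp /= !Rabs_Ropp. apply: Haux => //. lra. }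
have Huniq (h : R -> R) (a b : R) y1 y2 : is_RInt h a b y1 -> is_RInt h a b y2 -> y1 = y2.
{ move=> H1 H2. by rewrite -(is_RInt_unique _ _ _ _ H1) -(is_RInt_unique _ _ _ _ H2). }
suff [y Hy] : exists y : R_CompleteSpace, filterlimi (fun ab : R * R => is_RInt f (fst ab) (snd ab))
  (filter_prod Fa Fb) (locally y) by exists y.
apply filterlimi_locally_cauchy.
{ apply: filter_forall => x. split; last exact: Huniq.
  by exists (RInt f (fst x) (snd x)). }
move=> eps.
have [P [[Q1 Q2 HQ1 HQ2 HQ] HP2]] : exists P : R * R -> Prop, filter_prod Fa Fb P /\
    (forall u v, P u -> P v -> forall u' v' : R_CompleteSpace,
      is_RInt g (fst u) (snd u) u' -> is_RInt g (fst v) (snd v) v' -> ball u' (pos_div_2 eps) v').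
{ apply filterlimi_locally_cauchy; last by exists lg.
  apply: filter_forall => x. split; last exact: Huniq.
  by exists (RInt g (fst x) (snd x)). }
exists (fun ab => (Q1 (fst ab) /\ D (fst ab)) /\ (Q2 (snd ab) /\ D (snd ab))); split.
{ by exists (fun x => Q1 x /\ D x) (fun x => Q2 x /\ D x) => //; apply: filter_and. }
move=> [a b] [c d] /= [[Ha Da] [Hb Db]] [[Hc Dc] [Hd Dd]] u' v' Hu Hv.
rewrite (Huniq _ _ _ _ _ Hu (If a b)) (Huniq _ _ _ _ _ Hv (If c d)).
(* Two pairs of endpoints that share one end isolate the move of the other end; each of the two
   moves gets half of [eps]. *)
have Hac : Rabs (RInt g a c) < eps / 2.
{ have := HP2 (c, b) (a, b) (HQ _ _ Hc Hb) (HQ _ _ Ha Hb) _ _ (Ig c b) (Ig a b).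
  rewrite /ball /= /AbsRing_ball /abs /minus /plus /opp /= -(RInt_Chasles g a c b) //= /plus /=.
  by rewrite (_ : RInt g a c + RInt g c b + - RInt g c b = RInt g a c); last ring. }
have Hbd : Rabs (RInt g b d) < eps / 2.
{ have := HP2 (a, b) (a, d) (HQ _ _ Ha Hb) (HQ _ _ Ha Hd) _ _ (Ig a b) (Ig a d).
  rewrite /ball /= /AbsRing_ball /abs /minus /plus /opp /= -(RInt_Chasles g a b d) //= /plus /=.
  by rewrite (_ : RInt g a b + RInt g b d + - RInt g a b = RInt g b d); last ring. }
rewrite /ball /= /AbsRing_ball /abs /minus /plus /opp /=.
have -> : RInt f c d = RInt f a b - RInt f a c + RInt f b d.
{ rewrite -(RInt_Chasles f a c b) // -(RInt_Chasles f c b d) //= /plus /=. ring. }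
have := Hle a c Da Dc. have := Hle b d Db Dd.
move: Hac Hbd. move: (RInt f a c) (RInt f b d) => p q.
rewrite (_ : RInt f a b - p + q + - RInt f a b = q - p); last ring.
split_Rabs; lra.
Qed.

Lemma is_RInt_gen_primitive {Fa Fb : (R -> Prop) -> Prop}
  {FFa : Filter Fa} {FFb : Filter Fb} (F f : R -> R) (la lb : R) :
  (forall x, is_derive F x (f x)) -> (forall x, continuous f x) ->
  filterlim F Fa (locally la) -> filterlim F Fb (locally lb) ->
  is_RInt_gen f Fa Fb (lb - la).
Proof.
move=> HF Cf Ha Hb.
have E x : Derive F x = f x by apply: is_derive_unique.
apply (is_RInt_gen_ext (Derive F)); first by apply: filter_forall => ab x _.
apply is_RInt_gen_Derive; try done; apply: filter_forall => ab x _.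
  by exists (f x).
apply: (continuous_ext f) => //.
Qed.

(** [phi] has to be differentiable only between endpoints that the filters reach, so [phi = ln] on
    the positive half-line is allowed, while [f] is continuous everywhere. *)
Lemma is_RInt_gen_subst {Fa Fb Ga Gb : (R -> Prop) -> Prop}
  {FFa : Filter Fa} {FFb : Filter Fb} {FGa : Filter Ga} {FGb : Filter Gb}
  (f phi dphi : R -> R) (l : R) :
  filterlim phi Ga Fa -> filterlim phi Gb Fb ->
  filter_prod Ga Gb (fun ab => forall x, Rmin (fst ab) (snd ab) <= x <= Rmax (fst ab) (snd ab) ->
     is_derive phi x (dphi x) /\ continuous dphi x) ->
  (forall x, continuous f x) ->
  is_RInt_gen f Fa Fb l -> is_RInt_gen (fun x => dphi x * f (phi x)) Ga Gb l.
Proof.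
move=> Ha Hb Hd Cf Hf.
have Ef a b := ex_RInt_continuous_R f a b Cf.
have Hl : filterlim (fun ab : R * R => RInt f (fst ab) (snd ab)) (filter_prod Fa Fb) (locally l).
{ move=> P HP. have := Hf P HP. rewrite /filtermapi /filtermap.
  apply: filter_imp => ab [y [H1 H2]]. by rewrite (is_RInt_unique _ _ _ _ H1). }
apply: (filterlimi_lim_ext_loc (fun ab => RInt f (phi (fst ab)) (phi (snd ab)))).
{ apply: filter_imp Hd => ab Hab.
  have H : is_RInt (fun x => scal (dphi x) (f (phi x))) (fst ab) (snd ab) (RInt f (phi (fst ab)) (phi (snd ab))).
  { apply: (is_RInt_comp (V := R_CompleteNormedModule)) => //. }
  exact: H. }
apply: (filterlim_comp _ _ _ (fun ab : R * R => (phi (fst ab), phi (snd ab))) (fun ab => RInt f (fst ab) (snd ab)) _ _ _ _ Hl).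
apply: filterlim_pair.
  by apply: (filterlim_comp _ _ _ fst phi _ Ga) => //; apply: filterlim_fst.
by apply: (filterlim_comp _ _ _ snd phi _ Gb) => //; apply: filterlim_snd.
Qed.

Lemma integral_R_shift (f : R -> R) (c l : R) :
  (forall x, continuous f x) ->
  integral_R f l -> integral_R (fun y => f (y + c)) l.
Proof.
move=> Cf Hf.
apply (is_RInt_gen_ext (fun y => 1 * f (y + c))).
  by apply: filter_forall => ab x _; rewrite Rmult_1_l.
refine (is_RInt_gen_subst f (fun y => y + c) (fun _ => 1) l _ _ _ Cf Hf).
- move=> P [M HM]. exists (M - c) => x Hx. apply: HM. lra.
- move=> P [M HM]. exists (M - c) => x Hx. apply: HM. lra.
- apply: filter_forall => ab x _; split; last by apply: continuous_const.
  auto_derive => //; ring.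
Qed.

Lemma filter_prod_le_mp :
  filter_prod (Rbar_locally m_infty) (Rbar_locally p_infty) (fun ab => fst ab <= snd ab).
Proof.
exists (fun x => x < 0) (fun x => 0 < x); [by exists 0 | by exists 0 | move=> x y /=; lra].
Qed.

Lemma filter_prod_le_ap (r : R) :
  filter_prod (at_point r) (Rbar_locally p_infty) (fun ab => fst ab <= snd ab).
Proof.
exists (fun x => x = r) (fun x => r < x); [done | by exists r | move=> x y /=; lra].
Qed.

Lemma integral_R_le (f g : R -> R) (lf lg : R) :
  (forall x, Rabs (f x) <= g x) -> integral_R f lf -> integral_R g lg -> Rabs lf <= lg.
Proof.
move=> H Hf Hg.
apply: (RInt_gen_norm (V := R_CompleteNormedModule) f g lf lg _ _ Hf Hg).
  exact: filter_prod_le_mp.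
by apply: filter_forall => ab x _; apply: H.
Qed.

Lemma ray_integral_le (r : R) (f g : R -> R) (lf lg : R) :
  (forall x, r <= x -> Rabs (f x) <= g x) ->
  is_RInt_gen f (at_point r) (Rbar_locally p_infty) lf ->
  is_RInt_gen g (at_point r) (Rbar_locally p_infty) lg -> Rabs lf <= lg.
Proof.
move=> H Hf Hg.
apply: (RInt_gen_norm (V := R_CompleteNormedModule) f g lf lg _ _ Hf Hg).
  exact: filter_prod_le_ap.
exists (fun x => x = r) (fun x => r < x); [done | by exists r |].
move=> x y /= -> _ z [Hz _]; exact: H.
Qed.

Lemma integral_R_unique (f : R -> R) (l l' : R) :
  integral_R f l -> integral_R f l' -> l = l'.
Proof.
move=> H H'. rewrite -(is_RInt_gen_unique (V := R_CompleteNormedModule) _ _ H).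
exact: (is_RInt_gen_unique (V := R_CompleteNormedModule) _ _ H').
Qed.

Lemma integral_R_ext (f g : R -> R) (l : R) :
  (forall x, f x = g x) -> integral_R f l -> integral_R g l.
Proof. move=> H. apply is_RInt_gen_ext. by apply: filter_forall => ab x _. Qed.

Lemma integral_R_plus (f g : R -> R) (lf lg : R) :
  integral_R f lf -> integral_R g lg -> integral_R (fun x => f x + g x) (lf + lg).
Proof. exact: is_RInt_gen_plus. Qed.

Lemma integral_R_minus (f g : R -> R) (lf lg : R) :
  integral_R f lf -> integral_R g lg -> integral_R (fun x => f x - g x) (lf - lg).
Proof. exact: is_RInt_gen_minus. Qed.

Lemma integral_R_scal (k : R) (f : R -> R) (l : R) :
  integral_R f l -> integral_R (fun x => k * f x) (k * l).
Proof. exact: (is_RInt_gen_scal f k l). Qed.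

Lemma filterlim_exp_p (e : R) : 0 < e ->
  filterlim (fun y => exp (e * y)) (Rbar_locally p_infty) (Rbar_locally p_infty).
Proof.
move=> He. apply: (filterlim_comp _ _ _ (fun y => e * y) exp _ (Rbar_locally p_infty)).
- move=> P [M HM]. exists (M / e) => x Hx. apply: HM.
  apply (Rmult_lt_compat_l e) in Hx => //. field_simplify in Hx; lra.
- exact: is_lim_exp_p.
Qed.

Lemma filterlim_exp_m (e : R) : 0 < e ->
  filterlim (fun y => exp (e * y)) (Rbar_locally m_infty) (locally 0).
Proof.
move=> He. apply: (filterlim_comp _ _ _ (fun y => e * y) exp _ (Rbar_locally m_infty)).
- move=> P [M HM]. exists (M / e) => x Hx. apply: HM.
  apply (Rmult_lt_compat_l e) in Hx => //. field_simplify in Hx; lra.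
- exact: is_lim_exp_m.
Qed.

(* Comparable to [exp (- b * |y|)], but with an elementary primitive on R. *)
Definition decay (b y : R) : R := / (exp (b * y / 2) + exp (- (b * y / 2))) ^ 2.

Lemma decay_den_pos (b y : R) : 0 < exp (b * y / 2) + exp (- (b * y / 2)).
Proof. have := exp_pos (b * y / 2). have := exp_pos (- (b * y / 2)). lra. Qed.

Lemma continuous_decay (b y : R) : continuous (decay b) y.
Proof.
apply: ex_derive_continuous. rewrite /decay. auto_derive.
have := decay_den_pos b y. nra.
Qed.

Lemma filterlim_decay_primitive_p (b : R) : 0 < b ->
  filterlim (fun y => - / (1 + exp (b * y)) / b) (Rbar_locally p_infty) (locally 0).
Proof.
move=> Hb. apply filterlim_locally => eps.
have [M HM] := filterlim_exp_p b Hb (fun x => / (b * eps) < x)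
  (ex_intro _ (/ (b * eps)) (fun x H => H)).
exists M => y /HM Hy. rewrite /ball /= /AbsRing_ball /abs /minus /plus /opp /=.
have He := cond_pos eps. have Hp := exp_pos (b * y).
rewrite (_ : - / (1 + exp (b * y)) / b + - 0 = - (/ (1 + exp (b * y)) / b)); last by rewrite /Rdiv; ring.
rewrite Rabs_Ropp Rabs_pos_eq.
2:{ apply: Rlt_le. apply: Rdiv_lt_0_compat => //. apply: Rinv_0_lt_compat. lra. }
have Hbe : 0 < b * eps by nra.
have H1 : / (1 + exp (b * y)) < b * eps.
{ rewrite -(Rinv_inv (b * eps)). apply: Rinv_lt_contravar; last lra.
  apply: Rmult_lt_0_compat; [exact: Rinv_0_lt_compat | lra]. }
apply: (Rmult_lt_reg_r b) => //. rewrite /Rdiv Rmult_assoc Rinv_l; lra.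
Qed.

Lemma filterlim_decay_primitive_m (b : R) : 0 < b ->
  filterlim (fun y => - / (1 + exp (b * y)) / b) (Rbar_locally m_infty) (locally (- / b)).
Proof.
move=> Hb.
have -> : - / b = - / (1 + 0) / b by field; lra.
apply: (filterlim_comp _ _ _ (fun y => exp (b * y)) (fun z => - / (1 + z) / b) _ (locally 0)).
  exact: filterlim_exp_m.
apply: (ex_derive_continuous (fun z => - / (1 + z) / b) 0). auto_derive. lra.
Qed.

Lemma decay_primitive (b y : R) : 0 < b ->
  is_derive (fun y => - / (1 + exp (b * y)) / b) y (decay b y).
Proof.
move=> Hb. have Hp := exp_pos (b * y). auto_derive; first lra.
rewrite /decay. have Hd := decay_den_pos b y.
have E : exp (b * y) = exp (b * y / 2) * exp (b * y / 2) by rewrite -exp_plus; f_equal; field.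
rewrite E (exp_Ropp (b * y / 2)). have H2 := exp_pos (b * y / 2).
field. repeat split; try lra; nra.
Qed.

Lemma integral_decay (b : R) : 0 < b -> integral_R (decay b) (/ b).
Proof.
move=> Hb. have -> : / b = 0 - (- / b) by ring.
apply (is_RInt_gen_primitive (fun y => - / (1 + exp (b * y)) / b)).
- move=> x. exact: decay_primitive.
- exact: continuous_decay.
- exact: filterlim_decay_primitive_m.
- exact: filterlim_decay_primitive_p.
Qed.

Lemma ex_ray_decay (b r : R) : 0 < b ->
  ex_RInt_gen (decay b) (at_point r) (Rbar_locally p_infty).
Proof.
move=> Hb. exists (0 - (- / (1 + exp (b * r)) / b)).
apply (is_RInt_gen_primitive (fun y => - / (1 + exp (b * y)) / b)).
- move=> x. exact: decay_primitive.
- exact: continuous_decay.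
- move=> P HP. exact: locally_singleton HP.
- exact: filterlim_decay_primitive_p.
Qed.

(** The first two hypotheses together say [v <= C e^(- |b y|)]; the factor 4 comes from
    [(p + q)^2 <= 2 (p^2 + q^2)] applied to the two exponentials in [decay]. *)
Lemma le_decay (b C y v : R) :
  v * exp (b * y) <= C -> v * exp (- (b * y)) <= C -> 0 <= v -> v <= 4 * C * decay b y.
Proof.
move=> H1 H2 Hv.
have Hd := decay_den_pos b y. rewrite /decay.
have E : exp (b * y) = exp (b * y / 2) ^ 2.
{ rewrite /= Rmult_1_r -exp_plus. f_equal. field. }
have E' : exp (- (b * y)) = exp (- (b * y / 2)) ^ 2.
{ rewrite /= Rmult_1_r -exp_plus. f_equal. field. }
rewrite E in H1. rewrite E' in H2.
move: Hd H1 H2. move: (exp (b * y / 2)) (exp (- (b * y / 2))) => p q Hd H1 H2.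
have Hpos : 0 < (p + q) ^ 2 by apply: pow_lt.
apply: (Rmult_le_reg_r ((p + q) ^ 2)) => //.
rewrite Rmult_assoc Rinv_l; last by lra.
have Hpq : (p + q) ^ 2 <= 2 * (p ^ 2 + q ^ 2) by (have := pow2_ge_0 (p - q)); lra.
apply: (Rle_trans _ (v * (2 * (p ^ 2 + q ^ 2)))); last lra.
exact: Rmult_le_compat_l.
Qed.

Lemma ex_integral_R_decay (f : R -> R) (b C : R) : 0 < b ->
  (forall y, continuous f y) ->
  (forall y, Rabs (f y) * exp (b * y) <= C) ->
  (forall y, Rabs (f y) * exp (- (b * y)) <= C) ->
  exists l, integral_R f l.
Proof.
move=> Hb Cf H1 H2.
apply: (ex_RInt_gen_dominated (fun _ => True) f (fun y => 4 * C * decay b y)) => //.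
- exact: filter_true.
- exact: filter_true.
- move=> x. apply: (continuous_scal_r (4 * C) (decay b)). exact: continuous_decay.
- move=> x _. apply: le_decay => //. exact: Rabs_pos.
- exists (4 * C * / b). apply: integral_R_scal. exact: integral_decay.
Qed.

Lemma ex_ray_integral_decay (f : R -> R) (r b C : R) : 0 < b ->
  (forall y, continuous f y) ->
  (forall y, r <= y -> Rabs (f y) <= C * decay b y) ->
  ex_RInt_gen f (at_point r) (Rbar_locally p_infty).
Proof.
move=> Hb Cf H1.
apply: (ex_RInt_gen_dominated (fun y => r <= y) f (fun y => C * decay b y)) => //.
- move=> x y z. lra.
- rewrite /at_point. lra.
- exists r. move=> x. lra.
- move=> x. apply: (continuous_scal_r C (decay b)). exact: continuous_decay.
- case: (ex_ray_decay b r Hb) => l Hl. exists (C * l). exact: (is_RInt_gen_scal (decay b) C l).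
Qed.

(** * Gamma function and reflection formula *)

Lemma exp_le (x y : R) : x <= y -> exp x <= exp y.
Proof. case=> [H|->]; [left; exact: exp_increasing | by right]. Qed.

(** The upper bound starts from [e^x - 1 <= x e^x], the tangent inequality at [- x] multiplied by
    [e^x]. *)
Lemma exp_taylor1 (x : R) : 0 <= exp x - 1 - x <= x ^ 2 * exp (Rabs x).
Proof.
have H0 := exp_ineq1_le x. split; first lra.
have H1 := exp_ineq1_le (- x). have Hp := exp_pos x.
have E : exp x * exp (- x) = 1 by rewrite -exp_plus Rplus_opp_r exp_0.
have H2 : exp x - 1 <= x * exp x by nra.
case: (Rle_dec 0 x) => Hx.
- rewrite Rabs_pos_eq //. nra.
- rewrite Rabs_left; last lra. have := exp_ineq1_le (- x). nra.
Qed.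

(** The maximum sits at [y = ln (k / p)], and the tangent inequality of [exp] at that point is
    enough; the constant chosen for [k > 0] overshoots the maximum by [k]. *)
Lemma exp_lin_bound (k p : R) : 0 <= k -> 0 < p ->
  exists C, forall y, k * y - p * exp y <= C.
Proof.
move=> Hk Hp. case: (Req_dec k 0) => [->|Hk0].
  exists 0 => y. have := exp_pos y. nra.
have Hk' : 0 < k / p by apply: Rdiv_lt_0_compat; lra.
exists (k * ln (k / p)) => y.
have H := exp_ineq1_le (y - ln (k / p)).
have E : exp y = exp (y - ln (k / p)) * (k / p).
{ rewrite -{2}(exp_ln (k / p)) // -exp_plus. f_equal. ring. }
rewrite E (_ : p * (exp (y - ln (k / p)) * (k / p)) = k * exp (y - ln (k / p))); last by field; lra.
nra.
Qed.

Lemma continuous_exp_lin (k p y : R) : continuous (fun y => exp (k * y - p * exp y)) y.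
Proof. apply: ex_derive_continuous. by auto_derive. Qed.

Lemma ex_integral_exp_lin (k p : R) : 0 < k -> 0 < p ->
  exists l, integral_R (fun y => exp (k * y - p * exp y)) l.
Proof.
move=> Hk Hp.
have [C1 H1] := exp_lin_bound (k + k / 2) p ltac:(lra) Hp.
have [C2 H2] := exp_lin_bound (k - k / 2) p ltac:(lra) Hp.
apply: (ex_integral_R_decay _ (k / 2) (exp (Rmax C1 C2))); first lra.
- move=> y. exact: continuous_exp_lin.
- move=> y. rewrite Rabs_pos_eq; last by apply: Rlt_le; apply: exp_pos.
  rewrite -exp_plus. apply: exp_le. have := Rmax_l C1 C2. have := H1 y. lra.
- move=> y. rewrite Rabs_pos_eq; last by apply: Rlt_le; apply: exp_pos.
  rewrite -exp_plus. apply: exp_le. have := Rmax_r C1 C2. have := H2 y. lra.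
Qed.

Lemma filterlim_ln_0 : filterlim ln (at_right 0) (Rbar_locally m_infty).
Proof. exact: is_lim_ln_0. Qed.

(** Substituting [e^y] for the variable of Euler's integral removes the singular endpoint: from here
    on, Gamma is an integral of a function continuous on the whole line. *)
Lemma Gamma_integral (s : R) : 0 < s ->
  integral_R (fun y => exp (s * y - exp y)) (Gamma s).
Proof.
move=> Hs.
have [l Hl] := ex_integral_exp_lin s 1 Hs Rlt_0_1.
have Hl' : integral_R (fun y => exp (s * y - exp y)) l.
{ apply: integral_R_ext Hl => x. by rewrite Rmult_1_l. }
suff -> : Gamma s = l by [].
refine (is_RInt_gen_unique (V := R_CompleteNormedModule) (fun x => Rpower x (s - 1) * exp (- x)) l _).
apply (is_RInt_gen_ext (fun x => / x * exp (s * ln x - exp (ln x)))).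
{ exists (fun x => 0 < x) (fun x => 0 < x).
  - exists (mkposreal 1 Rlt_0_1) => y _ //.
  - by exists 0.
  - move=> a b Ha Hb x [Hx _].
    have {}Hx : 0 < x. { move: Hx. rewrite /fst /snd /Rmin. case: Rle_dec; lra. }
    rewrite exp_ln // /Rpower.
    rewrite -{1}(exp_ln x) // -exp_Ropp -!exp_plus. f_equal. ring. }
refine (is_RInt_gen_subst (fun y => exp (s * y - exp y)) ln (fun x => / x) l _ _ _ _ Hl').
- exact: filterlim_ln_0.
- exact: is_lim_ln_p.
- exists (fun x => 0 < x) (fun x => 0 < x).
  - exists (mkposreal 1 Rlt_0_1) => y _ //.
  - by exists 0.
  - move=> a b Ha Hb x [Hx _].
    have {}Hx : 0 < x. { move: Hx. rewrite /fst /snd /Rmin. case: Rle_dec; lra. }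
    split; first by apply: is_derive_ln.
    apply: ex_derive_continuous. auto_derive. lra.
- move=> x. apply: ex_derive_continuous. by auto_derive.
Qed.

Lemma Gamma_integral_scaled (s p : R) : 0 < s -> 0 < p ->
  integral_R (fun y => exp (s * y - p * exp y)) (exp (- s * ln p) * Gamma s).
Proof.
move=> Hs Hp.
have H := integral_R_scal (exp (- s * ln p)) _ _ (integral_R_shift _ (ln p) _ _ (Gamma_integral s Hs)).
apply: integral_R_ext (H _) => x.
- rewrite -exp_plus exp_plus (exp_plus x) exp_ln //. rewrite -exp_plus.  f_equal. ring.
- apply: ex_derive_continuous. by auto_derive.
Qed.

Lemma filterlim_exp_lin_p (k : R) :
  filterlim (fun y => exp (k * y - exp y)) (Rbar_locally p_infty) (locally 0).
Proof.
have [C HC] := exp_lin_bound (Rabs k + 1) 1 ltac:(have := Rabs_pos k; lra) Rlt_0_1.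
have := filterlim_exp_m 1 Rlt_0_1 => Hm.
apply filterlim_locally => eps.
have He : 0 < eps / exp C by apply: Rdiv_lt_0_compat; [exact: cond_pos | exact: exp_pos].
have [M HM] := proj1 (filterlim_locally _ _) Hm (mkposreal _ He).
exists (Rmax (- M) 0) => y Hy.
have := Rmax_l (- M) 0. have := Rmax_r (- M) 0 => V1 V2.
have {HM} := HM (- y) ltac:(lra).
rewrite /ball /= /AbsRing_ball /abs /minus /plus /opp /= !Ropp_0 !Rplus_0_r.
rewrite !Rabs_pos_eq; try by apply: Rlt_le; apply: exp_pos.
move=> H. apply: (Rle_lt_trans _ (exp C * exp (1 * - y))).
- rewrite -exp_plus. apply: exp_le. have := HC y. have := Rle_abs k. nra.
- apply (Rmult_lt_compat_l (exp C)) in H; last exact: exp_pos.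
  apply: (Rlt_le_trans _ _ _ H). right. field. apply: Rgt_not_eq. exact: exp_pos.
Qed.

Lemma filterlim_exp_lin_m (k : R) : 0 < k ->
  filterlim (fun y => exp (k * y - exp y)) (Rbar_locally m_infty) (locally 0).
Proof.
move=> Hk. have Hm := filterlim_exp_m k Hk.
apply filterlim_locally => eps.
have [M HM] := proj1 (filterlim_locally _ _) Hm eps.
exists M => y Hy. have {HM} := HM y Hy.
rewrite /ball /= /AbsRing_ball /abs /minus /plus /opp /= !Ropp_0 !Rplus_0_r.
rewrite !Rabs_pos_eq; try by apply: Rlt_le; apply: exp_pos.
apply: Rle_lt_trans. apply: exp_le. have := exp_pos y. lra.
Qed.

(** Integration by parts in disguise: [e^(s y - e^y)] is a primitive of the difference of the two
    integrands and vanishes at both ends. *)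
Lemma Gamma_S (s : R) : 0 < s -> Gamma (s + 1) = s * Gamma s.
Proof.
move=> Hs.
have H1 := Gamma_integral (s + 1) ltac:(lra).
have H2 := integral_R_scal s _ _ (Gamma_integral s Hs).
have H3 := integral_R_minus _ _ _ _ H2 H1.
suff : s * Gamma s - Gamma (s + 1) = 0 - 0 by lra.
apply: (integral_R_unique _ _ _ H3).
apply (is_RInt_gen_primitive (fun y => exp (s * y - exp y))).
- move=> x. auto_derive => //.
  rewrite (_ : (s + 1) * x - exp x = (s * x - exp x) + x); last ring.
  rewrite (exp_plus _ x). rewrite /Rminus. ring.
- move=> x. apply: ex_derive_continuous. by auto_derive.
- exact: filterlim_exp_lin_m.
- exact: filterlim_exp_lin_p.
Qed.

(** * An integral interpolating between Gamma and beta *)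

Lemma exp_frac_le (k y : R) : 0 <= k <= 1 -> exp (k * y) <= 1 + exp y.
Proof.
move=> Hk. have := exp_pos y. case: (Rle_dec 0 y) => Hy.
- have : exp (k * y) <= exp y by apply: exp_le; nra. lra.
- have : exp (k * y) <= exp 0 by apply: exp_le; nra. rewrite exp_0. lra.
Qed.

(* [K p = int_R e^(s y - p e^y) / (1 + e^y) dy] interpolates between the beta
   integral [B] at [p = 0] and [0] at infinity, and
   [K - K' = Gamma(s) p^(-s)], so that [- e^(-p) K] is a primitive of
   [Gamma(s) p^(-s) e^(-p)]: this replaces Fubini in [Gamma(s) Gamma(1 - s) = B]. *)
Definition Kint (s p y : R) : R := exp (s * y - p * exp y) / (1 + exp y).

Lemma continuous_Kint (s p y : R) : continuous (Kint s p) y.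
Proof.
apply: ex_derive_continuous. rewrite /Kint. auto_derive.
have := exp_pos y. lra.
Qed.

Lemma Kint_pos (s p y : R) : 0 < Kint s p y.
Proof.
rewrite /Kint. apply: Rdiv_lt_0_compat; first exact: exp_pos.
have := exp_pos y. lra.
Qed.

Lemma Kint_le (s p y : R) : 0 <= p -> Kint s p y <= Kint s 0 y.
Proof.
move=> Hp. have Hy := exp_pos y. rewrite /Kint /Rdiv.
apply: Rmult_le_compat_r; first by apply: Rlt_le; apply: Rinv_0_lt_compat; lra.
apply: exp_le. nra.
Qed.

Lemma ex_Kint (s p : R) : 0 < s < 1 -> 0 <= p -> exists l, integral_R (Kint s p) l.
Proof.
move=> Hs Hp.
pose b := Rmin s (1 - s).
have Hb : 0 < b by rewrite /b /Rmin; case: Rle_dec; lra.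
have Hb1 : s - b >= 0 /\ s + b <= 1 by rewrite /b /Rmin; case: Rle_dec; lra.
have Haux c y : 0 <= s + c <= 1 -> Rabs (Kint s p y) * exp (c * y) <= 1.
{ move=> Hc. rewrite Rabs_pos_eq; last by apply: Rlt_le; apply: Kint_pos.
  have Hy := exp_pos y.
  apply: (Rle_trans _ (Kint s 0 y * exp (c * y))).
    apply: Rmult_le_compat_r; [exact: Rlt_le (exp_pos _) | exact: Kint_le].
  rewrite /Kint. apply: (Rmult_le_reg_r (1 + exp y)); first lra.
  rewrite Rmult_1_l.
  rewrite (_ : _ * (1 + exp y) = exp ((s + c) * y)); first exact: exp_frac_le.
  rewrite (_ : (s + c) * y = (s * y - 0 * exp y) + c * y); last ring.
  rewrite (exp_plus _ (c * y)). field. lra. }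
apply: (ex_integral_R_decay _ b 1) => //.
- move=> y. exact: continuous_Kint.
- move=> y. apply: Haux. lra.
- move=> y. rewrite (_ : - (b * y) = (- b) * y); last ring. apply: Haux. lra.
Qed.

(** Differentiation under the integral by a quadratic bound. With [E = e^y],
    [- E / (1 + E) = 1 / (1 + E) - 1], so the candidate derivative is [K p] minus a scaled Gamma
    integral. For [|h| <= p / 2] the second-order remainder loses at most half of the decay
    [e^(- p E)], hence the majorant [e^((s + 2) y - p E / 2)], whose extra [2 y] is the factor
    [E^2]. *)
Lemma Kint_derivative (s p : R) (K : R -> R) : 0 < s < 1 -> 0 < p ->
  (forall q, 0 <= q -> integral_R (Kint s q) (K q)) ->
  is_derive K p (K p - exp (- s * ln p) * Gamma s).
Proof.
move=> Hs Hp HK.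
have Hs0 : 0 < s by lra.
have [C HC] := ex_integral_exp_lin (s + 2) (p / 2) ltac:(lra) ltac:(lra).
have HG := Gamma_integral_scaled s p Hs0 Hp.
set d := K p - _.
have Hquad h : Rabs h <= p / 2 -> Rabs (K (p + h) - K p - h * d) <= h ^ 2 * C.
{ move=> Hh.
  have Hph : 0 <= p + h by move: Hh; split_Rabs; lra.
  have H1 := integral_R_minus _ _ _ _ (integral_R_minus _ _ _ _ (HK _ Hph) (HK p ltac:(lra)))
     (integral_R_scal h _ _ (integral_R_minus _ _ _ _ (HK p ltac:(lra)) HG)).
  apply: (integral_R_le _ _ _ _ _ H1 (integral_R_scal (h ^ 2) _ _ HC)) => y.
  have Hy := exp_pos y. set E := exp y in Hy *.
  have E1 : Kint s (p + h) y = exp (s * y - p * E) * exp (- (h * E)) / (1 + E).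
  { rewrite /Kint -/E -exp_plus. do 2 f_equal. ring. }
  rewrite E1 /Kint -/E.
  have -> : exp (s * y - p * E) * exp (- (h * E)) / (1 + E) - exp (s * y - p * E) / (1 + E) -
     h * (exp (s * y - p * E) / (1 + E) - exp (s * y - p * E)) =
     exp (s * y - p * E) * ((exp (- (h * E)) - 1 - - (h * E)) / (1 + E)).
  { field. lra. }
  have [T1 T2] := exp_taylor1 (- (h * E)).
  have Hi : 0 < / (1 + E) <= 1.
  { split; first by apply: Rinv_0_lt_compat; lra.
    rewrite -[1 in X in _ <= X]Rinv_1. apply: Rinv_le_contravar; lra. }
  rewrite Rabs_mult Rabs_pos_eq; last by apply: Rlt_le; apply: exp_pos.
  have -> : exp ((s + 2) * y - p / 2 * E) = exp (s * y - p * E) * (E ^ 2 * exp (p / 2 * E)).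
  { rewrite /E /= Rmult_1_r -!exp_plus. f_equal. lra. }
  have Hx := exp_pos (s * y - p * E).
  rewrite -Rmult_assoc (Rmult_comm (h ^ 2)) Rmult_assoc.
  apply: Rmult_le_compat_l; first lra.
  rewrite /Rdiv Rabs_pos_eq; last by apply: Rmult_le_pos; lra.
  apply: (Rle_trans _ ((- (h * E)) ^ 2 * exp (Rabs (- (h * E))))); first nra.
  rewrite (_ : (- (h * E)) ^ 2 = h ^ 2 * E ^ 2); last ring.
  rewrite Rmult_assoc. apply: Rmult_le_compat_l; first exact: pow2_ge_0.
  apply: Rmult_le_compat_l; first exact: pow2_ge_0.
  apply: exp_le. rewrite Rabs_Ropp Rabs_mult (Rabs_pos_eq E); last lra.
  apply: Rmult_le_compat_r; lra. }
apply is_derive_Reals. move=> eps Heps.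
have Hd : 0 < Rmin (p / 2) (eps / (2 * (Rabs C + 1))).
{ apply: Rmin_pos; first lra. apply: Rdiv_lt_0_compat => //. have := Rabs_pos C. lra. }
exists (mkposreal _ Hd) => h Hh0 /= Hh.
have Hh1 := Rlt_le_trans _ _ _ Hh (Rmin_l _ _).
have Hh2 := Rlt_le_trans _ _ _ Hh (Rmin_r _ _).
have := Hquad h ltac:(lra).
have -> : (K (p + h) - K p) / h - d = (K (p + h) - K p - h * d) / h by field.
rewrite Rabs_div // => Hq.
have Hah := Rabs_pos_lt h Hh0.
apply: (Rmult_lt_reg_r (Rabs h)) => //.
rewrite /Rdiv Rmult_assoc Rinv_l; last lra.
rewrite Rmult_1_r. apply: (Rle_lt_trans _ _ _ Hq).
rewrite -(pow2_abs h) /= Rmult_1_r.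
have HCp := Rabs_pos C. have HC1 := Rle_abs C.
have H3 : Rabs h * (2 * (Rabs C + 1)) < eps.
{ apply (Rmult_lt_compat_r (2 * (Rabs C + 1))) in Hh2; last lra.
  move: Hh2. rewrite /Rdiv Rmult_assoc Rinv_l; lra. }
have H4 : Rabs h * C < eps by nra.
rewrite (_ : Rabs h * Rabs h * C = (Rabs h * C) * Rabs h); last ring.
exact: Rmult_lt_compat_r.
Qed.

(** * Cauchy's theorem on rectangles, in real and imaginary parts *)

Lemma continuity_2d_pt_fst (f : R -> R -> R) (x y : R) :
  continuity_2d_pt f x y -> continuous (fun u => f u y) x.
Proof.
move=> H. apply filterlim_locally => eps.
have [d Hd] := H eps. exists d => u Hu. apply: Hd => //.
rewrite Rminus_diag Rabs_R0. exact: cond_pos.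
Qed.

Lemma continuity_2d_pt_snd (f : R -> R -> R) (x y : R) :
  continuity_2d_pt f x y -> continuous (fun v => f x v) y.
Proof.
move=> H. apply filterlim_locally => eps.
have [d Hd] := H eps. exists d => u Hu. apply: Hd => //.
rewrite Rminus_diag Rabs_R0. exact: cond_pos.
Qed.

(** Since [dP/dr = D = dQ/dt], the integral of [P] over a vertical side has [r]-derivative
    [Q r d - Q r c], which is then integrated in [r]. The open strip [c' < t < d'] around the
    rectangle leaves room for differentiating under the integral. *)
Lemma green_rectangle (P Q D : R -> R -> R) (a b c d c' d' : R) :
  c' < c -> c <= d -> d < d' ->
  (forall r t, c' < t < d' -> is_derive (fun u => P u t) r (D r t)) ->
  (forall r t, c' < t < d' -> is_derive (fun v => Q r v) t (D r t)) ->
  (forall r t, c' < t < d' -> continuity_2d_pt D r t) ->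
  (forall r t, c' < t < d' -> continuous (fun v => P r v) t) ->
  (forall r t, c' < t < d' -> continuous (fun u => Q u t) r) ->
  RInt (fun t => P b t) c d - RInt (fun t => P a t) c d =
  RInt (fun y => Q y d) a b - RInt (fun y => Q y c) a b.
Proof.
move=> Hc Hcd Hd HP HQ HD CP CQ.
have Ht t : Rmin c d <= t <= Rmax c d -> c' < t < d' by rewrite Rmin_left // Rmax_right //; lra.
have EP r : ex_RInt (fun t => P r t) c d.
{ apply: (ex_RInt_continuous (V := R_CompleteNormedModule)) => t /Ht H. exact: CP. }
have EQ t r s : c' < t < d' -> ex_RInt (fun y => Q y t) r s.
{ move=> H. apply: (ex_RInt_continuous (V := R_CompleteNormedModule)) => y _. exact: CQ. }
have H1 r : is_derive (fun r => RInt (fun t => P r t) c d) r (Q r d - Q r c).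
{ have -> : Q r d - Q r c = RInt (fun t => Derive (fun u => P u t) r) c d.
  { symmetry. apply: is_RInt_unique.
    apply: (is_RInt_ext (fun t => D r t)).
    { move=> t [H0 H0']. symmetry. apply: is_derive_unique. apply: HP. apply: Ht. lra. }
    apply: (is_RInt_derive (V := R_CompleteNormedModule) (fun t => Q r t)).
    - move=> t /Ht H. exact: HQ.
    - move=> t /Ht H. apply: continuity_2d_pt_snd. exact: HD. }
  apply: is_derive_RInt_param.
  - apply: filter_forall => u t /Ht H. exists (D u t). exact: HP.
  - move=> t /Ht H. apply: (continuity_2d_pt_ext_loc D); last exact: HD.
    have He : 0 < Rmin (t - c') (d' - t) by apply: Rmin_pos; lra.
    exists (mkposreal _ He) => u v /= _ Hv. symmetry. apply: is_derive_unique. apply: HP.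
    have := Rmin_l (t - c') (d' - t). have := Rmin_r (t - c') (d' - t).
    move: Hv. split_Rabs; lra.
  - by apply: filter_forall. }
have H2 : is_RInt (fun r => Q r d - Q r c) a b (RInt (fun t => P b t) c d - RInt (fun t => P a t) c d).
{ apply: (is_RInt_derive (V := R_CompleteNormedModule) (fun r => RInt (fun t => P r t) c d)).
  - move=> r _. exact: H1.
  - move=> r _. apply: (continuous_minus (V := R_NormedModule)); apply: CQ; lra. }
rewrite -(is_RInt_unique _ _ _ _ H2).
rewrite (RInt_minus (V := R_CompleteNormedModule)) //; apply: EQ; lra.
Qed.

(* Real and imaginary parts, at [w = r + i t], of
   [exp (l e^w + k w) / (1 + q e^(a w))]. *)
Definition dRe (q a r t : R) : R := 1 + q * exp (a * r) * cos (a * t).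
Definition dIm (q a r t : R) : R := q * exp (a * r) * sin (a * t).
Definition dSq (q a r t : R) : R := dRe q a r t * dRe q a r t + dIm q a r t * dIm q a r t.
Definition gMod (l k r t : R) : R := exp (l * exp r * cos t + k * r).
Definition gArg (l k r t : R) : R := l * exp r * sin t + k * t.
Definition gRe (l k q a r t : R) : R :=
  gMod l k r t * (dRe q a r t * cos (gArg l k r t) + dIm q a r t * sin (gArg l k r t)) / dSq q a r t.
Definition gIm (l k q a r t : R) : R :=
  gMod l k r t * (dRe q a r t * sin (gArg l k r t) - dIm q a r t * cos (gArg l k r t)) / dSq q a r t.

(* The logarithmic derivative of that function is
   [l e^w + k - q a e^(a w) / (1 + q e^(a w))]. *)
Definition lRe (l k q a r t : R) : R :=
  l * exp r * cos t + k
  - a * (dRe q a r t * dRe q a r t - dRe q a r t + dIm q a r t * dIm q a r t) / dSq q a r t.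
Definition lIm (l k q a r t : R) : R :=
  l * exp r * sin t - a * dIm q a r t / dSq q a r t.

Definition hRe (l k q a r t : R) : R :=
  gRe l k q a r t * lRe l k q a r t - gIm l k q a r t * lIm l k q a r t.
Definition hIm (l k q a r t : R) : R :=
  gRe l k q a r t * lIm l k q a r t + gIm l k q a r t * lRe l k q a r t.

Ltac unfold_g :=
  rewrite /hRe /hIm /lRe /lIm /gRe /gIm /gMod /gArg /dSq /dRe /dIm.

(** With [h] the derivative of [g] in [w = r + i t], the derivative along [r] is [h] and along [t]
    is [i h]. This lemma and the next three are thus the Cauchy-Riemann equations of [gRe] and
    [gIm]. *)
Lemma is_derive_gRe_r (l k q a r t : R) : dSq q a r t <> 0 ->
  is_derive (fun u => gRe l k q a u t) r (hRe l k q a r t).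
Proof.
rewrite /dSq /dRe /dIm => H. unfold_g. auto_derive; first by [].
field. by [].
Qed.

Lemma is_derive_gIm_r (l k q a r t : R) : dSq q a r t <> 0 ->
  is_derive (fun u => gIm l k q a u t) r (hIm l k q a r t).
Proof.
rewrite /dSq /dRe /dIm => H. unfold_g. auto_derive; first by [].
field. by [].
Qed.

Lemma is_derive_gIm_t (l k q a r t : R) : dSq q a r t <> 0 ->
  is_derive (fun u => gIm l k q a r u) t (hRe l k q a r t).
Proof.
rewrite /dSq /dRe /dIm => H. unfold_g. auto_derive; first by [].
field. by [].
Qed.

Lemma is_derive_gRe_t (l k q a r t : R) : dSq q a r t <> 0 ->
  is_derive (fun u => gRe l k q a r u) t (- hIm l k q a r t).
Proof.
rewrite /dSq /dRe /dIm => H. unfold_g. auto_derive; first by [].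
field. by [].
Qed.

Ltac cont2d :=
  repeat first
   [ apply continuity_2d_pt_const | apply continuity_2d_pt_id1 | apply continuity_2d_pt_id2
   | apply continuity_2d_pt_plus | apply continuity_2d_pt_minus | apply continuity_2d_pt_mult
   | apply continuity_2d_pt_opp
   | apply continuity_2d_pt_inv
   | apply (continuity_1d_2d_pt_comp exp); [apply derivable_continuous_pt; apply derivable_pt_exp |]
   | apply (continuity_1d_2d_pt_comp cos); [apply derivable_continuous_pt; apply derivable_pt_cos |]
   | apply (continuity_1d_2d_pt_comp sin); [apply derivable_continuous_pt; apply derivable_pt_sin |]
   ].

Lemma continuity_hRe (l k q a r t : R) : dSq q a r t <> 0 ->
  continuity_2d_pt (hRe l k q a) r t.
Proof. rewrite /dSq /dRe /dIm => H. unfold_g. rewrite /Rdiv. cont2d; exact: H. Qed.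

Lemma continuity_hIm (l k q a r t : R) : dSq q a r t <> 0 ->
  continuity_2d_pt (hIm l k q a) r t.
Proof. rewrite /dSq /dRe /dIm => H. unfold_g. rewrite /Rdiv. cont2d; exact: H. Qed.

Lemma integral_R_reflect (f : R -> R) (l : R) :
  (forall x, continuous f x) -> integral_R f l -> integral_R (fun y => f (- y)) l.
Proof.
move=> Cf Hf.
have H1 : is_RInt_gen f (Rbar_locally p_infty) (Rbar_locally m_infty) (- l).
{ exact: (is_RInt_gen_swap f l Hf). }
have H2 : integral_R (fun y => -1 * f (- y)) (- l).
{ refine (is_RInt_gen_subst f Ropp (fun _ => -1) (- l) _ _ _ Cf H1).
  - move=> P [M HM]. exists (- M) => x Hx. apply: HM. lra.
  - move=> P [M HM]. exists (- M) => x Hx. apply: HM. lra.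
  - apply: filter_forall => ab x _; split; last by apply: continuous_const.
    auto_derive => //; ring. }
have H3 := integral_R_scal (-1) _ _ H2.
rewrite (_ : l = -1 * - l); last ring.
apply: integral_R_ext H3 => x. ring.
Qed.

(* The function [e^(s w) / (1 - e^w)], with poles at [0] and [2 i pi]. *)
Lemma beta_dSq (r t : R) : dSq (-1) 1 r t = 1 - 2 * exp r * cos t + exp r ^ 2.
Proof.
rewrite /dSq /dRe /dIm !Rmult_1_l.
have := sin2_cos2 t. rewrite /Rsqr => H. nra.
Qed.

(** With [R = e^r], [1 - 2 R cos t + R^2] equals [(1 - cos t) (1 + R)^2 / 2 + (1 + cos t) (1 - R)^2
    / 2]. *)
Lemma beta_dSq_ge (r t : R) : (1 - cos t) / 2 * (1 + exp r) ^ 2 <= dSq (-1) 1 r t.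
Proof.
rewrite beta_dSq. have [H1 H2] := COS_bound t. have := pow2_ge_0 (1 - exp r). nra.
Qed.

Lemma beta_dSq_pos (r t : R) : 0 < t < 2 * PI -> 0 < dSq (-1) 1 r t.
Proof.
move=> Ht. apply: Rlt_le_trans (beta_dSq_ge r t). have := exp_pos r => Hr.
have Hc : cos t < 1.
{ have H := cos_2a_sin (t / 2). rewrite (_ : 2 * (t / 2) = t) in H; last field.
  have : 0 < sin (t / 2) by apply: sin_gt_0; lra. nra. }
apply: Rmult_lt_0_compat; first lra. apply: pow_lt. lra.
Qed.

Lemma beta_bound (s r t c : R) : cos t <= c -> c < 1 ->
  Rabs (gRe 0 s (-1) 1 r t) <= 4 / (1 - c) * Kint s 0 r /\
  Rabs (gIm 0 s (-1) 1 r t) <= 4 / (1 - c) * Kint s 0 r.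
Proof.
move=> Ht Hc.
have HD := beta_dSq_ge r t. have Hr := exp_pos r.
have HD0 : 0 < (1 - c) / 2 * (1 + exp r) ^ 2.
{ apply: Rmult_lt_0_compat; first lra. apply: pow_lt. lra. }
have HD1 : (1 - c) / 2 * (1 + exp r) ^ 2 <= dSq (-1) 1 r t.
{ apply: Rle_trans HD. apply: Rmult_le_compat_r; last lra. apply: pow2_ge_0. }
have HA : Rabs (dRe (-1) 1 r t) <= 1 + exp r.
{ rewrite /dRe !Rmult_1_l. have := COS_bound t. split_Rabs; nra. }
have HB : Rabs (dIm (-1) 1 r t) <= 1 + exp r.
{ rewrite /dIm !Rmult_1_l. have := SIN_bound t. split_Rabs; nra. }
have Haux u v : Rabs u <= 1 -> Rabs v <= 1 ->
  Rabs (gMod 0 s r t * (dRe (-1) 1 r t * u + dIm (-1) 1 r t * v) / dSq (-1) 1 r t)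
    <= 4 / (1 - c) * Kint s 0 r.
{ move=> Hu Hv.
  have HN : gMod 0 s r t = exp (s * r) by rewrite /gMod; f_equal; ring.
  have Hs := exp_pos (s * r).
  rewrite Rabs_div; last lra. rewrite Rabs_mult HN (Rabs_pos_eq (exp _)); last lra.
  rewrite (Rabs_pos_eq (dSq _ _ _ _)); last lra.
  have H1 : Rabs (dRe (-1) 1 r t * u + dIm (-1) 1 r t * v) <= 2 * (1 + exp r).
  { apply: Rle_trans (Rabs_triang _ _) _. rewrite (Rabs_mult _ u) (Rabs_mult _ v).
    have U1 := Rmult_le_compat _ _ _ _ (Rabs_pos _) (Rabs_pos _) HA Hu.
    have U2 := Rmult_le_compat _ _ _ _ (Rabs_pos _) (Rabs_pos _) HB Hv.
    lra. }
  apply: (Rle_trans _ (exp (s * r) * (2 * (1 + exp r)) / ((1 - c) / 2 * (1 + exp r) ^ 2))).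
  - apply: Rmult_le_compat.
    + apply: Rmult_le_pos; [lra | exact: Rabs_pos].
    + apply: Rlt_le. apply: Rinv_0_lt_compat. lra.
    + apply: Rmult_le_compat_l => //. lra.
    + apply: Rinv_le_contravar; lra.
  - right. rewrite /Kint (_ : s * r - 0 * exp r = s * r); last ring. field. lra. }
have Hcs x : Rabs (cos x) <= 1 by have := COS_bound x; split_Rabs; lra.
have Hsn x : Rabs (sin x) <= 1 by have := SIN_bound x; split_Rabs; lra.
split; first exact: Haux.
rewrite /gIm. rewrite (_ : _ - _ = dRe (-1) 1 r t * sin (gArg 0 s r t) + dIm (-1) 1 r t * - cos (gArg 0 s r t)); last ring.
apply: Haux => //. by rewrite Rabs_Ropp.
Qed.

Lemma continuous_gRe_r (l k q a r t : R) : dSq q a r t <> 0 -> continuous (fun u => gRe l k q a u t) r.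
Proof. move=> H. apply: ex_derive_continuous. eexists. exact: is_derive_gRe_r. Qed.
Lemma continuous_gIm_r (l k q a r t : R) : dSq q a r t <> 0 -> continuous (fun u => gIm l k q a u t) r.
Proof. move=> H. apply: ex_derive_continuous. eexists. exact: is_derive_gIm_r. Qed.
Lemma continuous_gRe_t (l k q a r t : R) : dSq q a r t <> 0 -> continuous (fun u => gRe l k q a r u) t.
Proof. move=> H. apply: ex_derive_continuous. eexists. exact: is_derive_gRe_t. Qed.
Lemma continuous_gIm_t (l k q a r t : R) : dSq q a r t <> 0 -> continuous (fun u => gIm l k q a r u) t.
Proof. move=> H. apply: ex_derive_continuous. eexists. exact: is_derive_gIm_t. Qed.

(** [green_rectangle] is applied to the pair [gRe], [gIm] and to the pair [gIm], [- gRe]: the two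
    parts of Cauchy's theorem. *)
Lemma g_rectangle (l k q a y1 y2 c d c' d' : R) :
  c' < c -> c <= d -> d < d' ->
  (forall r t, c' < t < d' -> dSq q a r t <> 0) ->
  RInt (fun t => gRe l k q a y2 t) c d - RInt (fun t => gRe l k q a y1 t) c d =
  RInt (fun y => gIm l k q a y d) y1 y2 - RInt (fun y => gIm l k q a y c) y1 y2
  /\
  RInt (fun t => gIm l k q a y2 t) c d - RInt (fun t => gIm l k q a y1 t) c d =
  RInt (fun y => gRe l k q a y c) y1 y2 - RInt (fun y => gRe l k q a y d) y1 y2.
Proof.
move=> Hc Hcd Hd HD. split.
- apply: (green_rectangle _ _ (hRe l k q a) y1 y2 c d c' d') => // r t /HD H.
  + exact: is_derive_gRe_r.
  + exact: is_derive_gIm_t.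
  + exact: continuity_hRe.
  + exact: continuous_gRe_t.
  + exact: continuous_gIm_r.
- have E r t : c' < t < d' -> ex_RInt (fun y => gRe l k q a y t) r y2.
  { move=> H. apply: (ex_RInt_continuous (V := R_CompleteNormedModule)) => y _.
    apply: continuous_gRe_r. exact: HD. }
  rewrite (green_rectangle (gIm l k q a) (fun r t => - gRe l k q a r t) (hIm l k q a) y1 y2 c d c' d') //.
  + rewrite !(RInt_opp (V := R_CompleteNormedModule)); try apply: E; try lra.
    rewrite /opp /=. ring.
  + move=> r t /HD H1. exact: is_derive_gIm_r.
  + move=> r t /HD H1. rewrite -(Ropp_involutive (hIm l k q a r t)).
    apply: (is_derive_opp (V := R_NormedModule)). exact: is_derive_gRe_t.
  + move=> r t /HD H1. exact: continuity_hIm.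
  + move=> r t /HD H1. exact: continuous_gIm_t.
  + move=> r t /HD H1. apply: (continuous_opp (V := R_NormedModule)). exact: continuous_gRe_r.
Qed.

Lemma integral_R_lim (f : R -> R) (l : R) : (forall x, continuous f x) -> integral_R f l ->
  is_lim_seq (fun n => RInt f (- INR n) (INR n)) l.
Proof.
move=> Cf Hf P HP.
have [Q1 Q2 [M1 H1] [M2 H2] H] := Hf P HP.
have [N HN] := INR_unbounded (Rmax (- M1) M2).
exists N => n Hn.
have Hn' : INR N <= INR n by apply: le_INR.
have := Rmax_l (- M1) M2. have := Rmax_r (- M1) M2 => Ha Hb.
have [y [Hy1 Hy2]] := H (- INR n) (INR n) (H1 (- INR n) ltac:(lra)) (H2 (INR n) ltac:(lra)).
by rewrite (is_RInt_unique _ _ _ _ Hy1).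
Qed.

Lemma is_lim_seq_exp_INR (b : R) : 0 < b -> is_lim_seq (fun n => exp (- b * INR n)) 0.
Proof.
move=> Hb.
apply: (is_lim_seq_ext (fun n => exp (b * - INR n))); first by move=> n; f_equal; ring.
apply: (filterlim_comp _ _ _ (fun n => - INR n) (fun y => exp (b * y)) _ (Rbar_locally m_infty)).
- exact (proj1 (is_lim_seq_opp _ p_infty) is_lim_seq_INR).
- exact: filterlim_exp_m.
Qed.

Lemma Kint0_le_exp (s y : R) : 0 < s < 1 ->
  Kint s 0 y <= exp (- (Rmin s (1 - s)) * Rabs y).
Proof.
move=> Hs. have Hy := exp_pos y. rewrite /Kint.
apply: (Rmult_le_reg_r (1 + exp y)); first lra.
rewrite /Rdiv Rmult_assoc Rinv_l; last lra. rewrite Rmult_1_r.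
have Hm1 := Rmin_l s (1 - s). have Hm2 := Rmin_r s (1 - s).
have He := exp_pos (- Rmin s (1 - s) * Rabs y).
case: (Rle_dec 0 y) => H.
- rewrite Rabs_pos_eq // in He *. apply: (Rle_trans _ (exp (- Rmin s (1 - s) * y) * exp y)).
  + rewrite -exp_plus. apply: exp_le. nra.
  + nra.
- rewrite Rabs_left in He *; last lra. apply: (Rle_trans _ (exp (- Rmin s (1 - s) * - y) * 1)).
  + rewrite Rmult_1_r. apply: exp_le. nra.
  + nra.
Qed.

Lemma ex_integral_beta (s t : R) (B : R) : 0 < s < 1 -> integral_R (Kint s 0) B -> 0 < t <= PI ->
  exists lr li, integral_R (fun y => gRe 0 s (-1) 1 y t) lr /\ integral_R (fun y => gIm 0 s (-1) 1 y t) li.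
Proof.
move=> Hs HB Ht.
have HD r : dSq (-1) 1 r t <> 0. { have := beta_dSq_pos r t ltac:(have := PI_RGT_0; lra). lra. }
have Hc : cos t < 1. { rewrite -cos_0. apply: cos_decreasing_1; lra. }
have H (f : R -> R) : (forall y, continuous f y) -> (forall y, Rabs (f y) <= 4 / (1 - cos t) * Kint s 0 y) ->
   exists l, integral_R f l.
{ move=> Cf Hf.
  apply: (ex_RInt_gen_dominated (fun _ => True) f (fun y => 4 / (1 - cos t) * Kint s 0 y)) => //.
  - exact: filter_true.
  - exact: filter_true.
  - move=> x. apply: (continuous_scal_r _ (Kint s 0)). exact: continuous_Kint.
  - exists (4 / (1 - cos t) * B). exact: integral_R_scal. }
have [lr Hr] := H (fun y => gRe 0 s (-1) 1 y t) (fun y => continuous_gRe_r _ _ _ _ _ _ (HD y))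
  (fun y => proj1 (beta_bound s y t (cos t) (Rle_refl _) Hc)).
have [li Hi] := H (fun y => gIm 0 s (-1) 1 y t) (fun y => continuous_gIm_r _ _ _ _ _ _ (HD y))
  (fun y => proj2 (beta_bound s y t (cos t) (Rle_refl _) Hc)).
by exists lr, li.
Qed.

(** The line at height [t] is moved up to height [PI] without meeting the poles [0] and [2 i pi].
    The vertical sides at abscissae [n] and [- n] are [O(e^(- b n))] with [b = min (s, 1 - s)]. *)
Lemma beta_line_shift (s t lr li lr' li' : R) : 0 < s < 1 -> 0 < t <= PI ->
  integral_R (fun y => gRe 0 s (-1) 1 y t) lr -> integral_R (fun y => gIm 0 s (-1) 1 y t) li ->
  integral_R (fun y => gRe 0 s (-1) 1 y PI) lr' -> integral_R (fun y => gIm 0 s (-1) 1 y PI) li' ->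
  lr = lr' /\ li = li'.
Proof.
move=> Hs Ht Hr Hi Hr' Hi'. have HPI := PI_RGT_0.
have HD u v : 0 < v < 2 * PI -> dSq (-1) 1 u v <> 0. { move=> Hv. have := beta_dSq_pos u v Hv. lra. }
have Hc : cos t < 1. { rewrite -cos_0. apply: cos_decreasing_1; lra. }
set b := Rmin s (1 - s).
have Hb : 0 < b by apply: Rmin_pos; lra.
have Hct v : t <= v <= PI -> cos v <= cos t. { move=> Hv. apply: cos_decr_1; lra. }
have small (f : R -> R -> R) :
  (forall u v, 0 < v < 2 * PI -> continuous (f u) v) ->
  (forall u v, t <= v <= PI -> Rabs (f u v) <= 4 / (1 - cos t) * Kint s 0 u) ->
  is_lim_seq (fun n => RInt (f (INR n)) t PI - RInt (f (- INR n)) t PI) 0.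
{ move=> Cf Hf.
  have H1 u : Rabs (RInt (f u) t PI) <= (PI - t) * (4 / (1 - cos t) * exp (- b * Rabs u)).
  { have HI : ex_RInt (f u) t PI.
    { apply: (ex_RInt_continuous (V := R_CompleteNormedModule)) => v Hv. apply: Cf.
      move: Hv. rewrite Rmin_left ?Rmax_right; lra. }
    apply: (norm_RInt_le_const (V := R_NormedModule) (f u)); first lra; last first.
    - exact: (RInt_correct (V := R_CompleteNormedModule)).
    - move=> v Hv. apply: Rle_trans (Hf u v Hv) _. apply: Rmult_le_compat_l.
      + apply: Rlt_le. apply: Rdiv_lt_0_compat; lra.
      + exact: Kint0_le_exp. }
  apply: (is_lim_seq_le_le (fun n => - (2 * ((PI - t) * (4 / (1 - cos t))) * exp (- b * INR n))) _
     (fun n => 2 * ((PI - t) * (4 / (1 - cos t))) * exp (- b * INR n))).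
  - move=> n. have := H1 (INR n). have := H1 (- INR n).
    rewrite Rabs_Ropp (Rabs_pos_eq (INR n)); last exact: pos_INR.
    rewrite -(Rmult_assoc (PI - t)) (Rmult_assoc 2).
    move=> /Rabs_le_between V1 /Rabs_le_between V2. split; lra.
  - rewrite -[Finite 0]/(Finite (0)) -Ropp_0. apply (is_lim_seq_opp _ 0).
    have := is_lim_seq_scal_l _ (2 * ((PI - t) * (4 / (1 - cos t)))) _ (is_lim_seq_exp_INR b Hb).
    by rewrite /= Rmult_0_r.
  - have := is_lim_seq_scal_l _ (2 * ((PI - t) * (4 / (1 - cos t)))) _ (is_lim_seq_exp_INR b Hb).
    by rewrite /= Rmult_0_r. }
have Hg n := g_rectangle 0 s (-1) 1 (- INR n) (INR n) t PI 0 (2 * PI) ltac:(lra) ltac:(lra) ltac:(lra) HD.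
have CI v : 0 < v < 2 * PI -> forall u, continuous (fun y => gIm 0 s (-1) 1 y v) u.
{ move=> Hv u. apply: continuous_gIm_r. exact: HD. }
have CR v : 0 < v < 2 * PI -> forall u, continuous (fun y => gRe 0 s (-1) 1 y v) u.
{ move=> Hv u. apply: continuous_gRe_r. exact: HD. }
have L1 := is_lim_seq_minus' _ _ _ _ (integral_R_lim _ _ (CI PI ltac:(lra)) Hi') (integral_R_lim _ _ (CI t ltac:(lra)) Hi).
have L2 := is_lim_seq_minus' _ _ _ _ (integral_R_lim _ _ (CR t ltac:(lra)) Hr) (integral_R_lim _ _ (CR PI ltac:(lra)) Hr').
have S1 := small (gRe 0 s (-1) 1) (fun u v Hv => continuous_gRe_t 0 s (-1) 1 u v (HD u v Hv))
  (fun u v Hv => proj1 (beta_bound s u v _ (Hct v Hv) Hc)).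
have S2 := small (gIm 0 s (-1) 1) (fun u v Hv => continuous_gIm_t 0 s (-1) 1 u v (HD u v Hv))
  (fun u v Hv => proj2 (beta_bound s u v _ (Hct v Hv) Hc)).
have E1 := is_lim_seq_ext _ _ _ (fun n => proj1 (Hg n)) S1.
have E2 := is_lim_seq_ext _ _ _ (fun n => proj2 (Hg n)) S2.
have := is_lim_seq_unique _ _ E1. rewrite (is_lim_seq_unique _ _ L1) => [[]] U1.
have := is_lim_seq_unique _ _ E2. rewrite (is_lim_seq_unique _ _ L2) => [[]] U2.
lra.
Qed.

(** * Value of the beta integral by a Poisson kernel *)

Lemma continuous_ge_0_right (f : R -> R) (d : R) : 0 < d -> continuous f 0 ->
  (forall t, 0 < t < d -> 0 <= f t) -> 0 <= f 0.
Proof.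
move=> Hd Cf Hf. case: (Rle_dec 0 (f 0)) => // H.
have He : 0 < - f 0 by lra.
have [e He'] := proj1 (filterlim_locally _ _) Cf (mkposreal _ He).
have Hm : 0 < Rmin (e / 2) (d / 2) by apply: Rmin_pos; [have := cond_pos e|]; lra.
have H1 := Rmin_l (e / 2) (d / 2). have H2 := Rmin_r (e / 2) (d / 2).
have H3 := Hf (Rmin (e / 2) (d / 2)) ltac:(lra).
have := He' (Rmin (e / 2) (d / 2)).
rewrite /ball /= /AbsRing_ball /abs /minus /plus /opp /= Ropp_0 Rplus_0_r (Rabs_pos_eq _ (Rlt_le _ _ Hm)) => H4.
have {H4} := H4 ltac:(have := cond_pos e; lra).
split_Rabs; lra.
Qed.

(** This is [Im (1 / (1 - e^w))] at [w = y + i t]. As [t] tends to 0 from above it concentrates at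
    [y = 0], its mass [PI - t] tending to [PI]. *)
Definition poisson (t y : R) : R := sin t / (exp y + exp (- y) - 2 * cos t).

Lemma poisson_den (t y : R) : 0 < t < PI -> 0 < exp y + exp (- y) - 2 * cos t.
Proof.
move=> Ht. have Hc : cos t < 1. { rewrite -cos_0. apply: cos_decreasing_1; lra. }
have Hy := exp_pos y. rewrite exp_Ropp.
have Hi : 0 < / exp y by apply: Rinv_0_lt_compat.
have : exp y * / exp y = 1 by apply: Rinv_r; lra.
move=> H. have := pow2_ge_0 (exp y - 1). nra.
Qed.

Lemma continuous_poisson (t y : R) : 0 < t < PI -> continuous (poisson t) y.
Proof.
move=> Ht. apply: ex_derive_continuous. rewrite /poisson. auto_derive.
have := poisson_den t y Ht. lra.
Qed.

Lemma filterlim_atan_p : filterlim atan (Rbar_locally p_infty) (locally (PI / 2)).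
Proof.
apply filterlim_locally => eps. have HPI := PI_RGT_0. have He := cond_pos eps.
have Hm : 0 < Rmin (eps / 2) (PI / 2) by apply: Rmin_pos; lra.
have H1 := Rmin_l (eps / 2) (PI / 2). have H2 := Rmin_r (eps / 2) (PI / 2).
exists (tan (PI / 2 - Rmin (eps / 2) (PI / 2))) => x /atan_increasing.
rewrite atan_tan; last lra. move=> H.
rewrite /ball /= /AbsRing_ball /abs /minus /plus /opp /=.
have := atan_bound x. split_Rabs; lra.
Qed.

(** [atan ((e^y - cos t) / sin t)] is a primitive; it runs from [- (PI / 2 - t)] to [PI / 2]. *)
Lemma integral_poisson (t : R) : 0 < t < PI -> integral_R (poisson t) (PI - t).
Proof.
move=> Ht. have Hs : 0 < sin t by apply: sin_gt_0; lra.
have -> : PI - t = PI / 2 - (- (PI / 2 - t)) by field.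
have E0 : - (PI / 2 - t) = atan ((0 - cos t) / sin t).
{ rewrite -(atan_tan (- (PI / 2 - t))); last lra. f_equal.
  rewrite /tan sin_neg cos_neg sin_shift cos_shift. field. lra. }
apply (is_RInt_gen_primitive (fun y => atan ((exp y - cos t) / sin t))).
- move=> y. have Hy := exp_pos y. auto_derive; first by split => //; lra.
  have Hd := poisson_den t y Ht. rewrite /poisson. move: Hd. rewrite exp_Ropp => Hd.
  have E : cos t ^ 2 = 1 - sin t ^ 2. { have := sin2_cos2 t. rewrite /Rsqr. lra. }
  have Hd' : 0 < exp y * exp y + 1 - 2 * cos t * exp y.
  { apply (Rmult_lt_compat_l (exp y)) in Hd => //.
    have Hi : exp y * / exp y = 1 by apply: Rinv_r; lra. nra. }
  have EE : 1 + (exp y - cos t) / sin t * ((exp y - cos t) / sin t * 1)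
    = (exp y * exp y + 1 - 2 * cos t * exp y) / sin t ^ 2.
  { apply: (Rmult_eq_reg_r (sin t ^ 2)); last by apply: pow_nonzero; lra.
    rewrite /Rdiv Rmult_assoc (Rmult_assoc (_ + 1 - _)) Rinv_l; last by apply: pow_nonzero; lra.
    field_simplify; lra. }
  rewrite EE. field. repeat split; lra.
- move=> y. exact: continuous_poisson.
- rewrite E0. apply: (filterlim_comp _ _ _ exp (fun z => atan ((z - cos t) / sin t)) _ (locally 0)).
  + exact: is_lim_exp_m.
  + apply: (ex_derive_continuous (fun z => atan ((z - cos t) / sin t))). auto_derive. split => //; lra.
- apply: (filterlim_comp _ _ _ (fun y => (exp y - cos t) / sin t) atan _ (Rbar_locally p_infty)); last exact: filterlim_atan_p.
  move=> P [M HM]. have [M' HM'] := is_lim_exp_p (fun x => M * sin t + cos t < x)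
    (ex_intro _ (M * sin t + cos t) (fun x H => H)).
  exists M' => y /HM' Hy. apply: HM. apply: (Rmult_lt_reg_r (sin t)) => //.
  rewrite /Rdiv Rmult_assoc Rinv_l; lra.
Qed.

(** With [p = e^(s y / 2)] and [m = e^((1 - s) y / 2)] the two sides are the squares of
    [p m - m / p] and of [p m - 1 / (p m)], and [m / p] lies between [1 / (p m)] and [p m]. *)
Lemma sym_exp_bound (s y : R) : 0 < s < 1 ->
  (exp (s * y) + exp (- (s * y)) - 2) * exp ((1 - s) * y) <= exp y + exp (- y) - 2.
Proof.
move=> Hs.
pose p := exp (s * y / 2). pose m := exp ((1 - s) * y / 2).
have Hp : 0 < p by apply: exp_pos. have Hm : 0 < m by apply: exp_pos.
have -> : exp (s * y) = p * p by rewrite /p -exp_plus; f_equal; field.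
have -> : exp ((1 - s) * y) = m * m by rewrite /m -exp_plus; f_equal; field.
have -> : exp y = (p * m) * (p * m) by rewrite /p /m -!exp_plus; f_equal; field.
have -> : exp (- y) = / (p * m) * / (p * m) by rewrite /p /m -exp_plus -exp_Ropp -exp_plus; f_equal; field.
have -> : exp (- (s * y)) = / p * / p by rewrite /p -exp_Ropp -exp_plus; f_equal; field.
have -> : (p * p + / p * / p - 2) * (m * m) = (p * m - m * / p) ^ 2 by field; lra.
have -> : p * m * (p * m) + / (p * m) * / (p * m) - 2 = (p * m - / (p * m)) ^ 2 by field; lra.
have Hip : 0 < / p by apply: Rinv_0_lt_compat. have Him : 0 < / m by apply: Rinv_0_lt_compat.
have Em : m * / m = 1 by apply: Rinv_r; lra. have Ep : p * / p = 1 by apply: Rinv_r; lra.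
have Hexp x : 0 <= x -> 1 <= exp x by move=> Hx; rewrite -exp_0; apply: exp_le.
have Hexp' x : x <= 0 -> exp x <= 1 by move=> Hx; rewrite -exp_0; apply: exp_le.
rewrite Rinv_mult -(pow2_abs (p * m - _)) -(pow2_abs (p * m - / p * / m)).
apply: pow_incr; split; first exact: Rabs_pos.
case: (Rle_dec 0 y) => Hy.
- have H1 : 1 <= p by apply: Hexp; nra.
  have H2 : 1 <= m by apply: Hexp; nra.
  have H3 : / m <= 1 by nra. have H4 : / p <= 1 by nra.
  have V1 : m * / p <= p * m by nra. have V2 : / p * / m <= m * / p by nra.
  rewrite !Rabs_pos_eq; lra.
- have H1 : p <= 1 by apply: Hexp'; nra.
  have H2 : m <= 1 by apply: Hexp'; nra.
  have H3 : 1 <= / m by nra. have H4 : 1 <= / p by nra.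
  have V1 : p * m <= m * / p by nra. have V2 : m * / p <= / p * / m by nra.
  rewrite !Rabs_left1; lra.
Qed.

Lemma dIm_PI (y : R) : dIm (-1) 1 y PI = 0.
Proof. rewrite /dIm !Rmult_1_l sin_PI. ring. Qed.

(** At height [PI] the integrand is [e^(i pi s)] times [Kint s 0], so shifting the line evaluates
    the integral of [e^(s y) poisson t y] as [B sin (s (PI - t))]. Adding the reflected integral and
    subtracting twice the mass [PI - t] leaves the integral of
    [(e^(s y) + e^(- s y) - 2) poisson t y], which is [O(sin t)] by [sym_exp_bound]. Letting [t]
    tend to 0 gives [2 B sin (PI s) = 2 PI]. *)
Lemma beta_value (s B : R) : 0 < s < 1 -> integral_R (Kint s 0) B -> B * sin (PI * s) = PI.
Proof.
move=> Hs HB. have HPI := PI_RGT_0.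
have Rpi y : gRe 0 s (-1) 1 y PI = cos (s * PI) * Kint s 0 y.
{ rewrite /gRe /dSq dIm_PI /dRe !Rmult_1_l cos_PI /gMod /gArg /Kint.
  rewrite (_ : 0 * exp y * cos PI + s * y = s * y - 0 * exp y); last ring.
  rewrite (_ : 0 * exp y * sin PI + s * PI = s * PI); last ring.
  have := exp_pos y => Hy. field. lra. }
have Ipi y : gIm 0 s (-1) 1 y PI = sin (s * PI) * Kint s 0 y.
{ rewrite /gIm /dSq dIm_PI /dRe !Rmult_1_l cos_PI /gMod /gArg /Kint.
  rewrite (_ : 0 * exp y * cos PI + s * y = s * y - 0 * exp y); last ring.
  rewrite (_ : 0 * exp y * sin PI + s * PI = s * PI); last ring.
  have := exp_pos y => Hy. field. lra. }
have HR := integral_R_ext _ _ _ (fun y => eq_sym (Rpi y)) (integral_R_scal (cos (s * PI)) _ _ HB).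
have HI := integral_R_ext _ _ _ (fun y => eq_sym (Ipi y)) (integral_R_scal (sin (s * PI)) _ _ HB).
have H1 t : 0 < t < PI -> integral_R (fun y => exp (s * y) * poisson t y) (B * sin (s * (PI - t))).
{ move=> Ht.
  have [lr [li [Hr Hi]]] := ex_integral_beta s t B Hs HB ltac:(lra).
  have [Er Ei] := beta_line_shift s t _ _ _ _ Hs ltac:(lra) Hr Hi HR HI.
  have -> : B * sin (s * (PI - t)) = cos (s * t) * li - sin (s * t) * lr.
  { rewrite Er Ei Rmult_minus_distr_l sin_minus. ring. }
  apply: integral_R_ext (integral_R_minus _ _ _ _ (integral_R_scal (cos (s * t)) _ _ Hi) (integral_R_scal (sin (s * t)) _ _ Hr)) => y.
  have Hy := exp_pos y. have HD := beta_dSq_pos y t ltac:(lra). have Hq := poisson_den t y Ht.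
  have ED : dSq (-1) 1 y t = exp y * (exp y + exp (- y) - 2 * cos t).
  { rewrite beta_dSq exp_Ropp. field. lra. }
  rewrite /gIm /gRe /gMod /gArg /poisson.
  rewrite (_ : 0 * exp y * cos t + s * y = s * y); last ring.
  rewrite (_ : 0 * exp y * sin t + s * t = s * t); last ring.
  rewrite ED /dIm !Rmult_1_l.
  have E1 := sin2_cos2 (s * t). rewrite /Rsqr in E1.
  move: (dRe (-1) 1 y t) => A. move: Hq. move: (exp y + exp (- y) - 2 * cos t) => q Hq.
  transitivity (exp (s * y) * sin t * (sin (s * t) * sin (s * t) + cos (s * t) * cos (s * t)) / q).
  - field. lra.
  - rewrite E1. field. lra. }
have H2 t : 0 < t < PI -> integral_R (fun y => exp (- (s * y)) * poisson t y) (B * sin (s * (PI - t))).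
{ move=> Ht. apply: integral_R_ext (integral_R_reflect _ _ _ (H1 t Ht)) => y.
  - rewrite /poisson !Ropp_involutive (Rplus_comm (exp (- y))). do 2 f_equal. ring.
  - apply: (continuous_mult (K := R_AbsRing)); last exact: continuous_poisson.
    apply: ex_derive_continuous. by auto_derive. }
(* Nonnegativity of [psi 1] and [psi (-1)] for [0 < t < PI] is the two-sided bound; by continuity it
   survives at [t = 0], where the sine term vanishes. The constant [4 / (1 - s)] is the 4 of
   [le_decay] times the integral of [decay (1 - s)]. *)
pose psi c t := 4 * / (1 - s) * sin t + c * (2 * B * sin (s * (PI - t)) - 2 * (PI - t)).
have Hpsi c : c = 1 \/ c = -1 -> 0 <= psi c 0.
{ move=> Hc. apply: (continuous_ge_0_right (psi c) PI) => //.
  - apply: ex_derive_continuous. rewrite /psi. by auto_derive.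
  - move=> t Ht.
    have H3 := integral_R_minus _ _ _ _ (integral_R_plus _ _ _ _ (H1 t Ht) (H2 t Ht))
      (integral_R_scal 2 _ _ (integral_poisson t Ht)).
    have Hst : 0 < sin t by apply: sin_gt_0; lra.
    have H4 := integral_R_scal (4 * sin t) _ _ (integral_decay (1 - s) ltac:(lra)).
    have := integral_R_le _ _ _ _ _ H3 H4.
    move=> H. have {H} : Rabs (B * sin (s * (PI - t)) + B * sin (s * (PI - t)) - 2 * (PI - t)) <= 4 * sin t * / (1 - s).
    { apply: H => y.
      have Hv x : Rabs (exp (s * x) * poisson t x + exp (- (s * x)) * poisson t x - 2 * poisson t x)
          * exp ((1 - s) * x) <= sin t.
      { have Hq := poisson_den t x Ht. have Hb := sym_exp_bound s x Hs. have He := exp_pos ((1 - s) * x).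
        have Hcosh : 0 <= exp (s * x) + exp (- (s * x)) - 2.
        { have := exp_ineq1_le (s * x). have := exp_ineq1_le (- (s * x)). lra. }
        rewrite /poisson.
        have -> : forall u v w : R, u * w + v * w - 2 * w = (u + v - 2) * w by move=> *; ring.
        rewrite Rabs_pos_eq; last first.
        { apply: Rmult_le_pos => //. apply: Rlt_le. exact: Rdiv_lt_0_compat. }
        have -> : forall u d e : R, u * (sin t / d) * e = sin t * (u * e / d) by move=> *; rewrite /Rdiv; ring.
        rewrite -[X in _ <= X]Rmult_1_r. apply: Rmult_le_compat_l; first lra.
        apply: (Rmult_le_reg_r _ _ _ Hq). have := COS_bound t. rewrite /Rdiv Rmult_assoc Rinv_l; lra. }
      apply: le_decay; last exact: Rabs_pos.
      - exact: Hv.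
      - have := Hv (- y).
        rewrite /poisson !Ropp_involutive (Rplus_comm (exp (- y))) Ropp_mult_distr_r_reverse Ropp_involutive.
        rewrite (Rplus_comm (exp (- (s * y)) * _)) -Ropp_mult_distr_r. by []. }
    rewrite /psi. case: Hc => ->; split_Rabs; lra. }
have := Hpsi 1 (or_introl eq_refl). have := Hpsi (-1) (or_intror eq_refl).
rewrite /psi sin_0 !Rminus_0_r (Rmult_comm s). lra.
Qed.

Lemma integral_R_ge_0 (f : R -> R) (l : R) : (forall x, 0 <= f x) -> integral_R f l -> 0 <= l.
Proof.
move=> Hf H. apply: Rle_trans (Rabs_pos l) _.
apply: (integral_R_le f f) => // x. rewrite Rabs_pos_eq //. exact: Rle_refl.
Qed.

(** A rate of continuity at [p = 0]. With [e = (1 - s) / 2], [1 - exp (- exp v) <= exp (e v)] for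
    every real [v] because [0 < e <= 1], and [s + e < 1] keeps the majorant [Kint (s + e) 0]
    integrable. *)
Lemma Kint_integral_at_0 (s B : R) (K : R -> R) : 0 < s < 1 ->
  (forall q, 0 <= q -> integral_R (Kint s q) (K q)) ->
  exists C e, 0 < e /\ forall q, Rabs (K 0 - K (exp q)) <= C * exp (e * q).
Proof.
move=> Hs HK. pose e := (1 - s) / 2.
have [C HC] := ex_Kint (s + e) 0 ltac:(rewrite /e; lra) ltac:(lra).
exists C, e. split; first by rewrite /e; lra. move=> q.
have Hq := exp_pos q.
rewrite Rmult_comm.
apply: (integral_R_le _ _ _ _ _ (integral_R_minus _ _ _ _ (HK 0 ltac:(lra)) (HK (exp q) ltac:(lra))) (integral_R_scal (exp (e * q)) _ _ HC)) => y.
have Hy := exp_pos y. have Hle := Kint_le s (exp q) y ltac:(lra).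
rewrite Rabs_pos_eq; last lra.
have -> : Kint s 0 y - Kint s (exp q) y = Kint s 0 y * (1 - exp (- exp (q + y))).
{ rewrite /Kint exp_plus Rmult_minus_distr_l Rmult_1_r. f_equal. rewrite /Rdiv.
  rewrite (_ : s * y - exp q * exp y = (s * y - 0 * exp y) + - (exp q * exp y)); last ring.
  rewrite (exp_plus (s * y - 0 * exp y)). ring. }
have -> : Kint (s + e) 0 y = Kint s 0 y * exp (e * y).
{ rewrite /Kint (_ : (s + e) * y - 0 * exp y = (s * y - 0 * exp y) + e * y); last ring.
  rewrite exp_plus. field. lra. }
have HKp := Kint_pos s 0 y.
rewrite (Rmult_comm (exp _)) Rmult_assoc -exp_plus. apply: Rmult_le_compat_l; first lra.
rewrite (_ : e * y + e * q = e * (q + y)); last ring.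
move: (q + y) => v. have H1 := exp_ineq1_le (- exp v). have H2 := exp_pos (- exp v).
case: (Rle_dec 0 v) => Hv.
- apply: (Rle_trans _ 1); first lra. rewrite -exp_0. apply: exp_le. apply: Rmult_le_pos => //. rewrite /e; lra.
- apply: (Rle_trans _ (exp v)); first lra. apply: exp_le. have : e <= 1 by rewrite /e; lra. nra.
Qed.

(** The integral of [Gamma s exp ((1 - s) q - exp q)] over the line is [Gamma s * Gamma (1 - s)],
    while its primitive [- exp (- p) K p], taken at [p = exp q], rises from [- B] to [0]. *)
Lemma Gamma_beta (s B : R) : 0 < s < 1 -> integral_R (Kint s 0) B -> Gamma s * Gamma (1 - s) = B.
Proof.
move=> Hs HB.
pose K p := RInt_gen (Kint s p) (Rbar_locally m_infty) (Rbar_locally p_infty).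
have HK q : 0 <= q -> integral_R (Kint s q) (K q).
{ move=> Hq. have [l Hl] := ex_Kint s q Hs Hq.
  rewrite /K (is_RInt_gen_unique (V := R_CompleteNormedModule) _ _ Hl). exact: Hl. }
have HK0 : K 0 = B by apply: (integral_R_unique _ _ _ (HK 0 _)) => //; lra.
have HKb q : 0 <= q -> 0 <= K q <= B.
{ move=> Hq. split.
  - apply: (integral_R_ge_0 _ _ _ (HK q Hq)) => y. apply: Rlt_le. exact: Kint_pos.
  - apply: Rle_trans (Rle_abs _) _. apply: (integral_R_le _ _ _ _ _ (HK q Hq) HB) => y.
    rewrite Rabs_pos_eq; last by apply: Rlt_le; apply: Kint_pos. exact: Kint_le. }
have [C [e [He HC]]] := Kint_integral_at_0 s B K Hs HK.
have H1 := integral_R_scal (Gamma s) _ _ (Gamma_integral (1 - s) ltac:(lra)).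
rewrite (_ : B = 0 - (- B)); last ring.
apply: (integral_R_unique _ _ _ H1).
apply (is_RInt_gen_primitive (fun q => - (exp (- exp q) * K (exp q)))).
- move=> q. have Hq := exp_pos q.
  have HD := Kint_derivative s (exp q) K Hs Hq HK.
  have H2 : is_derive (fun q => K (exp q)) q (exp q * (K (exp q) - exp (- s * ln (exp q)) * Gamma s)).
  { apply: (is_derive_comp K exp q) => //. exact: is_derive_exp. }
  auto_derive; first by exists (K (exp q) - exp (- s * ln (exp q)) * Gamma s).
  rewrite (is_derive_unique _ _ _ HD) ln_exp.
  rewrite (_ : (1 - s) * q - exp q = - exp q + (q + - s * q)); last ring.
  rewrite !exp_plus. ring.
- move=> q. apply: (continuous_scal_r (Gamma s) (fun q => exp ((1 - s) * q - exp q))).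
  apply: ex_derive_continuous. by auto_derive.
- apply filterlim_locally => eps.
  have HB0 : 0 <= B by have := HKb 0 ltac:(lra); lra.
  (* The distance from [exp (- p) K p] to [B] splits into [B - K p], controlled by the rate at 0,
     and [(1 - exp (- p)) K p <= p B]. *)
  have Hl : filterlim (fun q => Rabs C * exp (e * q) + B * exp (1 * q)) (Rbar_locally m_infty) (locally (Rabs C * 0 + B * 0)).
  { apply: (is_lim_plus' (fun q => Rabs C * exp (e * q)) (fun q => B * exp (1 * q)) m_infty).
    - apply: (is_lim_scal_l (fun q => exp (e * q)) (Rabs C) m_infty 0). exact: filterlim_exp_m.
    - apply: (is_lim_scal_l (fun q => exp (1 * q)) B m_infty 0). apply: filterlim_exp_m. lra. }
  have [M HM] := proj1 (filterlim_locally _ _) Hl eps.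
  exists M => q Hq. have := HM q Hq. have := HC q. rewrite HK0.
  rewrite /ball /= /AbsRing_ball /abs /minus /plus /opp /= !Rmult_0_r Rplus_0_l Ropp_0 Rplus_0_r Rmult_1_l.
  have Hb := HKb (exp q) (Rlt_le _ _ (exp_pos q)).
  have H2 := exp_ineq1_le (- exp q). have H3 := exp_pos (- exp q). have Hq0 := exp_pos q.
  have H4 := exp_pos (e * q). have HC1 := Rle_abs C.
  have H5 : exp (- exp q) <= 1 by rewrite -exp_0; apply: exp_le; lra.
  move=> HA HB'. apply: Rle_lt_trans HB'.
  have HCe : C * exp (e * q) <= Rabs C * exp (e * q) by apply: Rmult_le_compat_r; lra.
  have H6 : 0 <= (1 - exp (- exp q)) * K (exp q) <= exp q * B.
  { split; first by apply: Rmult_le_pos; lra. apply: Rmult_le_compat; lra. }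
  have H7 : 0 <= Rabs C * exp (e * q) by apply: Rmult_le_pos; [exact: Rabs_pos | lra].
  rewrite (Rabs_pos_eq (_ + B * exp q)); last nra.
  rewrite (_ : - (exp (- exp q) * K (exp q)) + - - B = (B - K (exp q)) + (1 - exp (- exp q)) * K (exp q)); last ring.
  apply: Rle_trans (Rabs_triang _ _) _. rewrite (Rabs_pos_eq ((1 - _) * _)); last lra. lra.
- apply filterlim_locally => eps.
  have Hl : filterlim (fun q => B * exp (- exp q)) (Rbar_locally p_infty) (locally (B * 0)).
  { apply: (is_lim_scal_l (fun q => exp (- exp q)) B p_infty 0).
    apply: (filterlim_comp _ _ _ (fun q => - exp q) exp _ (Rbar_locally m_infty)); last exact: is_lim_exp_m.
    exact (is_lim_opp _ _ _ is_lim_exp_p). }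
  have [M HM] := proj1 (filterlim_locally _ _) Hl eps.
  exists M => q Hq. have := HM q Hq.
  rewrite /ball /= /AbsRing_ball /abs /minus /plus /opp /= !Rmult_0_r Ropp_0 !Rplus_0_r.
  have Hb := HKb (exp q) (Rlt_le _ _ (exp_pos q)). have H3 := exp_pos (- exp q).
  rewrite Rabs_Ropp !Rabs_pos_eq; try nra.
Qed.

Lemma Gamma_reflection (s : R) : 0 < s < 1 -> Gamma s * Gamma (1 - s) * sin (PI * s) = PI.
Proof.
move=> Hs. have [B HB] := ex_Kint s 0 Hs (Rle_refl 0).
rewrite (Gamma_beta s B Hs HB). exact: beta_value.
Qed.

Lemma Gamma_1 : Gamma 1 = 1.
Proof.
apply: (integral_R_unique _ _ _ (Gamma_integral 1 Rlt_0_1)).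
have E1 : 1 = 0 - - exp (- 0) by rewrite Ropp_0 exp_0; lra.
rewrite {2}E1.
apply (is_RInt_gen_primitive (fun y => - exp (- exp y))).
- move=> y. auto_derive => //. rewrite !Rmult_1_l /Rminus exp_plus. ring.
- move=> y. apply: ex_derive_continuous. by auto_derive.
- apply: (filterlim_comp _ _ _ exp (fun z => - exp (- z)) _ (locally 0)); first exact: is_lim_exp_m.
  apply: (ex_derive_continuous (fun z => - exp (- z))). by auto_derive.
- rewrite -{1}Ropp_0. apply: (is_lim_opp (fun q => exp (- exp q)) p_infty 0).
  apply: (filterlim_comp _ _ _ (fun q => - exp q) exp _ (Rbar_locally m_infty)); last exact: is_lim_exp_m.
  exact (is_lim_opp _ _ _ is_lim_exp_p).
Qed.

Lemma Gamma_half : Gamma (1 / 2) = sqrt PI.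
Proof.
have H := Gamma_reflection (1 / 2) ltac:(lra).
have E : 1 - 1 / 2 = 1 / 2 by field.
rewrite E (_ : PI * (1 / 2) = PI / 2) in H; last field.
rewrite sin_PI2 Rmult_1_r in H.
have Hp : 0 <= Gamma (1 / 2).
{ apply: (integral_R_ge_0 _ _ _ (Gamma_integral (1 / 2) ltac:(lra))) => y. apply: Rlt_le. exact: exp_pos. }
by rewrite -H sqrt_square.
Qed.

Lemma half_pochhammer_rising (k : nat) : half_pochhammer k = rising (1 / 2) k.
Proof.
have HG : Gamma (1 / 2) <> 0 by rewrite Gamma_half; apply: Rgt_not_eq; apply: sqrt_lt_R0; exact: PI_RGT_0.
elim: k => [|k IH].
- rewrite /half_pochhammer /= Rplus_0_l. by field.
- rewrite [rising _ _]/= -IH /half_pochhammer S_INR.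
  rewrite (_ : INR k + 1 + 1 / 2 = (INR k + 1 / 2) + 1); last ring.
  rewrite Gamma_S; last by have := pos_INR k; lra.
  by field.
Qed.

(** * Hankel's integral and the Mittag-Leffler remainder *)

(* Hankel's integral [1/(2 i pi) int s^(k-1) e^s / (1 + q s^(-a)) ds], the path
   being made of the circle of radius [e^r] and of both sides of the cut
   (-oo, - e^r]; conjugate symmetry leaves the upper half of it. *)
Definition hankel_ray (k q a r : R) : R :=
  RInt_gen (fun y => gIm 1 k q (- a) y PI) (at_point r) (Rbar_locally p_infty).
Definition hankel (k q a r : R) : R :=
  (RInt (gRe 1 k q (- a) r) 0 PI + hankel_ray k q a r) / PI.

Lemma sin_aPI_pos (a : R) : 0 < a < 1 -> 0 < sin (a * PI).
Proof. move=> Ha. have HPI := PI_RGT_0. apply: sin_gt_0; nra. Qed.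

(** [1 + q e^(- a w)] can vanish only where [e^(- a w)] is real and negative, which [|a t| < PI]
    excludes. The strip is open and contains the heights from [0] to [PI] because [a < 1]; this is
    the margin that [g_rectangle] asks for. *)
Lemma hankel_dSq_pos (q a r t : R) : 0 < a < 1 -> 0 <= q -> - PI < t < PI / a -> 0 < dSq q (- a) r t.
Proof.
move=> Ha Hq Ht. have HPI := PI_RGT_0.
have Ht2 : - PI < - a * t < PI.
{ split; last nra. have : a * t < PI; last lra.
  have H : a * (PI / a) = PI by field; lra. nra. }
rewrite /dSq /dRe /dIm. set v := - a * t in Ht2 *.
have He := exp_pos (- a * r).
case: (Req_dec v 0) => Hv.
- rewrite Hv cos_0 sin_0. nra.
- case: (Req_dec q 0) => Hq0; first by rewrite Hq0; lra.
  have Hs : sin v <> 0.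
  { case: (Rlt_dec 0 v) => H.
    - have : 0 < sin v by apply: sin_gt_0; lra. lra.
    - have : 0 < sin (- v) by apply: sin_gt_0; lra. rewrite sin_neg. lra. }
  have Hx : q * exp (- a * r) * sin v <> 0.
  { apply: Rmult_integral_contrapositive_currified => //.
    apply: Rmult_integral_contrapositive_currified => //; lra. }
  have := Rsqr_pos_lt _ Hx. rewrite /Rsqr => H.
  have := Rle_0_sqr (1 + q * exp (- a * r) * cos v). rewrite /Rsqr. lra.
Qed.

(** The distance from [-1] to the ray of direction [e^(- i a t)] is 1 if [cos (a t) >= 0]; otherwise
    it is [|sin (a t)|], and then [cos (a t)^2 <= cos (a PI)^2]. Being uniform in [q], [r] and [t],
    the bound dominates every Hankel integrand at once. *)
Lemma hankel_dSq_ge (q a r t : R) : 0 < a < 1 -> 0 <= q -> 0 <= t <= PI ->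
  sin (a * PI) ^ 2 <= dSq q (- a) r t.
Proof.
move=> Ha Hq Ht. have HPI := PI_RGT_0.
rewrite /dSq /dRe /dIm (Ropp_mult_distr_l_reverse a t) cos_neg sin_neg.
have He := exp_pos (- a * r).
have HX : 0 <= q * exp (- a * r) by nra.
move: HX. move: (q * exp (- a * r)) => X HX.
have Hs2 := sin2_cos2 (a * PI). have Ht2 := sin2_cos2 (a * t). rewrite /Rsqr in Hs2 Ht2.
have Hc : cos (a * PI) <= cos (a * t) by apply: cos_decr_1; nra.
move: Hs2 Ht2 Hc. move: (sin (a * PI)) (cos (a * PI)) (sin (a * t)) (cos (a * t)) => s c u v Hs2 Ht2 Hc.
have E : (1 + X * v) * (1 + X * v) + X * - u * (X * - u) = (X + v) ^ 2 + u * u.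
{ rewrite (_ : u * u = 1 - v * v); last lra.
  rewrite (_ : X * - u * (X * - u) = X * X * (u * u)); last ring.
  rewrite (_ : u * u = 1 - v * v); last lra. ring. }
case: (Rle_dec 0 v) => Hv.
- have H0 : 0 <= X * v by apply: Rmult_le_pos.
  have H1 : 1 <= (1 + X * v) * (1 + X * v) by nra.
  have H2 := Rle_0_sqr (X * - u). have H3 := Rle_0_sqr c. rewrite /Rsqr in H2 H3. lra.
- rewrite E. have : v * v <= c * c by nra. have := pow2_ge_0 (X + v). lra.
Qed.

(** [|dRe|] and [|dIm|] are at most [sqrt dSq], so the numerator is at most [2 gMod sqrt dSq], and a
    single factor [1 / m] remains after division. *)
Lemma g_bound (l k q a r t m : R) : 0 < m -> m ^ 2 <= dSq q a r t ->
  Rabs (gRe l k q a r t) <= 2 / m * gMod l k r t /\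
  Rabs (gIm l k q a r t) <= 2 / m * gMod l k r t.
Proof.
move=> Hm HD.
have HD0 : 0 < dSq q a r t. { have := pow_lt m 2 Hm. lra. }
have HA : Rabs (dRe q a r t) <= sqrt (dSq q a r t).
{ rewrite -sqrt_Rsqr_abs. apply: sqrt_le_1_alt. rewrite /dSq. have := Rle_0_sqr (dIm q a r t). rewrite /Rsqr. lra. }
have HB : Rabs (dIm q a r t) <= sqrt (dSq q a r t).
{ rewrite -sqrt_Rsqr_abs. apply: sqrt_le_1_alt. rewrite /dSq. have := Rle_0_sqr (dRe q a r t). rewrite /Rsqr. lra. }
have Hsm : m <= sqrt (dSq q a r t).
{ rewrite -(sqrt_pow2 m); last lra. exact: sqrt_le_1_alt. }
have Hss : dSq q a r t = sqrt (dSq q a r t) * sqrt (dSq q a r t) by rewrite sqrt_sqrt //; lra.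
have Hg := exp_pos (l * exp r * cos t + k * r).
have Haux u v : Rabs u <= 1 -> Rabs v <= 1 ->
  Rabs (gMod l k r t * (dRe q a r t * u + dIm q a r t * v) / dSq q a r t) <= 2 / m * gMod l k r t.
{ move=> Hu Hv. rewrite /gMod in Hg *.
  rewrite Rabs_div; last lra. rewrite (Rabs_mult (exp _)) (Rabs_pos_eq (exp _)); last lra.
  rewrite (Rabs_pos_eq (dSq _ _ _ _)); last lra.
  have H1 : Rabs (dRe q a r t * u + dIm q a r t * v) <= 2 * sqrt (dSq q a r t).
  { apply: Rle_trans (Rabs_triang _ _) _. rewrite (Rabs_mult _ u) (Rabs_mult _ v).
    have U1 := Rmult_le_compat _ _ _ _ (Rabs_pos _) (Rabs_pos _) HA Hu.
    have U2 := Rmult_le_compat _ _ _ _ (Rabs_pos _) (Rabs_pos _) HB Hv.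
    lra. }
  move: Hsm H1. rewrite [X in _ / X]Hss. move: (sqrt _) => z Hz H1.
  apply: (Rle_trans _ (exp (l * exp r * cos t + k * r) * (2 * z) / (z * z))).
  - apply: Rmult_le_compat_r; first by apply: Rlt_le; apply: Rinv_0_lt_compat; nra.
    apply: Rmult_le_compat_l => //. lra.
  - rewrite (_ : _ / (z * z) = exp (l * exp r * cos t + k * r) * (2 * / z)); last by field; lra.
    rewrite (Rmult_comm (2 / m)). apply: Rmult_le_compat_l; first lra.
    rewrite /Rdiv. apply: Rmult_le_compat_l; first lra. apply: Rinv_le_contravar; lra. }
have Hcs x : Rabs (cos x) <= 1 by have := COS_bound x; split_Rabs; lra.
have Hsn x : Rabs (sin x) <= 1 by have := SIN_bound x; split_Rabs; lra.
split; first exact: Haux.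
rewrite /gIm. rewrite (_ : _ - _ = dRe q a r t * sin (gArg l k r t) + dIm q a r t * - cos (gArg l k r t)); last ring.
apply: Haux => //. by rewrite Rabs_Ropp.
Qed.

Lemma hankel_cut_bound (k q a y : R) : 0 < a < 1 -> 0 <= q ->
  Rabs (gIm 1 k q (- a) y PI) <= 2 / sin (a * PI) * exp (k * y - exp y).
Proof.
move=> Ha Hq. have HPI := PI_RGT_0.
have [_ H] := g_bound 1 k q (- a) y PI (sin (a * PI)) (sin_aPI_pos a Ha) (hankel_dSq_ge q a y PI Ha Hq ltac:(lra)).
rewrite /gMod cos_PI in H.
by rewrite (_ : 1 * exp y * -1 + k * y = k * y - exp y) in H; last ring.
Qed.

Lemma hankel_dSq_neq (q a r t : R) : 0 < a < 1 -> 0 <= q -> - PI < t < PI / a -> dSq q (- a) r t <> 0.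
Proof. move=> Ha Hq Ht. have := hankel_dSq_pos q a r t Ha Hq Ht. lra. Qed.

Lemma PI_lt_PI_div (a : R) : 0 < a < 1 -> PI < PI / a.
Proof.
move=> Ha. have HPI := PI_RGT_0. apply: (Rmult_lt_reg_r a); first lra.
rewrite /Rdiv Rmult_assoc Rinv_l; nra.
Qed.

(** [k] may be negative, in which case the left side explodes at [- oo]; hence a ray, and a constant
    that depends on [r]. *)
Lemma exp_lin_le_decay (k r : R) : exists C, forall y, r <= y -> exp (k * y - exp y) <= C * decay 1 y.
Proof.
have [C1 H1] := exp_lin_bound (Rabs k + 1) 1 ltac:(have := Rabs_pos k; lra) Rlt_0_1.
pose C := C1 + (2 * Rabs k + 2) * Rabs r.
exists (4 * exp C) => y Hy.
have Hk := Rabs_pos k. have Hr := Rabs_pos r. have HL := H1 y.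
have Hyr : - y <= Rabs r by split_Rabs; lra.
have A1 : k * y <= Rabs k * y + 2 * Rabs k * Rabs r.
{ case: (Rle_dec 0 y) => H.
  - have : k <= Rabs k by apply: Rle_abs. nra.
  - have : - k <= Rabs k by rewrite -Rabs_Ropp; apply: Rle_abs. nra. }
apply: le_decay; last by apply: Rlt_le; apply: exp_pos.
- rewrite -exp_plus. apply: exp_le. rewrite /C. nra.
- rewrite -exp_plus. apply: exp_le. rewrite /C. nra.
Qed.

Lemma hankel_ray_correct (k q a r : R) : 0 < a < 1 -> 0 <= q ->
  is_RInt_gen (fun y => gIm 1 k q (- a) y PI) (at_point r) (Rbar_locally p_infty) (hankel_ray k q a r).
Proof.
move=> Ha Hq. have HPI := PI_RGT_0. have HPa := PI_lt_PI_div a Ha.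
have [C HC] := exp_lin_le_decay k r.
have Hs := sin_aPI_pos a Ha.
refine (RInt_gen_correct (V := R_CompleteNormedModule) (fun y => gIm 1 k q (- a) y PI) _).
apply: (ex_ray_integral_decay _ r 1 (2 / sin (a * PI) * C)); first lra.
- move=> y. apply: continuous_gIm_r. apply: hankel_dSq_neq => //. lra.
- move=> y Hy. apply: Rle_trans (hankel_cut_bound k q a y Ha Hq) _.
  rewrite Rmult_assoc. apply: Rmult_le_compat_l; last exact: HC.
  apply: Rlt_le. apply: Rdiv_lt_0_compat; lra.
Qed.

Lemma hankel_arc_correct (k q a r : R) : 0 < a < 1 -> 0 <= q ->
  is_RInt (gRe 1 k q (- a) r) 0 PI (RInt (gRe 1 k q (- a) r) 0 PI).
Proof.
move=> Ha Hq. have HPI := PI_RGT_0. have HPa := PI_lt_PI_div a Ha.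
apply: (RInt_correct (V := R_CompleteNormedModule)).
apply: (ex_RInt_continuous (V := R_CompleteNormedModule)) => t.
rewrite Rmin_left ?Rmax_right; try lra. move=> Ht.
apply: continuous_gRe_t. apply: hankel_dSq_neq => //. lra.
Qed.

Lemma ray_integral_unique (f : R -> R) (r l l' : R) :
  is_RInt_gen f (at_point r) (Rbar_locally p_infty) l ->
  is_RInt_gen f (at_point r) (Rbar_locally p_infty) l' -> l = l'.
Proof.
move=> H H'. rewrite -(is_RInt_gen_unique (V := R_CompleteNormedModule) _ _ H).
exact: (is_RInt_gen_unique (V := R_CompleteNormedModule) _ _ H').
Qed.

Lemma ray_integral_ext (f g : R -> R) (r l : R) :
  (forall x, f x = g x) ->
  is_RInt_gen f (at_point r) (Rbar_locally p_infty) l ->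
  is_RInt_gen g (at_point r) (Rbar_locally p_infty) l.
Proof. move=> H. apply is_RInt_gen_ext. by apply: filter_forall => ab x _. Qed.

Lemma ray_integral_lin (k : R) (f g : R -> R) (r lf lg : R) :
  is_RInt_gen f (at_point r) (Rbar_locally p_infty) lf ->
  is_RInt_gen g (at_point r) (Rbar_locally p_infty) lg ->
  is_RInt_gen (fun x => f x + k * g x) (at_point r) (Rbar_locally p_infty) (lf + k * lg).
Proof.
move=> Hf Hg. exact: (is_RInt_gen_plus f (fun x => k * g x) lf (k * lg) Hf (is_RInt_gen_scal g k lg Hg)).
Qed.

(** Cauchy's theorem on the rectangle between [r] and [r'] with heights [0] and [PI]: the bottom
    side contributes nothing because the function is real on the real axis, and the top side is the
    piece of the cut between the two radii. *)
Lemma hankel_indep (k q a r r' : R) : 0 < a < 1 -> 0 <= q -> hankel k q a r = hankel k q a r'.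
Proof.
move=> Ha Hq. have HPI := PI_RGT_0. have HPa := PI_lt_PI_div a Ha.
have [H _] := g_rectangle 1 k q (- a) r r' 0 PI (- PI) (PI / a) ltac:(lra) ltac:(lra) ltac:(lra)
  (fun u t Ht => hankel_dSq_neq q a u t Ha Hq Ht).
have Z y : gIm 1 k q (- a) y 0 = 0.
{ rewrite /gIm /dIm /gArg !Rmult_0_r sin_0 !Rmult_0_r Rplus_0_l sin_0. rewrite /Rdiv. ring. }
have HZ : RInt (fun y => gIm 1 k q (- a) y 0) r r' = 0.
{ rewrite (RInt_ext _ (fun _ => 0)); last by move=> y _; exact: Z.
  rewrite RInt_const. by rewrite /scal /= /mult /= Rmult_0_r. }
rewrite HZ in H.
have C y : continuous (fun y => gIm 1 k q (- a) y PI) y.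
{ apply: continuous_gIm_r. apply: hankel_dSq_neq => //. lra. }
have H1 := RInt_correct (V := R_CompleteNormedModule) _ _ _ (ex_RInt_continuous_R _ r r' C).
have H2 := hankel_ray_correct k q a r' Ha Hq.
have H3 := is_RInt_gen_Chasles _ r' _ _ (proj2 (is_RInt_gen_at_point _ r r' _) H1) H2.
have H4 := ray_integral_unique _ _ _ _ (hankel_ray_correct k q a r Ha Hq) (H3 _ _).
rewrite /hankel H4 /plus /=. rewrite /Rdiv. f_equal.
move: H. rewrite Rminus_0_r => <-.
rewrite -[RInt (fun t => gRe 1 k q (- a) r' t) 0 PI]/(RInt (gRe 1 k q (- a) r') 0 PI)
  -[RInt (fun t => gRe 1 k q (- a) r t) 0 PI]/(RInt (gRe 1 k q (- a) r) 0 PI). ring.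
Qed.

(** Under the integral, [s^(k-1) + q s^(k-a-1) = s^(k-1) (1 + q s^(-a))] cancels the denominator.
    Applied with decreasing [k] this recurrence produces the Mittag-Leffler series, with increasing
    [k] the inverse powers of the algebraic part. *)
Lemma hankel_split (k q a r : R) : 0 < a < 1 -> 0 <= q ->
  hankel k q a r + q * hankel (k - a) q a r = hankel k 0 a r.
Proof.
move=> Ha Hq. have HPI := PI_RGT_0. have HPa := PI_lt_PI_div a Ha.
have E0 u t : dSq 0 (- a) u t = 1 by rewrite /dSq /dRe /dIm; ring.
have Er u t : dRe 0 (- a) u t = 1 by rewrite /dRe; ring.
have Ei u t : dIm 0 (- a) u t = 0 by rewrite /dIm; ring.
have EM u t : gMod 1 (k - a) u t = gMod 1 k u t * exp (- a * u).
{ rewrite /gMod -exp_plus. f_equal. ring. }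
have Eg u t : gArg 1 (k - a) u t = gArg 1 k u t - a * t by rewrite /gArg; ring.
have C2 x : cos (- a * x) = cos (a * x) by rewrite Ropp_mult_distr_l_reverse cos_neg.
have S2 x : sin (- a * x) = - sin (a * x) by rewrite Ropp_mult_distr_l_reverse sin_neg.
have HR u t : 0 <= t <= PI -> gRe 1 k q (- a) u t + q * gRe 1 (k - a) q (- a) u t = gRe 1 k 0 (- a) u t.
{ move=> Ht. have HD := hankel_dSq_neq q a u t Ha Hq ltac:(lra).
  rewrite /gRe E0 Er Ei EM Eg cos_minus sin_minus.
  move: HD. rewrite /dSq /dRe /dIm C2 S2 => HD. field. exact: HD. }
have HI u t : 0 <= t <= PI -> gIm 1 k q (- a) u t + q * gIm 1 (k - a) q (- a) u t = gIm 1 k 0 (- a) u t.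
{ move=> Ht. have HD := hankel_dSq_neq q a u t Ha Hq ltac:(lra).
  rewrite /gIm E0 Er Ei EM Eg cos_minus sin_minus.
  move: HD. rewrite /dSq /dRe /dIm C2 S2 => HD. field. exact: HD. }
have A1 := is_RInt_plus _ _ _ _ _ _ (hankel_arc_correct k q a r Ha Hq)
  (is_RInt_scal _ _ _ q _ (hankel_arc_correct (k - a) q a r Ha Hq)).
have A2 : RInt (gRe 1 k 0 (- a) r) 0 PI = RInt (gRe 1 k q (- a) r) 0 PI + q * RInt (gRe 1 (k - a) q (- a) r) 0 PI.
{ apply: is_RInt_unique. apply: is_RInt_ext A1 => t. rewrite Rmin_left ?Rmax_right; try lra.
  move=> Ht. apply: HR. lra. }
have B1 := ray_integral_lin q _ _ _ _ _ (hankel_ray_correct k q a r Ha Hq) (hankel_ray_correct (k - a) q a r Ha Hq).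
have B2 : hankel_ray k 0 a r = hankel_ray k q a r + q * hankel_ray (k - a) q a r.
{ apply: (ray_integral_unique _ r _ _ (hankel_ray_correct k 0 a r Ha (Rle_refl 0))).
  apply: ray_integral_ext B1 => y. apply: HI. lra. }
rewrite /hankel A2 B2. field. lra.
Qed.

Lemma hankel_arc_lim (k q a : R) : 0 < a < 1 -> 0 <= q -> 0 < k ->
  filterlim (fun r => RInt (gRe 1 k q (- a) r) 0 PI) (Rbar_locally m_infty) (locally 0).
Proof.
move=> Ha Hq Hk. have HPI := PI_RGT_0. have Hs := sin_aPI_pos a Ha.
pose C := (PI - 0) * (2 / sin (a * PI) * exp 1).
have H r : r < 0 -> Rabs (RInt (gRe 1 k q (- a) r) 0 PI) <= C * exp (k * r).
{ move=> Hr. rewrite /C Rmult_assoc.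
  apply: (norm_RInt_le_const (V := R_NormedModule) (gRe 1 k q (- a) r)); first lra; last exact: hankel_arc_correct.
  move=> t Ht. have [H _] := g_bound 1 k q (- a) r t (sin (a * PI)) Hs (hankel_dSq_ge q a r t Ha Hq Ht).
  apply: Rle_trans H _. rewrite Rmult_assoc. apply: Rmult_le_compat_l.
  - apply: Rlt_le. apply: Rdiv_lt_0_compat; lra.
  - rewrite /gMod -exp_plus. apply: exp_le.
    have H1 : exp r <= 1 by rewrite -exp_0; apply: exp_le; lra.
    have H2 := exp_pos r. have H3 := COS_bound t. nra. }
apply filterlim_locally => eps.
have Hl : filterlim (fun r => C * exp (k * r)) (Rbar_locally m_infty) (locally (C * 0)).
{ apply: (is_lim_scal_l (fun q => exp (k * q)) C m_infty 0). exact: filterlim_exp_m. }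
have [M HM] := proj1 (filterlim_locally _ _) Hl eps.
exists (Rmin M 0) => r Hr. have := Rmin_l M 0. have := Rmin_r M 0 => H1 H2.
have := HM r ltac:(lra). have := H r ltac:(lra).
rewrite /ball /= /AbsRing_ball /abs /minus /plus /opp /= Rmult_0_r Ropp_0 !Rplus_0_r.
move=> H3 H4. apply: Rle_lt_trans H3 _. apply: Rle_lt_trans (Rle_abs _) H4.
Qed.

(** Contour collapse: the value does not depend on the radius, so the radius may tend to 0. [L] is
    what the small circle leaves behind, and the ray grows into the whole cut. *)
Lemma hankel_line (k q a r l L : R) : 0 < a < 1 -> 0 <= q ->
  filterlim (fun r => RInt (gRe 1 k q (- a) r) 0 PI) (Rbar_locally m_infty) (locally L) ->
  integral_R (fun y => gIm 1 k q (- a) y PI) l ->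
  hankel k q a r = (L + l) / PI.
Proof.
move=> Ha Hq HL Hl. have HPI := PI_RGT_0.
have H1 : filterlim (fun r => PI * hankel k q a r - RInt (gRe 1 k q (- a) r) 0 PI) (Rbar_locally m_infty) (locally (PI * hankel k q a r - L)).
{ apply: (filterlim_ext (fun r' => PI * hankel k q a r - RInt (gRe 1 k q (- a) r') 0 PI)).
  - move=> r'. by rewrite (hankel_indep k q a r r').
  - apply: (is_lim_minus' (fun _ => PI * hankel k q a r) _ m_infty) => //. exact: is_lim_const. }
have H2 : filterlim (hankel_ray k q a) (Rbar_locally m_infty) (locally l).
{ apply filterlim_locally => eps.
  have [Q1 Q2 [M1 HQ1] [M2 HQ2] HQ] := proj1 (filterlimi_locally _ _) Hl (pos_div_2 eps).
  exists M1 => r' Hr'.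
  have Hray := hankel_ray_correct k q a r' Ha Hq.
  have [Q3 Q4 HQ3 [M4 HQ4] HQ'] := proj1 (filterlimi_locally _ _) Hray (pos_div_2 eps).
  pose b := Rmax M2 M4 + 1.
  have Hb2 : M2 < b by have := Rmax_l M2 M4; rewrite /b; lra.
  have Hb4 : M4 < b by have := Rmax_r M2 M4; rewrite /b; lra.
  have [z1 [Hz1 Hz1']] := HQ r' b (HQ1 r' Hr') (HQ2 b Hb2).
  have [z2 [Hz2 Hz2']] := HQ' r' b HQ3 (HQ4 b Hb4).
  have Ez : z1 = z2 by rewrite -(is_RInt_unique _ _ _ _ Hz1) -(is_RInt_unique _ _ _ _ Hz2).
  rewrite -Ez in Hz2'. move: Hz1' Hz2'.
  rewrite /ball /= /AbsRing_ball /abs /minus /plus /opp /=.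
  move=> V1 V2. rewrite (_ : pos eps = eps / 2 + eps / 2); last field.
  rewrite (_ : hankel_ray k q a r' + - l = (z1 + - l) - (z1 + - hankel_ray k q a r')); last ring.
  apply: Rle_lt_trans (Rabs_triang _ _) _. rewrite Rabs_Ropp. lra. }
have H3 : filterlim (hankel_ray k q a) (Rbar_locally m_infty) (locally (PI * hankel k q a r - L)).
{ apply: filterlim_ext H1 => r'. rewrite /hankel. field. lra. }
have E : l = PI * hankel k q a r - L := filterlim_locally_unique _ _ _ H2 H3.
rewrite E. field. lra.
Qed.

Lemma g0_forms (k a r t : R) :
  gRe 1 k 0 a r t = gMod 1 k r t * cos (gArg 1 k r t) /\
  gIm 1 k 0 a r t = gMod 1 k r t * sin (gArg 1 k r t).
Proof.
have E0 : dSq 0 a r t = 1 by rewrite /dSq /dRe /dIm; ring.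
have Er : dRe 0 a r t = 1 by rewrite /dRe; ring.
have Ei : dIm 0 a r t = 0 by rewrite /dIm; ring.
rewrite /gRe /gIm E0 Er Ei. split; field.
Qed.

(** The derivative of [s^k e^s] is integrated along the contour; its primitive has no imaginary part
    on the positive axis and vanishes at the far end of the cut. The result is the recurrence of
    [1 / Gamma (1 - k)]. *)
Lemma hankel_succ (k a r : R) : 0 < a < 1 -> hankel (k + 1) 0 a r = - k * hankel k 0 a r.
Proof.
move=> Ha. have HPI := PI_RGT_0. have HPa := PI_lt_PI_div a Ha.
have HD u t : - PI < t < PI / a -> dSq 0 (- a) u t <> 0 by move=> Ht; apply: hankel_dSq_neq => //; lra.
have E0 u t : dSq 0 (- a) u t = 1 by rewrite /dSq /dRe /dIm; ring.
have Er u t : dRe 0 (- a) u t = 1 by rewrite /dRe; ring.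
have Ei u t : dIm 0 (- a) u t = 0 by rewrite /dIm; ring.
have EM u t : gMod 1 (k + 1) u t = gMod 1 k u t * exp u.
{ rewrite /gMod -exp_plus. f_equal. ring. }
have EA u t : gArg 1 (k + 1) u t = gArg 1 k u t + t by rewrite /gArg; ring.
have EL u t : lRe 1 k 0 (- a) u t = exp u * cos t + k /\ lIm 1 k 0 (- a) u t = exp u * sin t.
{ rewrite /lRe /lIm E0 Er Ei. split; field. }
have HR u t : gRe 1 (k + 1) 0 (- a) u t + k * gRe 1 k 0 (- a) u t = hRe 1 k 0 (- a) u t.
{ rewrite /hRe (proj1 (EL u t)) (proj2 (EL u t)) !(proj1 (g0_forms _ _ _ _)) (proj2 (g0_forms _ _ _ _)) EM EA cos_plus. ring. }
have HI u t : gIm 1 (k + 1) 0 (- a) u t + k * gIm 1 k 0 (- a) u t = hIm 1 k 0 (- a) u t.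
{ rewrite /hIm (proj1 (EL u t)) (proj2 (EL u t)) !(proj2 (g0_forms _ _ _ _)) (proj1 (g0_forms _ _ _ _)) EM EA sin_plus. ring. }
have A1 := is_RInt_plus _ _ _ _ _ _ (hankel_arc_correct (k + 1) 0 a r Ha (Rle_refl 0))
  (is_RInt_scal _ _ _ k _ (hankel_arc_correct k 0 a r Ha (Rle_refl 0))).
have A2 : is_RInt (hRe 1 k 0 (- a) r) 0 PI (gIm 1 k 0 (- a) r PI - gIm 1 k 0 (- a) r 0).
{ apply: (is_RInt_derive (V := R_CompleteNormedModule) (gIm 1 k 0 (- a) r)).
  - move=> t. rewrite Rmin_left ?Rmax_right; try lra. move=> Ht. apply: is_derive_gIm_t. apply: HD. lra.
  - move=> t. rewrite Rmin_left ?Rmax_right; try lra. move=> Ht. apply: (continuity_2d_pt_snd (hRe 1 k 0 (- a))).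
    apply: continuity_hRe. apply: HD. lra. }
have A3 : RInt (gRe 1 (k + 1) 0 (- a) r) 0 PI + k * RInt (gRe 1 k 0 (- a) r) 0 PI = gIm 1 k 0 (- a) r PI - gIm 1 k 0 (- a) r 0.
{ rewrite -(is_RInt_unique _ _ _ _ A2). symmetry. apply: is_RInt_unique.
  apply: is_RInt_ext A1 => t _. exact: HR. }
have Z : gIm 1 k 0 (- a) r 0 = 0.
{ rewrite (proj2 (g0_forms _ _ _ _)) /gArg sin_0 !Rmult_0_r Rplus_0_l sin_0. ring. }
have B1 := ray_integral_lin k _ _ _ _ _ (hankel_ray_correct (k + 1) 0 a r Ha (Rle_refl 0)) (hankel_ray_correct k 0 a r Ha (Rle_refl 0)).
have B2 : is_RInt_gen (fun y => hIm 1 k 0 (- a) y PI) (at_point r) (Rbar_locally p_infty) (0 - gIm 1 k 0 (- a) r PI).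
{ apply (is_RInt_gen_primitive (fun y => gIm 1 k 0 (- a) y PI)).
  - move=> y. apply: is_derive_gIm_r. apply: HD. lra.
  - move=> y. apply: (continuity_2d_pt_fst (hIm 1 k 0 (- a))). apply: continuity_hIm. apply: HD. lra.
  - move=> P HP. exact: locally_singleton HP.
  - apply filterlim_locally => eps.
    have [M HM] := proj1 (filterlim_locally _ _) (filterlim_exp_lin_p k) eps.
    exists M => y Hy. have := HM y Hy.
    rewrite /ball /= /AbsRing_ball /abs /minus /plus /opp /= !Ropp_0 !Rplus_0_r.
    rewrite (Rabs_pos_eq (exp _)); last by apply: Rlt_le; apply: exp_pos.
    apply: Rle_lt_trans. rewrite (proj2 (g0_forms _ _ _ _)) /gMod cos_PI.
    rewrite (_ : 1 * exp y * -1 + k * y = k * y - exp y); last ring.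
    rewrite Rabs_mult (Rabs_pos_eq (exp _)); last by apply: Rlt_le; apply: exp_pos.
    have He := exp_pos (k * y - exp y). have Hsn := SIN_bound (gArg 1 k y PI).
    rewrite -[X in _ <= X]Rmult_1_r. apply: Rmult_le_compat_l; first lra. split_Rabs; lra. }
have B3 := ray_integral_unique _ _ _ _ (ray_integral_ext _ _ _ _ (fun y => HI y PI) B1) B2.
rewrite Z in A3. rewrite /hankel. apply: (Rmult_eq_reg_r PI); last lra. field_simplify; lra.
Qed.

Lemma Rabs_sin_le (z : R) : Rabs (sin z) <= Rabs z.
Proof.
have H x : 0 < x -> Rabs (sin x) <= x.
{ move=> Hx. have := sin_lt_x x Hx. have HPI := PI2_1.
  case: (Rle_dec x PI) => H1 H2.
  - have : 0 <= sin x by apply: sin_ge_0; lra. split_Rabs; lra.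
  - have := SIN_bound x. split_Rabs; lra. }
case: (Rtotal_order z 0) => [Hz|[->|Hz]].
- rewrite -(Rabs_Ropp z) -(Rabs_Ropp (sin z)) -sin_neg (Rabs_pos_eq (- z)); last lra. apply: H. lra.
- rewrite sin_0. exact: Rle_refl.
- rewrite (Rabs_pos_eq z); [exact: H | lra].
Qed.

Lemma one_minus_cos_le (z : R) : 0 <= 1 - cos z <= z ^ 2 / 2.
Proof.
have H := cos_2a_sin (z / 2). rewrite (_ : 2 * (z / 2) = z) in H; last field.
have Hs := Rabs_sin_le (z / 2). have Hp := Rabs_pos (sin (z / 2)).
have : Rabs (sin (z / 2)) ^ 2 <= Rabs (z / 2) ^ 2 by apply: pow_incr.
rewrite !pow2_abs. have := COS_bound z. nra.
Qed.

(** At [k = 0] the function is real on the cut, which therefore contributes nothing, and the mean of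
    [e^s] over the circle tends to its value 1 at [s = 0]. This supplies the endpoint that the
    reflection formula does not reach. *)
Lemma hankel_0 (a r : R) : 0 < a < 1 -> hankel 0 0 a r = 1.
Proof.
move=> Ha. have HPI := PI_RGT_0.
have HL : filterlim (fun r => RInt (gRe 1 0 0 (- a) r) 0 PI) (Rbar_locally m_infty) (locally PI).
{ have H u : u < 0 -> Rabs (RInt (gRe 1 0 0 (- a) u) 0 PI - PI) <= (PI - 0) * (2 * exp 1) * exp (1 * u).
  { move=> Hu.
    have A1 := is_RInt_minus _ _ _ _ _ _ (hankel_arc_correct 0 0 a u Ha (Rle_refl 0)) (is_RInt_const 0 PI 1).
    rewrite (_ : RInt (gRe 1 0 0 (- a) u) 0 PI - PI = minus (RInt (gRe 1 0 0 (- a) u) 0 PI) (scal (PI - 0) 1)).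
    2:{ rewrite /minus /plus /opp /scal /= /mult /=. ring. }
    rewrite Rmult_assoc.
    apply: (norm_RInt_le_const (V := R_NormedModule) _ _ _ _ _ _ _ A1); first lra.
    move=> t Ht. rewrite /norm /= /abs /= /minus /plus /opp /= (proj1 (g0_forms _ _ _ _)) /gMod /gArg.
    rewrite !Rmult_1_l !Rmult_0_l !Rplus_0_r.
    have He := exp_pos u. have He1 : exp u <= 1 by rewrite -exp_0; apply: exp_le; lra.
    have Hc := COS_bound t. have Hs := SIN_bound t.
    have [T1 T2] := exp_taylor1 (exp u * cos t).
    have [D1 D2] := one_minus_cos_le (exp u * sin t).
    have Hx : Rabs (exp u * cos t) <= exp u by split_Rabs; nra.
    have Hx1 : exp (exp u * cos t) <= exp 1 by apply: exp_le; nra.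
    have Hx2 : 2 <= exp 1 by have := exp_ineq1_le 1; lra.
    have Hxe : exp (Rabs (exp u * cos t)) <= exp 1 by apply: exp_le; lra.
    have Hx0 := exp_pos (exp u * cos t).
    have H1 : Rabs (exp (exp u * cos t) - 1) <= exp u * exp 1.
    { have HA := Rle_abs (exp u * cos t). have HB := Rle_abs (- (exp u * cos t)). rewrite Rabs_Ropp in HB.
      have := exp_ineq1_le (- (exp u * cos t)) => H1.
      have E : exp (exp u * cos t) * exp (- (exp u * cos t)) = 1 by rewrite -exp_plus Rplus_opp_r exp_0.
      have H2 : exp (exp u * cos t) - 1 <= (exp u * cos t) * exp (exp u * cos t) by nra.
      split_Rabs; nra. }
    have H2 : Rabs (exp (exp u * cos t) * (cos (exp u * sin t) - 1)) <= exp 1 * exp u.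
    { rewrite Rabs_mult (Rabs_pos_eq (exp _)); last lra. apply: Rmult_le_compat; try lra.
      - exact: Rabs_pos.
      - rewrite Rabs_left1; last lra.
        have Q1 : sin t ^ 2 <= 1 by nra. have Q2 : exp u ^ 2 <= exp u by nra.
        have Q3 : (exp u * sin t) ^ 2 <= exp u * 1.
        { rewrite Rpow_mult_distr. apply: Rmult_le_compat => //; exact: pow2_ge_0. }
        lra. }
    rewrite (_ : _ + - 1 = exp (exp u * cos t) * (cos (exp u * sin t) - 1) + (exp (exp u * cos t) - 1)); last ring.
    apply: Rle_trans (Rabs_triang _ _) _. lra. }
  apply filterlim_locally => eps.
  have Hl : filterlim (fun r => (PI - 0) * (2 * exp 1) * exp (1 * r)) (Rbar_locally m_infty) (locally ((PI - 0) * (2 * exp 1) * 0)).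
  { apply: (is_lim_scal_l (fun q => exp (1 * q)) _ m_infty 0). apply: filterlim_exp_m. lra. }
  have [M HM] := proj1 (filterlim_locally _ _) Hl eps.
  exists (Rmin M 0) => u Hu. have := Rmin_l M 0. have := Rmin_r M 0 => H1 H2.
  have := HM u ltac:(lra). have := H u ltac:(lra).
  rewrite /ball /= /AbsRing_ball /abs /minus /plus /opp /= Rmult_0_r Ropp_0 !Rplus_0_r.
  move=> H3 H4. apply: Rle_lt_trans H3 _. apply: Rle_lt_trans (Rle_abs _) H4. }
rewrite (hankel_line 0 0 a r 0 PI Ha (Rle_refl 0) HL); first by field; lra.
apply: (integral_R_ext (fun y => 0 * decay 1 y)).
- move=> y. rewrite (proj2 (g0_forms _ _ _ _)) /gArg sin_PI (_ : 1 * exp y * 0 + 0 * PI = 0); last ring. rewrite sin_0. ring.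
- have := integral_R_scal 0 _ _ (integral_decay 1 Rlt_0_1). by rewrite Rmult_0_l.
Qed.

(** For [0 < k < 1] the circle disappears and the cut gives [sin (k PI) Gamma k / PI], which the
    reflection formula turns into [1 / Gamma (1 - k)]. Negative [k] are brought back to [0 <= k < 1]
    by [hankel_succ]. *)
Lemma hankel_Gamma (k a r : R) : 0 < a < 1 -> k < 1 -> hankel k 0 a r * Gamma (1 - k) = 1.
Proof.
move=> Ha. have HPI := PI_RGT_0.
have H0 x : 0 <= x < 1 -> hankel x 0 a r * Gamma (1 - x) = 1.
{ move=> [[Hx|<-] Hx1]; last by rewrite Rminus_0_r Gamma_1 hankel_0 //; ring.
  have HL := hankel_arc_lim x 0 a Ha (Rle_refl 0) Hx.
  rewrite (hankel_line x 0 a r (sin (x * PI) * Gamma x) 0 Ha (Rle_refl 0) HL).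
  - have := Gamma_reflection x ltac:(lra). rewrite (Rmult_comm PI x) => H.
    transitivity (Gamma x * Gamma (1 - x) * sin (x * PI) / PI); first by field; lra.
    rewrite H. field. lra.
  - apply: integral_R_ext (integral_R_scal (sin (x * PI)) _ _ (Gamma_integral x Hx)) => y.
    rewrite (proj2 (g0_forms _ _ _ _)) /gArg /gMod sin_PI cos_PI.
    rewrite (_ : 1 * exp y * -1 + x * y = x * y - exp y); last ring.
    rewrite (_ : 1 * exp y * 0 + x * PI = x * PI); last ring. ring. }
have H n : forall x, - INR n <= x < 1 -> hankel x 0 a r * Gamma (1 - x) = 1.
{ elim: n => [|n IH] x Hx; first by apply: H0; simpl in Hx; lra.
  case: (Rle_dec 0 x) => Hx0; first by apply: H0; lra.
  rewrite S_INR in Hx. have := IH (x + 1) ltac:(lra). rewrite hankel_succ //.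
  rewrite (_ : 1 - (x + 1) = - x); last ring.
  rewrite (_ : 1 - x = - x + 1); last ring. rewrite Gamma_S; last lra. move=> <-. ring. }
move=> Hk. have [n Hn] := INR_unbounded (- k). apply: (H n). lra.
Qed.

(** Hankel's integral converges for every exponent, so [hankel_succ] continues the identification to
    all real [z], including the poles of Gamma: iterating it produces exactly the factor
    [rising z n] of [inv_Gamma]. *)
Lemma hankel_inv_Gamma (z a r : R) : 0 < a < 1 -> hankel (1 - z) 0 a r = inv_Gamma z.
Proof.
move=> Ha. rewrite /inv_Gamma.
set n := Z.to_nat _.
have Hn : 0 < z + INR n.
{ have [H1 _] := archimed (- z). rewrite /n.
  case: (Z.le_gt_cases 0 (up (- z))) => H.
  - rewrite INR_IZR_INZ Z2Nat.id //. lra.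
  - have : (IZR (up (- z)) < 0) by apply: IZR_lt. have := pos_INR (Z.to_nat (up (- z))). lra. }
have HG := hankel_Gamma (1 - (z + INR n)) a r Ha ltac:(lra).
rewrite (_ : 1 - (1 - (z + INR n)) = z + INR n) in HG; last ring.
have HG0 : Gamma (z + INR n) <> 0. { move=> E. rewrite E Rmult_0_r in HG. lra. }
have H m : hankel (1 - z) 0 a r = rising z m * hankel (1 - (z + INR m)) 0 a r.
{ elim: m => [|m IH]; first by rewrite /= Rplus_0_r Rmult_1_l.
  rewrite IH S_INR [rising _ (S m)]/=.
  have := hankel_succ (- (z + INR m)) a r Ha.
  rewrite (_ : - (z + INR m) + 1 = 1 - (z + INR m)); last ring.
  rewrite (_ : 1 - (z + (INR m + 1)) = - (z + INR m)); last ring.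
  move=> ->. ring. }
rewrite (H n). apply: (Rmult_eq_reg_r (Gamma (z + INR n))) => //.
rewrite Rmult_assoc HG. field. exact: HG0.
Qed.

(** * The Mittag-Leffler function and its remainder as Hankel integrals *)

Lemma exp_INR_mult (n : nat) (y : R) : exp (INR n * y) = exp y ^ n.
Proof.
elim: n => [|n IH]; first by rewrite Rmult_0_l exp_0.
rewrite S_INR Rmult_plus_distr_r exp_plus IH Rmult_1_l /=. ring.
Qed.

(** A finite geometric expansion of [1 / (1 + x s^(-a))] in powers of [- x s^(-a)], obtained one
    term at a time from [hankel_split]. *)
Lemma hankel_expand (a x r : R) (n : nat) : 0 < a < 1 -> 0 < x ->
  hankel 0 x a r = sum_n (fun n => (- x) ^ n / Gamma (a * INR n + 1)) n + (- x) ^ S n * hankel (- (a * INR (S n))) x a r.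
Proof.
move=> Ha Hx.
have Hstep m : hankel (- (a * INR m)) x a r = / Gamma (a * INR m + 1) - x * hankel (- (a * INR (S m))) x a r.
{ have H := hankel_split (- (a * INR m)) x a r Ha (Rlt_le _ _ Hx).
  have Hm := pos_INR m.
  have HG := hankel_Gamma (- (a * INR m)) a r Ha ltac:(nra).
  rewrite (_ : 1 - - (a * INR m) = a * INR m + 1) in HG; last ring.
  have HG0 : Gamma (a * INR m + 1) <> 0. { move=> E. rewrite E Rmult_0_r in HG. lra. }
  rewrite (_ : / Gamma (a * INR m + 1) = hankel (- (a * INR m)) 0 a r).
  - rewrite -H S_INR (_ : - (a * INR m) - a = - (a * (INR m + 1))); last ring. ring.
  - apply: (Rmult_eq_reg_r (Gamma (a * INR m + 1))) => //. by rewrite HG Rinv_l. }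
elim: n => [|n IH].
- rewrite sum_O. have := Hstep 0%nat. rewrite /= Rmult_0_r Ropp_0 => ->. rewrite /Rdiv. ring.
- rewrite IH sum_Sn (Hstep (S n)) /plus /=. rewrite /Rdiv. ring.
Qed.

Lemma mittag_leffler_hankel (a x r : R) : 0 < a < 1 -> 0 < x -> mittag_leffler a (- x) = hankel 0 x a r.
Proof.
move=> Ha Hx. have HPI := PI_RGT_0. have HPa := PI_lt_PI_div a Ha.
(* On the circle of radius [e^r0] and outside it, [x |s|^(-a) <= 1 / 2], so the remainder after [n]
   terms is [O(2^(-n))]. The radius may be chosen freely by [hankel_indep]. *)
pose r0 := ln (2 * x) / a.
rewrite (hankel_indep 0 x a r r0) //; last lra.
apply: is_series_unique.
have Hs := sin_aPI_pos a Ha.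
have H2s : 0 < 2 / sin (a * PI) by apply: Rdiv_lt_0_compat; lra.
have [C0 HC0] := exp_lin_le_decay 0 r0.
have [C1 HC1] := ex_ray_decay 1 r0 Rlt_0_1.
pose C := ((PI - 0) * (2 / sin (a * PI) * exp (exp r0)) + 2 / sin (a * PI) * C0 * C1) / PI.
have Hb m : Rabs (hankel (- (a * INR m)) x a r0) <= C * exp (- (a * INR m) * r0).
{ have Hm := pos_INR m. set k := - (a * INR m). have Hk : k <= 0 by rewrite /k; nra.
  have B1 : Rabs (RInt (gRe 1 k x (- a) r0) 0 PI) <= (PI - 0) * (2 / sin (a * PI) * (exp (exp r0) * exp (k * r0))).
  { apply: (norm_RInt_le_const (V := R_NormedModule) (gRe 1 k x (- a) r0)); first lra; last by apply: hankel_arc_correct; lra.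
    move=> t Ht. have [H _] := g_bound 1 k x (- a) r0 t (sin (a * PI)) Hs (hankel_dSq_ge x a r0 t Ha ltac:(lra) Ht).
    apply: Rle_trans H _. apply: Rmult_le_compat_l; first lra.
    rewrite /gMod -exp_plus. apply: exp_le. have := COS_bound t. have := exp_pos r0. nra. }
  have B2 : Rabs (hankel_ray k x a r0) <= 2 / sin (a * PI) * exp (k * r0) * C0 * C1.
  { refine (ray_integral_le r0 _ _ _ _ _ (hankel_ray_correct k x a r0 Ha ltac:(lra))
      (is_RInt_gen_scal _ (2 / sin (a * PI) * exp (k * r0) * C0) _ HC1)).
    move=> y Hy. apply: Rle_trans (hankel_cut_bound k x a y Ha ltac:(lra)) _.
    rewrite /scal /= /mult /=. move: H2s. move: (2 / sin (a * PI)) => c H2s.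
    rewrite (Rmult_assoc c) (Rmult_assoc c). apply: Rmult_le_compat_l; first lra.
    rewrite Rmult_assoc. apply: (Rle_trans _ (exp (k * r0) * exp (0 * y - exp y))).
    - rewrite -exp_plus. apply: exp_le. nra.
    - apply: Rmult_le_compat_l; [exact: Rlt_le (exp_pos _) | exact: HC0]. }
  rewrite /hankel /C Rabs_div; last lra. rewrite (Rabs_pos_eq PI); last lra.
  rewrite (_ : forall A B : R, A / PI * B = A * B / PI); last by move=> *; rewrite /Rdiv; ring.
  apply: Rmult_le_compat_r; first by apply: Rlt_le; apply: Rinv_0_lt_compat; lra.
  apply: Rle_trans (Rabs_triang _ _) _.
  rewrite -/k. move: H2s B1 B2. move: (2 / sin (a * PI)) => c H2s B1 B2. lra. }
rewrite /is_series.
have Hgeom : is_lim_seq (fun n => C * (/ 2) ^ S n) 0.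
{ have H := is_lim_seq_scal_l _ C _ (is_lim_seq_geom (/ 2) ltac:(split_Rabs; lra)).
  rewrite /= Rmult_0_r in H. exact: (proj1 (is_lim_seq_incr_1 (fun n => C * (/ 2) ^ n) 0) H). }
have Hlim : is_lim_seq (fun n => (- x) ^ S n * hankel (- (a * INR (S n))) x a r0) 0.
{ apply: (is_lim_seq_le_le (fun n => - (C * (/ 2) ^ S n)) _ (fun n => C * (/ 2) ^ S n)).
  - move=> n. apply Rabs_le_between. rewrite Rabs_mult -RPow_abs Rabs_Ropp (Rabs_pos_eq x); last lra.
    have H := Hb (S n).
    have E : exp (- (a * INR (S n)) * r0) = (/ 2) ^ S n * / x ^ S n.
    { have E1 : exp (- ln (2 * x)) = / 2 * / x.
      { rewrite exp_Ropp exp_ln; last lra. field. lra. }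
      rewrite -pow_inv -Rpow_mult_distr -E1 -[in RHS]/(exp _ ^ S n).
      rewrite (_ : - (a * INR (S n)) * r0 = INR (S n) * - ln (2 * x)); last by rewrite /r0; field; lra.
      exact: exp_INR_mult. }
    rewrite E in H. have Hxn : 0 < x ^ S n by apply: pow_lt.
    apply (Rmult_le_compat_l (x ^ S n)) in H; last lra.
    apply: Rle_trans H _. right. field. lra.
  - rewrite -[X in is_lim_seq _ (Finite X)]Ropp_0. apply (is_lim_seq_opp _ 0). exact: Hgeom.
  - exact: Hgeom. }
suff HS : is_lim_seq (sum_n (fun n => (- x) ^ n / Gamma (a * INR n + 1))) (hankel 0 x a r0) by exact: HS.
apply: (is_lim_seq_ext (fun n => hankel 0 x a r0 - (- x) ^ S n * hankel (- (a * INR (S n))) x a r0)).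
- move=> n. rewrite {1}(hankel_expand a x r0 n Ha Hx). ring.
- rewrite -{2}(Rminus_0_r (hankel 0 x a r0)). apply: is_lim_seq_minus' => //. exact: is_lim_seq_const.
Qed.

Lemma algebraic_part_hankel (a x r : R) (m : nat) : 0 < a < 1 -> 0 < x ->
  hankel 0 x a r - algebraic_part a m x = / (- x) ^ m * hankel (a * INR m) x a r.
Proof.
move=> Ha Hx. rewrite /algebraic_part Rminus_def Ropp_involutive.
elim: m => [|m IH].
- rewrite sum_n_m_zero; last lia. rewrite /zero /= Rmult_0_r. field.
- rewrite sum_n_Sm; last lia. rewrite /plus /= -Rplus_assoc IH -(hankel_inv_Gamma _ a r Ha).
  rewrite (_ : 1 - (1 - a * INR (S m)) = a * INR (S m)); last ring.
  rewrite -(hankel_split (a * INR (S m)) x a r Ha (Rlt_le _ _ Hx)).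
  rewrite (_ : a * INR (S m) - a = a * INR m); last by rewrite S_INR; ring.
  have : (- x) ^ m <> 0 by apply: pow_nonzero; lra.
  move=> H. rewrite -[match m with O => 1 | S _ => INR m + 1 end]/(INR (S m)). field. split => //; lra.
Qed.

(** Since [m > 0], the exponent [a m] is positive, so the small circle vanishes in the limit and the
    whole contour collapses onto the cut. *)
Lemma mittag_leffler_remainder (a x : R) (m : nat) : 0 < a < 1 -> 0 < x -> (0 < m)%nat ->
  exists l, integral_R (fun y => gIm 1 (a * INR m) x (- a) y PI) l /\
    mittag_leffler a (- x) - algebraic_part a m x = / (- x) ^ m * (l / PI).
Proof.
move=> Ha Hx Hm. have HPI := PI_RGT_0. have HPa := PI_lt_PI_div a Ha.
have Hk : 0 < a * INR m. { apply: Rmult_lt_0_compat; [lra | exact: (lt_INR 0)]. }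
have Hs := sin_aPI_pos a Ha.
have H2s : 0 < 2 / sin (a * PI) by apply: Rdiv_lt_0_compat; lra.
have [l0 Hl0] := ex_integral_exp_lin (a * INR m) 1 Hk Rlt_0_1.
have [l Hl] : exists l, integral_R (fun y => gIm 1 (a * INR m) x (- a) y PI) l.
{ apply: (ex_RInt_gen_dominated (fun _ => True) _ (fun y => 2 / sin (a * PI) * exp (a * INR m * y - 1 * exp y))) => //.
  - exact: filter_true.
  - exact: filter_true.
  - move=> y. apply: continuous_gIm_r. apply: hankel_dSq_neq => //; lra.
  - move=> y. apply: (continuous_scal_r _ (fun y => exp (a * INR m * y - 1 * exp y))). exact: continuous_exp_lin.
  - move=> y _. rewrite Rmult_1_l. apply: hankel_cut_bound => //. lra.
  - exists (2 / sin (a * PI) * l0). exact: integral_R_scal. }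
exists l; split => //.
rewrite (mittag_leffler_hankel a x 0 Ha Hx) algebraic_part_hankel //. f_equal.
rewrite (hankel_line _ x a 0 l 0 Ha (Rlt_le _ _ Hx) (hankel_arc_lim _ x a Ha (Rlt_le _ _ Hx) Hk) Hl).
by rewrite Rplus_0_l.
Qed.

(** * The saddle variable and its Gaussian moments *)

(* [exp x = 1 + x + x^2 * exp_quot x], with [exp_quot] entire and positive, so
   that [saddle x = x * sqrt (2 * exp_quot x)] is a smooth square root of
   [2 (e^x - 1 - x)], the inverse of [u |-> log t(u)]. *)
Definition exp_quot_coeffs : nat -> R := PS_decr_n (fun n => / INR (fact n)) 2.
Definition exp_quot (x : R) : R := PSeries exp_quot_coeffs x.
Definition exp_quot' (x : R) : R := PSeries (PS_derive exp_quot_coeffs) x.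

Lemma exp_radius : CV_radius (fun n => / INR (fact n)) = p_infty.
Proof.
apply CV_radius_infinite_DAlembert.
- move=> n. apply: Rinv_neq_0_compat. exact: INR_fact_neq_0.
- apply: (is_lim_seq_ext (fun n => / INR (S n))).
  + move=> n. rewrite fact_simpl mult_INR.
    have H1 := INR_fact_neq_0 n. have H2 : INR (S n) <> 0 by apply: not_0_INR.
    rewrite Rabs_pos_eq; first by field.
    apply: Rlt_le. apply: Rdiv_lt_0_compat; apply: Rinv_0_lt_compat; first apply: Rmult_lt_0_compat; try exact: INR_fact_lt_0.
    by apply: lt_0_INR; lia.
  + apply: (is_lim_seq_inv _ p_infty) => //. apply (is_lim_seq_incr_1 INR). exact: is_lim_seq_INR.
Qed.

Lemma exp_quot_radius : CV_radius exp_quot_coeffs = p_infty.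
Proof.
rewrite -exp_radius -[RHS]CV_radius_decr_1 -[RHS]CV_radius_decr_1. by [].
Qed.

Lemma exp_quotE (x : R) : exp x = 1 + x + x ^ 2 * exp_quot x.
Proof.
rewrite exp_Reals (PSeries_decr_n _ 1).
- rewrite /exp_quot /exp_quot_coeffs /=. field.
- apply: CV_radius_inside. by rewrite exp_radius.
Qed.

Lemma exp_quot_pos (x : R) : 0 < exp_quot x.
Proof.
case: (Req_dec x 0) => [->|Hx].
- rewrite /exp_quot PSeries_0 /exp_quot_coeffs /PS_decr_n /=. lra.
- have H := exp_ineq1 x Hx. rewrite exp_quotE in H.
  have : 0 < x ^ 2 by have := Rsqr_pos_lt x Hx; rewrite /Rsqr /=; lra.
  move=> H2. apply: (Rmult_lt_reg_l (x ^ 2)) => //. lra.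
Qed.

Lemma is_derive_exp_quot (x : R) : is_derive exp_quot x (exp_quot' x).
Proof. apply: is_derive_PSeries. by rewrite exp_quot_radius. Qed.

Lemma continuous_exp_quot' (x : R) : continuous exp_quot' x.
Proof.
apply: ex_derive_continuous. eexists. apply: is_derive_PSeries.
by rewrite CV_radius_derive exp_quot_radius.
Qed.

Definition saddle (x : R) : R := x * sqrt (2 * exp_quot x).
Definition saddle' (x : R) : R := sqrt (2 * exp_quot x) + x * exp_quot' x / sqrt (2 * exp_quot x).

Lemma sqrt_exp_quot_pos (x : R) : 0 < sqrt (2 * exp_quot x).
Proof. apply: sqrt_lt_R0. have := exp_quot_pos x. lra. Qed.

Lemma saddle_sq (x : R) : saddle x ^ 2 = 2 * (exp x - 1 - x).
Proof.
rewrite /saddle Rpow_mult_distr pow2_sqrt; last by have := exp_quot_pos x; lra.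
rewrite exp_quotE. ring.
Qed.

Lemma is_derive_saddle (x : R) : is_derive saddle x (saddle' x).
Proof.
rewrite /saddle. have Hq := exp_quot_pos x. have HD := is_derive_exp_quot x.
have Hs := sqrt_exp_quot_pos x.
auto_derive; first by repeat split; [exists (exp_quot' x) | lra].
rewrite (is_derive_unique _ _ _ HD) /saddle'. field. lra.
Qed.

Lemma continuous_saddle' (x : R) : continuous saddle' x.
Proof.
have Hs := sqrt_exp_quot_pos x. have Hq := exp_quot_pos x.
have HC : continuous (fun x => sqrt (2 * exp_quot x)) x.
{ apply: ex_derive_continuous. auto_derive. repeat split; last lra. exists (exp_quot' x). exact: is_derive_exp_quot. }
apply: (continuous_plus (V := R_NormedModule)) => //.
apply: (continuous_mult (K := R_AbsRing)).
- apply: (continuous_mult (K := R_AbsRing)); [exact: continuous_id | exact: continuous_exp_quot'].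
- apply: continuous_Rinv_comp => //. lra.
Qed.

Lemma saddle_0 : saddle 0 = 0. Proof. by rewrite /saddle Rmult_0_l. Qed.

Lemma saddle'_0 : saddle' 0 = 1.
Proof.
rewrite /saddle' /exp_quot PSeries_0 /exp_quot_coeffs /PS_decr_n /=.
rewrite (_ : 2 * / (1 + 1) = 1); last field. rewrite sqrt_1. field.
Qed.

(** This is [u du = (e^x - 1) dx]. It gives the sign of [saddle'] and drives the integrations by
    parts for the moments. *)
Lemma saddle_saddle' (x : R) : saddle x * saddle' x = exp x - 1.
Proof.
have H1 : is_derive (fun x => saddle x ^ 2) x (2 * (saddle x * saddle' x)).
{ have HD := is_derive_saddle x. auto_derive; first by exists (saddle' x).
  rewrite (is_derive_unique _ _ _ HD). ring. }
have H2 : is_derive (fun x => saddle x ^ 2) x (2 * (exp x - 1)).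
{ apply: (is_derive_ext (fun x => 2 * (exp x - 1 - x))); first by move=> y; rewrite saddle_sq.
  auto_derive => //. ring. }
have := is_derive_unique _ _ _ H1. rewrite (is_derive_unique _ _ _ H2). lra.
Qed.

Lemma saddle_pos (x : R) : 0 < x -> 0 < saddle x.
Proof. move=> H. apply: Rmult_lt_0_compat => //. exact: sqrt_exp_quot_pos. Qed.

Lemma saddle_neg (x : R) : x < 0 -> saddle x < 0.
Proof. move=> H. have := sqrt_exp_quot_pos x. rewrite /saddle. nra. Qed.

Lemma saddle'_pos (x : R) : 0 < saddle' x.
Proof.
have H := saddle_saddle' x.
case: (Rtotal_order x 0) => [Hx|[->|Hx]].
- have H1 := saddle_neg x Hx. have : exp x < exp 0 by apply: exp_increasing. rewrite exp_0. nra.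
- rewrite saddle'_0. lra.
- have H1 := saddle_pos x Hx. have : exp 0 < exp x by apply: exp_increasing. rewrite exp_0. nra.
Qed.

Lemma filterlim_saddle_p : filterlim saddle (Rbar_locally p_infty) (Rbar_locally p_infty).
Proof.
move=> P [M HM]. exists (Rmax 1 M) => x Hx. apply: HM.
have := Rmax_l 1 M. have := Rmax_r 1 M => H1 H2.
have Hp := saddle_pos x ltac:(lra). have Hsq := saddle_sq x.
have HT : 1 + x + x ^ 2 / 2 <= exp x.
{ have := exp_ge_taylor x 2 ltac:(lra). rewrite /=. lra. }
have : x <= saddle x by apply: Rnot_lt_le => H; nra.
lra.
Qed.

Lemma filterlim_saddle_m : filterlim saddle (Rbar_locally m_infty) (Rbar_locally m_infty).
Proof.
move=> P [M HM]. exists (- (M ^ 2 + 2)) => x Hx. apply: HM.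
have HM2 := pow2_ge_0 M.
have Hp := saddle_neg x ltac:(lra). have Hsq := saddle_sq x. have He := exp_pos x.
apply: Rnot_le_lt => H. nra.
Qed.

(** * Gaussian integral and moments in the saddle variable *)

Lemma ray_integral_lim (f : R -> R) (r l : R) (F : (R -> Prop) -> Prop) {FF : Filter F} :
  is_RInt_gen f (at_point r) F l -> filterlim (RInt f r) F (locally l).
Proof.
move=> H P HP. have [Q1 Q2 HQ1 HQ2 HQ] := H P HP.
rewrite /filtermap. apply: (filter_imp Q2) => // x Hx.
have [y [Hy1 Hy2]] := HQ r x HQ1 Hx. by rewrite (is_RInt_unique _ _ _ _ Hy1).
Qed.

Definition gauss_primitive (X v : R) : R := RInt (fun s => exp (- X * s ^ 2 / 2)) 0 v.

Lemma continuous_gauss (X s : R) : continuous (fun s => exp (- X * s ^ 2 / 2)) s.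
Proof. apply: ex_derive_continuous. by auto_derive. Qed.

Lemma is_derive_gauss_primitive (X v : R) : is_derive (gauss_primitive X) v (exp (- X * v ^ 2 / 2)).
Proof.
apply: (is_derive_RInt (V := R_NormedModule) (fun s => exp (- X * s ^ 2 / 2)) (gauss_primitive X) 0 v).
- apply: filter_forall => x. apply: (RInt_correct (V := R_CompleteNormedModule)).
  apply: ex_RInt_continuous_R => y. exact: continuous_gauss.
- exact: continuous_gauss.
Qed.

Lemma gauss_primitive_odd (X v : R) : gauss_primitive X (- v) = - gauss_primitive X v.
Proof.
rewrite /gauss_primitive.
have H : is_RInt (fun s => exp (- X * s ^ 2 / 2)) 0 v (RInt (fun s => exp (- X * s ^ 2 / 2)) 0 v).
{ apply: (RInt_correct (V := R_CompleteNormedModule)). apply: ex_RInt_continuous_R => y. exact: continuous_gauss. }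
apply: is_RInt_unique.
have H2 := is_RInt_comp_opp (fun s => exp (- X * s ^ 2 / 2)) 0 (- v) (- - RInt (fun s => exp (- X * s ^ 2 / 2)) 0 v).
rewrite Ropp_0 !Ropp_involutive in H2. have {H2} := H2 H => H2.
have H3 := is_RInt_opp _ _ _ _ H2.
apply: is_RInt_ext H3 => x _. rewrite /opp /= Ropp_involutive. f_equal. field.
Qed.

(** The Gaussian integral is read off from [Gamma (1 / 2) = sqrt PI] through the substitution
    [e^y = X s^2 / 2]. *)
Lemma gauss_primitive_lim (X : R) : 0 < X ->
  filterlim (gauss_primitive X) (Rbar_locally p_infty) (locally (sqrt (2 * PI / X) / 2)).
Proof.
move=> HX. have HPI := PI_RGT_0.
have [l Hl] : ex_RInt_gen (fun s => exp (- X * s ^ 2 / 2)) (at_point 0) (Rbar_locally p_infty).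
{ apply: (ex_ray_integral_decay _ 0 1 (4 * exp (/ (2 * X)))); first lra.
  - exact: continuous_gauss.
  - move=> y Hy. rewrite Rabs_pos_eq; last by apply: Rlt_le; apply: exp_pos.
    have Hq : y - X * y ^ 2 / 2 <= / (2 * X).
    { have H := pow2_ge_0 (X * y - 1). apply: (Rmult_le_reg_l (2 * X)); first lra.
      rewrite Rinv_r; nra. }
    apply: le_decay; last by apply: Rlt_le; apply: exp_pos.
    + rewrite -exp_plus. apply: exp_le. lra.
    + rewrite -exp_plus. apply: exp_le. lra. }
have Hlim := ray_integral_lim _ _ _ _ Hl.
suff -> : sqrt (2 * PI / X) / 2 = l by exact: Hlim.
have HG := Gamma_integral (1 / 2) ltac:(lra).
have HP : integral_R (fun y => exp (1 / 2 * y - exp y)) (sqrt (2 * X) * l - sqrt (2 * X) * gauss_primitive X 0).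
{ have H2X : 0 < sqrt (2 * X) by apply: sqrt_lt_R0; lra.
  have Hsq : sqrt (2 * X) * sqrt (2 * X) = 2 * X by apply: sqrt_sqrt; lra.
  have HE y : 2 / sqrt (2 * X) * exp (1 / 2 * y) * (2 / sqrt (2 * X) * exp (1 / 2 * y)) * X / 2 = exp y.
  { rewrite (_ : exp y = exp (1 / 2 * y) * exp (1 / 2 * y)); last by rewrite -exp_plus; f_equal; field.
    rewrite (_ : forall u : R, 2 / sqrt (2 * X) * u * (2 / sqrt (2 * X) * u) * X / 2 = u * u * (2 * X) / (sqrt (2 * X) * sqrt (2 * X))).
    - rewrite Hsq. field. lra.
    - move=> u. field. lra. }
  apply (is_RInt_gen_primitive (fun y => sqrt (2 * X) * gauss_primitive X (2 / sqrt (2 * X) * exp (1 / 2 * y)))).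
  - move=> y. have HD := is_derive_gauss_primitive X (2 / sqrt (2 * X) * exp (1 / 2 * y)).
    auto_derive; first by eexists; exact: HD.
    rewrite (is_derive_unique _ _ _ HD).
    rewrite (_ : - X * (2 / sqrt (2 * X) * exp (1 / 2 * y)) ^ 2 / 2 = - exp y); last by rewrite -(HE y); field; lra.
    rewrite /Rminus exp_plus. field. lra.
  - move=> y. apply: ex_derive_continuous. by auto_derive.
  - apply: (filterlim_comp _ _ _ (fun y => exp (1 / 2 * y)) (fun z => sqrt (2 * X) * gauss_primitive X (2 / sqrt (2 * X) * z)) _ (locally 0)).
    + apply: filterlim_exp_m. lra.
    + have HD := is_derive_gauss_primitive X (2 / sqrt (2 * X) * 0).
      have HC : continuous (fun z => sqrt (2 * X) * gauss_primitive X (2 / sqrt (2 * X) * z)) 0.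
      { apply: ex_derive_continuous. auto_derive. eexists. exact: HD. }
      move: HC. by rewrite /continuous Rmult_0_r.
  - apply: (is_lim_scal_l (fun y => gauss_primitive X (2 / sqrt (2 * X) * exp (1 / 2 * y))) (sqrt (2 * X)) p_infty l).
    apply: (filterlim_comp _ _ _ (fun y => 2 / sqrt (2 * X) * exp (1 / 2 * y)) (gauss_primitive X) _ (Rbar_locally p_infty)); last exact: Hlim.
    move=> P [M HM]. have [N HN] := filterlim_exp_p (1 / 2) ltac:(lra) (fun z => M * sqrt (2 * X) / 2 < z) (ex_intro _ (M * sqrt (2 * X) / 2) (fun x H => H)).
    exists N => y /HN Hy. apply: HM.
    apply: (Rmult_lt_reg_r (sqrt (2 * X) / 2)); first lra.
    rewrite (_ : 2 / sqrt (2 * X) * exp (1 / 2 * y) * (sqrt (2 * X) / 2) = exp (1 / 2 * y)); first lra. field. lra. }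
have H0 : gauss_primitive X 0 = 0 by rewrite /gauss_primitive RInt_point.
have := integral_R_unique _ _ _ HG HP. rewrite H0 Gamma_half => E.
have H2X : 0 < sqrt (2 * X) by apply: sqrt_lt_R0; lra.
apply: (Rmult_eq_reg_l (sqrt (2 * X))); last lra.
rewrite (_ : sqrt (2 * X) * l = sqrt PI); last lra.
rewrite (_ : 2 * PI / X = (2 * X) * (PI / X ^ 2)); last by field; lra.
have Hd : 0 < PI / X ^ 2 by apply: Rdiv_lt_0_compat; [lra | exact: pow_lt].
rewrite (sqrt_mult (2 * X)); try lra.
rewrite sqrt_div_alt; last exact: pow_lt. rewrite sqrt_pow2; last lra.
rewrite (_ : sqrt (2 * X) * (sqrt (2 * X) * (sqrt PI / X) / 2) = (sqrt (2 * X) * sqrt (2 * X)) * sqrt PI / (2 * X)); last by field; lra.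
rewrite sqrt_sqrt; last lra. field. lra.
Qed.

(** The integrand [u^r e^(- X u^2 / 2) du] pulled back by [u = saddle x]. Keeping the moments in the
    variable [x] allows a pointwise comparison with the integrand of the remainder. *)
Definition moment_fun (X : R) (r : nat) (x : R) : R := saddle x ^ r * saddle' x * exp (- X * (exp x - 1 - x)).

Lemma continuous_saddle (x : R) : continuous saddle x.
Proof. apply: ex_derive_continuous. eexists. exact: is_derive_saddle. Qed.

Lemma continuous_moment_fun (X : R) (r : nat) (x : R) : continuous (moment_fun X r) x.
Proof.
apply: (continuous_mult (K := R_AbsRing)).
- apply: (continuous_mult (K := R_AbsRing)); last exact: continuous_saddle'.
  apply: (continuous_comp saddle (fun v => v ^ r)); first exact: continuous_saddle.
  apply: ex_derive_continuous. by auto_derive.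
- apply: ex_derive_continuous. by auto_derive.
Qed.

Lemma moment_0 (X : R) : 0 < X -> integral_R (moment_fun X 0) (sqrt (2 * PI / X)).
Proof.
move=> HX. have HL := gauss_primitive_lim X HX.
rewrite (_ : sqrt (2 * PI / X) = sqrt (2 * PI / X) / 2 - - (sqrt (2 * PI / X) / 2)); last field.
apply (is_RInt_gen_primitive (fun x => gauss_primitive X (saddle x))).
- move=> x. have H1 := is_derive_gauss_primitive X (saddle x). have H2 := is_derive_saddle x.
  have := is_derive_comp _ _ _ _ _ H1 H2.
  rewrite /scal /= /mult /= /moment_fun /= Rmult_1_l.
  rewrite (_ : - X * (saddle x * (saddle x * 1)) / 2 = - X * (exp x - 1 - x)) //.
  have := saddle_sq x. rewrite /= => ->. field.
- exact: continuous_moment_fun.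
- apply: (filterlim_ext (fun x => - gauss_primitive X (- saddle x))).
  { move=> x. by rewrite gauss_primitive_odd Ropp_involutive. }
  apply: (is_lim_opp (fun x => gauss_primitive X (- saddle x)) m_infty (sqrt (2 * PI / X) / 2)).
  apply: (filterlim_comp _ _ _ (fun x => - saddle x) (gauss_primitive X) _ (Rbar_locally p_infty)) HL.
  exact (is_lim_opp saddle m_infty m_infty filterlim_saddle_m).
- exact: (filterlim_comp _ _ _ saddle (gauss_primitive X) _ _ _ filterlim_saddle_p HL).
Qed.

Lemma pow_gauss_lim (X : R) (n : nat) : 0 < X ->
  filterlim (fun v => v ^ n * exp (- X * v ^ 2 / 2)) (Rbar_locally p_infty) (locally 0).
Proof.
move=> HX.
pose C := INR (fact n) * exp (/ (2 * X) * 4).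
have Hb v : 0 <= v -> 0 <= v ^ n * exp (- X * v ^ 2 / 2) <= C * exp (1 * - v).
{ move=> Hv. have He := exp_pos (- X * v ^ 2 / 2). have Hvn := pow_le v n Hv. split; first by apply: Rmult_le_pos; lra.
  have H1 : v ^ n <= INR (fact n) * exp v.
  { have HT := exp_ge_taylor v n Hv.
    have HF := INR_fact_lt_0 n.
    have H2 : v ^ n / INR (fact n) <= exp v.
    { apply: Rle_trans HT. case: (n) => [|m]; first by right.
      rewrite tech5. rewrite -[X in X <= _]Rplus_0_l. apply: Rplus_le_compat_r.
      apply: cond_pos_sum => k. apply: Rdiv_le_0_compat; [exact: pow_le | exact: INR_fact_lt_0]. }
    apply (Rmult_le_compat_l (INR (fact n))) in H2; last lra.
    rewrite (_ : INR (fact n) * (v ^ n / INR (fact n)) = v ^ n) in H2; first by []. field. lra. }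
  apply: (Rle_trans _ (INR (fact n) * exp v * exp (- X * v ^ 2 / 2))); first by apply: Rmult_le_compat_r; lra.
  rewrite /C !Rmult_assoc. apply: Rmult_le_compat_l; first by apply: Rlt_le; exact: INR_fact_lt_0.
  rewrite -!exp_plus. apply: exp_le.
  have H := pow2_ge_0 (X * v - 2).
  have : 2 * v - X * v ^ 2 / 2 <= / (2 * X) * 4; last lra.
  apply: (Rmult_le_reg_l (2 * X)); first lra. rewrite -Rmult_assoc Rinv_r; nra. }
have Hl : filterlim (fun v => C * exp (1 * - v)) (Rbar_locally p_infty) (locally (C * 0)).
{ apply: (is_lim_scal_l (fun v => exp (1 * - v)) C p_infty 0).
  apply: (filterlim_comp _ _ _ Ropp (fun v => exp (1 * v)) _ (Rbar_locally m_infty)); last by apply: filterlim_exp_m; lra.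
  exact (is_lim_opp (fun x => x) p_infty p_infty (is_lim_id p_infty)). }
apply filterlim_locally => eps.
have [M HM] := proj1 (filterlim_locally _ _) Hl eps.
exists (Rmax M 0) => v Hv. have := Rmax_l M 0. have := Rmax_r M 0 => H1 H2.
have [B1 B2] := Hb v ltac:(lra). have := HM v ltac:(lra).
rewrite /ball /= /AbsRing_ball /abs /minus /plus /opp /= Rmult_0_r Ropp_0 !Rplus_0_r.
rewrite -/(v ^ 2).
move=> H. apply: Rle_lt_trans H. rewrite !Rabs_pos_eq; lra.
Qed.

Lemma moment_boundary_p (X : R) (n : nat) : 0 < X ->
  filterlim (fun x => saddle x ^ n * exp (- X * (exp x - 1 - x))) (Rbar_locally p_infty) (locally 0).
Proof.
move=> HX.
apply: (filterlim_ext (fun x => saddle x ^ n * exp (- X * saddle x ^ 2 / 2))).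
{ move=> x. rewrite saddle_sq. do 2 f_equal. field. }
exact: (filterlim_comp _ _ _ saddle (fun v => v ^ n * exp (- X * v ^ 2 / 2)) _ _ _ filterlim_saddle_p (pow_gauss_lim X n HX)).
Qed.

Lemma moment_boundary_m (X : R) (n : nat) : 0 < X ->
  filterlim (fun x => saddle x ^ n * exp (- X * (exp x - 1 - x))) (Rbar_locally m_infty) (locally 0).
Proof.
move=> HX.
apply: (filterlim_ext (fun x => (-1) ^ n * ((- saddle x) ^ n * exp (- X * (- saddle x) ^ 2 / 2)))).
{ move=> x. rewrite -Rmult_assoc -Rpow_mult_distr (_ : -1 * - saddle x = saddle x); last ring.
  rewrite (_ : (- saddle x) ^ 2 = saddle x ^ 2); last ring. rewrite saddle_sq. do 2 f_equal. field. }
rewrite -(Rmult_0_r ((-1) ^ n)).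
apply: (is_lim_scal_l (fun x => (- saddle x) ^ n * exp (- X * (- saddle x) ^ 2 / 2)) ((-1) ^ n) m_infty 0).
apply: (filterlim_comp _ _ _ (fun x => - saddle x) (fun v => v ^ n * exp (- X * v ^ 2 / 2)) _ (Rbar_locally p_infty) _ _ (pow_gauss_lim X n HX)).
exact (is_lim_opp saddle m_infty m_infty filterlim_saddle_m).
Qed.

Lemma is_derive_moment_boundary (X : R) (n : nat) (x : R) :
  is_derive (fun x => saddle x ^ S n * exp (- X * (exp x - 1 - x))) x
    (INR (S n) * moment_fun X n x - X * moment_fun X (S (S n)) x).
Proof.
have HD := is_derive_saddle x. have HS := saddle_saddle' x.
auto_derive; first by exists (saddle' x).
rewrite (is_derive_unique _ _ _ HD) /moment_fun.
rewrite (_ : saddle x ^ S (S n) * saddle' x = saddle x ^ S n * (exp x - 1)); last by rewrite -HS /=; ring.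
rewrite -[match n with O => 1 | S _ => INR n + 1 end]/(INR (S n)) -[saddle x ^ S n]/(saddle x * saddle x ^ n).
rewrite /Rminus. ring.
Qed.

Lemma moment_1 (X : R) : 0 < X -> integral_R (moment_fun X 1) 0.
Proof.
move=> HX. rewrite -(Rmult_0_r (- / X)).
have H : integral_R (fun x => - X * moment_fun X 1 x) (0 - 0).
{ apply (is_RInt_gen_primitive (fun x => saddle x ^ 0 * exp (- X * (exp x - 1 - x)))).
  - move=> x. have HS := saddle_saddle' x.
    apply: (is_derive_ext (fun x => exp (- X * (exp x - 1 - x)))); first by move=> y; rewrite /= Rmult_1_l.
    auto_derive => //. rewrite /moment_fun pow_1 HS /Rminus. ring.
  - move=> x. apply: (continuous_scal_r (- X) (moment_fun X 1)). exact: continuous_moment_fun.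
  - exact: moment_boundary_m.
  - exact: moment_boundary_p. }
have H2 := integral_R_scal (- / X) _ _ H. rewrite Rminus_0_r in H2.
apply: integral_R_ext H2 => x. field. lra.
Qed.

(** The derivative of [u^(n+1) e^(- X u^2 / 2)] integrates to 0, its boundary values being 0. *)
Lemma moment_SS (X : R) (n : nat) (m : R) : 0 < X -> integral_R (moment_fun X n) m ->
  integral_R (moment_fun X (S (S n))) (INR (S n) / X * m).
Proof.
move=> HX Hm.
have H : integral_R (fun x => INR (S n) * moment_fun X n x - X * moment_fun X (S (S n)) x) (0 - 0).
{ apply (is_RInt_gen_primitive (fun x => saddle x ^ S n * exp (- X * (exp x - 1 - x)))).
  - move=> x. exact: is_derive_moment_boundary.
  - move=> x. apply: (continuous_minus (V := R_NormedModule)).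
    + apply: (continuous_scal_r (INR (S n)) (moment_fun X n)). exact: continuous_moment_fun.
    + apply: (continuous_scal_r X (moment_fun X (S (S n)))). exact: continuous_moment_fun.
  - exact: moment_boundary_m.
  - exact: moment_boundary_p. }
have H2 := integral_R_scal (/ X) _ _ (integral_R_minus _ _ _ _ (integral_R_scal (INR (S n)) _ _ Hm) H).
rewrite (_ : INR (S n) / X * m = / X * (INR (S n) * m - (0 - 0))); last by rewrite /Rdiv; ring.
apply: integral_R_ext H2 => x. field. lra.
Qed.

Lemma moment_odd (X : R) (k : nat) : 0 < X -> integral_R (moment_fun X (2 * k + 1)) 0.
Proof.
move=> HX. elim: k => [|k IH]; first exact: moment_1.
rewrite (_ : (2 * S k + 1 = S (S (2 * k + 1)))%nat); last lia.
rewrite -(Rmult_0_r (INR (S (2 * k + 1)) / X)). exact: moment_SS.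
Qed.

(** Each step multiplies by [(2 k + 1) / X = (1 / 2 + k) / (X / 2)], which builds up the Pochhammer
    factor together with the power of [X / 2]. *)
Lemma moment_even (X : R) (k : nat) : 0 < X ->
  integral_R (moment_fun X (2 * k)) (rising (1 / 2) k * / (X / 2) ^ k * sqrt (2 * PI / X)).
Proof.
move=> HX. elim: k => [|k IH].
- rewrite /= Rinv_1 !Rmult_1_l. exact: moment_0.
- rewrite (_ : (2 * S k = S (S (2 * k)))%nat); last lia.
  rewrite (_ : rising (1 / 2) (S k) * / (X / 2) ^ S k * sqrt (2 * PI / X) =
     INR (S (2 * k)) / X * (rising (1 / 2) k * / (X / 2) ^ k * sqrt (2 * PI / X))); first exact: moment_SS.
  rewrite S_INR mult_INR [rising _ (S k)]/= [(X / 2) ^ S k]/= [INR 2]/=.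
  have : (X / 2) ^ k <> 0 by apply: pow_nonzero; lra.
  move=> H. field. split => //; lra.
Qed.

(** * Inversion of the saddle map *)

Lemma Ceq (z w : C) : Re z = Re w -> Im z = Im w -> z = w.
Proof. by case: z => a b; case: w => c d /= -> ->. Qed.

Lemma Cexp_plus (z w : C) : Cexp (z + w) = (Cexp z * Cexp w)%C.
Proof.
apply: Ceq; rewrite /Cexp /Re /Im /= ?cos_plus ?sin_plus exp_plus; ring.
Qed.

Lemma Cexp_RtoC (r : R) : Cexp (RtoC r) = RtoC (exp r).
Proof. apply: Ceq; rewrite /Cexp /Re /Im /= ?cos_0 ?sin_0; ring. Qed.

(** Used to exponentiate the relation that defines [t], which removes any question of branch of the
    logarithm. *)
Lemma Cexp_Clog (z : C) : z <> RtoC 0 -> Cexp (Clog z) = z.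
Proof.
move=> Hz. have Hm := proj1 (Cmod_gt_0 z) Hz.
have Hsq := Cmod2_alt z.
have Hr : -1 <= Re z / Cmod z <= 1.
{ have := re_le_Cmod z => H. split.
  - apply: (Rmult_le_reg_r (Cmod z)) => //. rewrite /Rdiv Rmult_assoc Rinv_l; last lra. split_Rabs; lra.
  - apply: (Rmult_le_reg_r (Cmod z)) => //. rewrite /Rdiv Rmult_assoc Rinv_l; last lra. split_Rabs; lra. }
have Hs : sqrt (1 - (Re z / Cmod z)²) = Rabs (Im z) / Cmod z.
{ rewrite -(sqrt_Rsqr (Rabs (Im z) / Cmod z)).
  - f_equal. rewrite /Rsqr.
    have E : Rabs (Im z) * Rabs (Im z) = Im z ^ 2 by rewrite -(pow2_abs (Im z)); ring.
    rewrite (_ : Rabs (Im z) / Cmod z * (Rabs (Im z) / Cmod z) = (Rabs (Im z) * Rabs (Im z)) / Cmod z ^ 2); last by field; lra.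
    rewrite E (_ : Im z ^ 2 = Cmod z ^ 2 - Re z ^ 2); last lra. field. lra.
  - apply: Rmult_le_pos; [exact: Rabs_pos | apply: Rlt_le; exact: Rinv_0_lt_compat]. }
have Hcos : Cmod z * cos (Carg z) = Re z.
{ rewrite /Carg. case: Rlt_dec => H; rewrite ?cos_neg cos_acos //; field; lra. }
have Hsin : Cmod z * sin (Carg z) = Im z.
{ rewrite /Carg. case: Rlt_dec => H; rewrite ?sin_neg sin_acos // Hs.
  - rewrite Rabs_left //. field. lra.
  - rewrite Rabs_pos_eq; last lra. field. lra. }
have E : Cexp (Clog z) = (exp (ln (Cmod z)) * cos (Carg z), exp (ln (Cmod z)) * sin (Carg z)) by [].
rewrite E exp_ln // Hcos Hsin. by case: z {Hz Hm Hsq Hr Hs Hcos Hsin E}.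
Qed.

Lemma Clog_pos (r : R) : 0 < r -> Clog (RtoC r) = RtoC (ln r).
Proof.
move=> Hr. rewrite /Clog /Carg Cmod_R Rabs_pos_eq; last lra.
rewrite (_ : Im (RtoC r) = 0) // (_ : Re (RtoC r) = r) //. case: Rlt_dec => H; first lra.
rewrite (_ : r / r = 1); last by field; lra. by rewrite acos_1.
Qed.

Lemma Cpower_exp (y s : R) : Cpower (RtoC (exp y)) s = RtoC (exp (s * y)).
Proof.
rewrite /Cpower Clog_pos; last exact: exp_pos. by rewrite ln_exp -RtoC_mult Cexp_RtoC.
Qed.

Lemma sin_taylor1 (y : R) : Rabs y <= 1 -> Rabs (sin y - y) <= y ^ 2.
Proof.
move=> Hy.
have H x : 0 <= x <= 1 -> 0 <= x - sin x <= x ^ 2.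
{ move=> Hx.
  have [z [Hz Hz']] := MVT_gen (fun x => x - sin x) 0 x (fun x => 1 - cos x)
     ltac:(move=> w _; auto_derive => //; ring) ltac:(move=> w _; apply: derivable_continuous_pt; apply: ex_derive_Reals_0; by auto_derive).
  rewrite Rmin_left ?Rmax_right in Hz; try lra.
  have [C1 C2] := one_minus_cos_le z. rewrite sin_0 in Hz'. nra. }
case: (Rle_dec 0 y) => Hy0.
- have := H y ltac:(split_Rabs; lra). split_Rabs; lra.
- have := H (- y) ltac:(split_Rabs; lra). rewrite sin_neg. split_Rabs; nra.
Qed.

Lemma Cexp_taylor1 (z : C) : Cmod z <= 1 -> Cmod (Cexp z - 1 - z) <= 20 * Cmod z ^ 2.
Proof.
case: z => x y Hz.
have Hx : Rabs x <= Cmod (x, y) by exact: (re_le_Cmod (x, y)).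
have Hy : Rabs y <= Cmod (x, y).
{ have := Rmax_Cmod (x, y). rewrite /=. have := Rmax_r (Rabs x) (Rabs y). lra. }
have Hsq : Cmod (x, y) ^ 2 = x ^ 2 + y ^ 2 by exact: (Cmod2_alt (x, y)).
rewrite Hsq.
have [T1 T2] := exp_taylor1 x. have [D1 D2] := one_minus_cos_le y.
have S := sin_taylor1 y ltac:(lra).
have He1 : exp 1 <= 3 by exact: exp_le_3.
have Hex : exp x <= exp 1 by apply: exp_le; move: Hx; split_Rabs; lra.
have Heax : exp (Rabs x) <= exp 1 by apply: exp_le; lra.
have Hx2 := pow2_ge_0 x. have Hy2 := pow2_ge_0 y. have He0 := exp_pos x.
have E : (Cexp (x, y) - 1 - (x, y))%C = (exp x * cos y - 1 - x, exp x * sin y - y).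
{ apply: Ceq; rewrite /Cexp /Re /Im /=; ring. }
rewrite E. apply: Rle_trans (Cmod_2Rmax _) _. rewrite [fst _]/= [snd _]/=.
have Hs2 : sqrt 2 <= 2. { rewrite -{2}(sqrt_pow2 2); last lra. apply: sqrt_le_1_alt. lra. }
have R1 : Rabs (exp x * cos y - 1 - x) <= 5 * (x ^ 2 + y ^ 2).
{ rewrite (_ : exp x * cos y - 1 - x = (exp x - 1 - x) - exp x * (1 - cos y)); last ring.
  have Q1 : 0 <= exp x * (1 - cos y) <= 3 * (y ^ 2 / 2).
  { split; first by apply: Rmult_le_pos; lra. apply: Rmult_le_compat; lra. }
  have Q2 : exp x - 1 - x <= 3 * x ^ 2.
  { apply: Rle_trans T2 _. rewrite Rmult_comm. apply: Rmult_le_compat_r; lra. }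
  apply: Rabs_le. lra. }
have R2 : Rabs (exp x * sin y - y) <= 10 * (x ^ 2 + y ^ 2).
{ rewrite (_ : exp x * sin y - y = (exp x - 1 - x) * sin y + x * sin y + (sin y - y)); last ring.
  have Hsy := Rabs_sin_le y. have Hs1 := SIN_bound y.
  have Q2 : exp x - 1 - x <= 3 * x ^ 2.
  { apply: Rle_trans T2 _. rewrite Rmult_comm. apply: Rmult_le_compat_r; lra. }
  have Q3 : Rabs ((exp x - 1 - x) * sin y) <= 3 * x ^ 2.
  { rewrite Rabs_mult (Rabs_pos_eq _ T1). have : Rabs (sin y) <= 1 by apply: Rabs_le; lra. have := Rabs_pos (sin y). nra. }
  have Q4 : Rabs (x * sin y) <= x ^ 2 + y ^ 2.
  { rewrite Rabs_mult. have A1 := pow2_abs x. have A2 := pow2_abs y. have A3 := Rabs_pos x.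
    have A4 := pow2_ge_0 (Rabs x - Rabs y). nra. }
  apply: Rle_trans (Rabs_triang _ _) _.
  have := Rabs_triang ((exp x - 1 - x) * sin y) (x * sin y). lra. }
have := Rmax_lub _ _ (10 * (x ^ 2 + y ^ 2)) (Rle_trans _ _ (10 * (x ^ 2 + y ^ 2)) R1 ltac:(lra)) R2.
have := Rle_trans _ _ _ (Rabs_pos _) (Rmax_l (Rabs (exp x * cos y - 1 - x)) (Rabs (exp x * sin y - y))).
have := sqrt_pos 2. nra.
Qed.

Lemma pow_n_RtoC (u : R) (k : nat) : pow_n (K := C_AbsRing) (RtoC u) k = RtoC (u ^ k).
Proof. elim: k => [|k IH] //=. rewrite IH. by rewrite /mult /= -RtoC_mult. Qed.

Lemma pow_n_R (u : R) (k : nat) : pow_n (K := R_AbsRing) u k = u ^ k.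
Proof. by elim: k => [|k IH] //=. Qed.

Lemma is_pseries_parts (b : nat -> C) (u : R) (s : C) :
  is_pseries (K := C_AbsRing) (V := C_NormedModule) b (RtoC u) s ->
  is_pseries (fun k => Re (b k)) u (Re s) /\ is_pseries (fun k => Im (b k)) u (Im s).
Proof.
move=> H.
have HS n : sum_n (fun k => scal (pow_n (K := C_AbsRing) (RtoC u) k) (b k : C_NormedModule)) n
   = (sum_n (fun k => scal (pow_n (K := R_AbsRing) u k) (Re (b k) : R_NormedModule)) n,
      sum_n (fun k => scal (pow_n (K := R_AbsRing) u k) (Im (b k) : R_NormedModule)) n) :> C.
{ have Ht k : scal (pow_n (K := C_AbsRing) (RtoC u) k) (b k : C_NormedModule) =
     (scal (pow_n (K := R_AbsRing) u k) (Re (b k) : R_NormedModule),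
      scal (pow_n (K := R_AbsRing) u k) (Im (b k) : R_NormedModule)) :> C.
  { rewrite pow_n_RtoC pow_n_R. apply: Ceq; rewrite /scal /= /mult /= /Re /Im /=; ring. }
  elim: n => [|n IH]; first by rewrite !sum_O Ht.
  rewrite !sum_Sn IH Ht. by []. }
have H' : filterlim (fun n => (sum_n (fun k => scal (pow_n (K := R_AbsRing) u k) (Re (b k) : R_NormedModule)) n,
      sum_n (fun k => scal (pow_n (K := R_AbsRing) u k) (Im (b k) : R_NormedModule)) n) : C_UniformSpace)
   eventually (locally (s : C_UniformSpace)).
{ by apply: (filterlim_ext _ _ HS). }
case: s {H} H' => s1 s2 H'. split.
- exact: (filterlim_comp _ _ _ _ _ _ _ _ H' (continuous_fst (U := R_UniformSpace) (V := R_UniformSpace) s1 s2)).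
- exact: (filterlim_comp _ _ _ _ _ _ _ _ H' (continuous_snd (U := R_UniformSpace) (V := R_UniformSpace) s1 s2)).
Qed.

Lemma locally_C_real (P : C -> Prop) : locally (T := C_UniformSpace) (RtoC 0) P ->
  exists d, 0 < d /\ forall u : R, Rabs u < d -> P (RtoC u).
Proof.
move=> [d Hd]. exists d. split; first exact: cond_pos.
move=> u Hu. apply: Hd. split.
- rewrite /ball /= /AbsRing_ball /abs /minus /plus /opp /=. by rewrite Ropp_0 Rplus_0_r.
- exact: ball_center.
Qed.

Lemma pseries_radius (b : nat -> R) (d : R) : 0 < d -> ex_pseries b (d / 2) ->
  Rbar_lt (d / 4) (CV_radius b).
Proof.
move=> Hd Hb. case: (Rbar_lt_le_dec (CV_radius b) (Rabs (d / 2))) => H.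
- exfalso. apply: (CV_disk_outside _ _ H).
  have := ex_series_lim_0 _ Hb. apply: is_lim_seq_ext => n.
  rewrite pow_n_R /scal /= /mult /=. ring.
- apply: Rbar_lt_le_trans H. rewrite /= Rabs_pos_eq; lra.
Qed.

(** Convergence at the real point [d / 2] bounds both real radii from below, so for [|u| < d / 4]
    the complex series is a pair of real power series, to which real calculus applies. *)
Lemma pseries_on_reals (b : nat -> C) (P : C -> C -> Prop) :
  locally (T := C_UniformSpace) (RtoC 0)
    (fun u => exists s, is_pseries (K := C_AbsRing) (V := C_NormedModule) b u s /\ P u s) ->
  exists d, 0 < d /\ Rbar_lt d (CV_radius (fun k => Re (b k))) /\ Rbar_lt d (CV_radius (fun k => Im (b k))) /\
    forall u : R, Rabs u < d -> P (RtoC u) (PSeries (fun k => Re (b k)) u, PSeries (fun k => Im (b k)) u).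
Proof.
move=> /locally_C_real [d [Hd H]]. exists (d / 4).
have [s [Hs _]] := H (d / 2) ltac:(rewrite Rabs_pos_eq; lra).
have [Hs1 Hs2] := is_pseries_parts _ _ _ Hs.
split; first lra. split; first by apply: pseries_radius => //; exists (Re s).
split; first by apply: pseries_radius => //; exists (Im s).
move=> u Hu. have [z [Hz HP]] := H u ltac:(lra).
have [Hz1 Hz2] := is_pseries_parts _ _ _ Hz.
rewrite (is_pseries_unique _ _ _ Hz1) (is_pseries_unique _ _ _ Hz2).
by case: z HP {Hz Hz1 Hz2}.
Qed.

Lemma is_derive_small (f : R -> R) (e : R) : f 0 = 0 -> is_derive f 0 0 -> 0 < e ->
  exists d, 0 < d /\ forall x, Rabs x < d -> Rabs (f x) <= e * Rabs x.
Proof.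
move=> H0 Hf He. move/is_derive_Reals: Hf => Hf.
have [d Hd] := Hf e He. exists d. split; first exact: cond_pos.
move=> x Hx. case: (Req_dec x 0) => [->|Hx0]; first by rewrite H0 Rabs_R0; lra.
have := Hd x Hx0 Hx. rewrite Rplus_0_l H0 !Rminus_0_r Rabs_div // => H.
have Hp := Rabs_pos_lt x Hx0.
apply Rlt_le in H. apply (Rmult_le_compat_r (Rabs x)) in H; last lra.
by rewrite /Rdiv Rmult_assoc Rinv_l in H; lra.
Qed.

Lemma Cmod_le_sum (x y : R) : Cmod (x, y) <= Rabs x + Rabs y.
Proof.
have -> : ((x, y) : C) = (RtoC x + Ci * RtoC y)%C by apply: Ceq; rewrite /Re /Im /=; ring.
apply: Rle_trans (Cmod_triangle _ _) _. rewrite Cmod_mult Cmod_Ci !Cmod_R. lra.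
Qed.

Lemma saddle_abs_lt (d : R) : 0 < d -> exists e, 0 < e /\ forall x, Rabs x < e -> Rabs (saddle x) < d.
Proof.
move=> Hd. have [e He] := proj1 (filterlim_locally _ _) (continuous_saddle 0) (mkposreal d Hd).
exists e. split; first exact: cond_pos. move=> x Hx. have := He x.
rewrite saddle_0 /ball /= /AbsRing_ball /abs /minus /plus /opp /= Ropp_0 !Rplus_0_r. by apply.
Qed.

(** [e^x] and [t (saddle x)] solve the same equation. Exponentiating it, the difference [D]
    satisfies [e^D - 1 - D = (e^(- x) - 1) D], whose left side is at most [20 |D|^2]. So either
    [D = 0] or [|e^(- x) - 1| <= 20 |D|]. Both functions have value 1 and slope 1 at 0, so
    [D = o(x)], and the second case, which stands for the other solution, is impossible for small
    [x]. *)
Lemma saddle_inverse_on_reals (t : C -> C) : is_saddle_inverse t ->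
  exists d p q, 0 < d /\ Rbar_lt d (CV_radius p) /\ Rbar_lt d (CV_radius q) /\
    (forall u : R, Rabs u < d -> t (RtoC u) = (PSeries p u, PSeries q u)) /\
    (forall x : R, Rabs x < d -> t (RtoC (saddle x)) = RtoC (exp x)).
Proof.
move=> [[tau [E0 [E1 [_ [_ Hs]]]]] He].
have {}Hs : locally (T := C_UniformSpace) (RtoC 0)
    (fun u => exists s, is_pseries (K := C_AbsRing) (V := C_NormedModule) tau u s /\ t u = s).
{ move: Hs. apply: filter_imp => u Hu. by exists (t u). }
have [d1 [Hd1 [R1 [R2 Ht]]]] := pseries_on_reals tau (fun u s => t u = s) Hs.
have [d2 [Hd2 Heq]] := locally_C_real _ He.
set p := fun k => Re (tau k) in R1 Ht. set q := fun k => Im (tau k) in R2 Ht.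
have P0 : p 0%nat = 1 by rewrite /p E0. have P1 : p 1%nat = 1 by rewrite /p E1.
have Q0 : q 0%nat = 0 by rewrite /q E0. have Q1 : q 1%nat = 0 by rewrite /q E1.
have rad0 (b : nat -> R) : Rbar_lt d1 (CV_radius b) -> Rbar_lt (Rabs 0) (CV_radius b).
{ move=> H. apply: Rbar_lt_trans H. rewrite /= Rabs_R0. lra. }
have Dp : is_derive (fun x => PSeries p (saddle x) - exp x) 0 0.
{ have H1 := is_derive_PSeries p 0 (rad0 _ R1).
  have H2 := is_derive_saddle 0. rewrite -{1}saddle_0 in H1.
  have H3 := is_derive_comp _ _ _ _ _ H1 H2.
  have H4 := is_derive_minus _ _ _ _ _ H3 (is_derive_exp 0).
  move: H4. rewrite /minus /plus /opp /scal /= /mult /= saddle'_0 PSeries_0 /PS_derive exp_0 P1.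
  by rewrite (_ : 1 * (1 * 1) + - (1) = 0); last ring. }
have Dq : is_derive (fun x => PSeries q (saddle x)) 0 0.
{ have H1 := is_derive_PSeries q 0 (rad0 _ R2).
  have H2 := is_derive_saddle 0. rewrite -{1}saddle_0 in H1.
  have H3 := is_derive_comp _ _ _ _ _ H1 H2.
  move: H3. rewrite /scal /= /mult /= saddle'_0 PSeries_0 /PS_derive Q1.
  by rewrite (_ : 1 * (1 * 0) = 0); last ring. }
have Z1 : PSeries p (saddle 0) - exp 0 = 0 by rewrite saddle_0 PSeries_0 exp_0 P0; ring.
have Z2 : PSeries q (saddle 0) = 0 by rewrite saddle_0 PSeries_0 Q0.
(* [1 / 1000] for each component gives [|D| <= |x| / 500], so [20 |D| <= |x| / 25] stays below the
   lower bound [|x| / 2] of [|e^(- x) - 1|]. *)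
have [d3 [Hd3 S1]] := is_derive_small _ (/ 1000) Z1 Dp ltac:(lra).
have [d4 [Hd4 S2]] := is_derive_small _ (/ 1000) Z2 Dq ltac:(lra).
have [d5 [Hd5 S3]] := saddle_abs_lt (Rmin d1 d2) ltac:(by apply: Rmin_pos).
pose d := Rmin (Rmin d1 (Rmin d3 d4)) (Rmin d5 (/ 4)).
have Hd : 0 < d by rewrite /d; repeat apply: Rmin_pos => //; lra.
have Hdd : d <= d1 /\ d <= d3 /\ d <= d4 /\ d <= d5 /\ d <= / 4.
{ rewrite /d. have := Rmin_l (Rmin d1 (Rmin d3 d4)) (Rmin d5 (/ 4)). have := Rmin_r (Rmin d1 (Rmin d3 d4)) (Rmin d5 (/ 4)).
  have := Rmin_l d1 (Rmin d3 d4). have := Rmin_r d1 (Rmin d3 d4). have := Rmin_l d3 d4. have := Rmin_r d3 d4.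
  have := Rmin_l d5 (/ 4). have := Rmin_r d5 (/ 4). lra. }
exists d, p, q. split => //.
split. { apply: Rbar_le_lt_trans R1. rewrite /=. lra. }
split. { apply: Rbar_le_lt_trans R2. rewrite /=. lra. }
split. { move=> u Hu. apply: Ht. lra. }
move=> x Hx.
have Hu := S3 x ltac:(lra). have := Rmin_l d1 d2. have := Rmin_r d1 d2 => Hm1 Hm2.
have Etu := Ht (saddle x) ltac:(lra).
have B1 := S1 x ltac:(lra). have B2 := S2 x ltac:(lra).
case: (Req_dec x 0) => Hx0.
{ rewrite Etu Hx0 saddle_0 exp_0 !PSeries_0 P0 Q0. by []. }
set D := (t (RtoC (saddle x)) - RtoC (exp x))%C.
have ED : D = (PSeries p (saddle x) - exp x, PSeries q (saddle x)).
{ rewrite /D Etu. apply: Ceq; rewrite /Re /Im /=; ring. }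
have Hax := Rabs_pos_lt x Hx0.
have HD : Cmod D <= / 500 * Rabs x.
{ rewrite ED. apply: Rle_trans (Cmod_le_sum _ _) _. lra. }
have Hex : 3 / 4 <= exp x <= 2.
{ have := exp_ineq1_le x. have := exp_ineq1_le (- x) => H1 H2.
  have E : exp x * exp (- x) = 1 by rewrite -exp_plus Rplus_opp_r exp_0.
  have := exp_pos x. have := exp_pos (- x). move: Hx. split_Rabs; split; nra. }
have Htx : t (RtoC (saddle x)) = (RtoC (exp x) + D)%C by rewrite /D; ring.
have Hnz : t (RtoC (saddle x)) <> RtoC 0.
{ move=> H0. have : Cmod (RtoC (exp x)) = Cmod D.
  { rewrite -(Cmod_opp D). f_equal. rewrite /D H0. ring. }
  rewrite Cmod_R Rabs_pos_eq; lra. }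
have HC : (Cexp D - 1 - D)%C = (RtoC (exp (- x) - 1) * D)%C.
{ have HL : Clog (t (RtoC (saddle x))) = (RtoC x + D)%C.
  { have := Heq (saddle x) ltac:(lra). rewrite -RtoC_pow saddle_sq => H.
    have H2 : Clog (t (RtoC (saddle x))) = (t (RtoC (saddle x)) - 1 - RtoC (2 * (exp x - 1 - x)) / 2)%C by rewrite H; ring.
    rewrite H2 /D RtoC_mult !RtoC_minus. field. }
  have HE := Cexp_Clog _ Hnz. rewrite HL Cexp_plus Cexp_RtoC Htx in HE.
  have E : (RtoC (exp (- x)) * RtoC (exp x) = 1)%C by rewrite -RtoC_mult -exp_plus Rplus_opp_l exp_0.
  have HE2 : Cexp D = (RtoC (exp (- x)) * (RtoC (exp x) * Cexp D))%C by rewrite Cmult_assoc E; ring.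
  rewrite HE2 HE RtoC_minus Cmult_plus_distr_l E. ring. }
have T := Cexp_taylor1 D ltac:(lra).
rewrite HC Cmod_mult Cmod_R in T.
have HD0 := Cmod_ge_0 D.
have Hlow : / 2 * Rabs x <= Rabs (exp (- x) - 1).
{ have := exp_ineq1_le x. have := exp_ineq1_le (- x) => H1 H2.
  have E : exp x * exp (- x) = 1 by rewrite -exp_plus Rplus_opp_r exp_0.
  have := exp_pos (- x). move: Hx. split_Rabs; nra. }
have HD1 : Cmod D = 0.
{ case: HD0 => // HDp. exfalso.
  have : Rabs (exp (- x) - 1) <= 20 * Cmod D.
  { apply: (Rmult_le_reg_r (Cmod D)) => //. lra. }
  lra. }
rewrite Htx (Cmod_eq_0 D HD1). ring.
Qed.

(** The identity [t (saddle x) = e^x] is differentiated along the real axis: the real series carries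
    all of the derivative and the imaginary one none. *)
Lemma saddle_inverse_derive (t : C -> C) : is_saddle_inverse t ->
  exists d, 0 < d /\ forall x : R, Rabs x < d ->
    t (RtoC (saddle x)) = RtoC (exp x) /\ C_derive t (RtoC (saddle x)) = RtoC (exp x / saddle' x).
Proof.
move=> /saddle_inverse_on_reals [d [p [q [Hd [Rp [Rq [Ht Hx]]]]]]].
have [e [He Hse]] := saddle_abs_lt d Hd.
exists (Rmin d e). split; first exact: Rmin_pos.
move=> x Hxd. have Hm1 := Rmin_l d e. have Hm2 := Rmin_r d e.
split; first by apply: Hx; lra.
have Hu := Hse x ltac:(lra). set u := saddle x in Hu *.
have rad (b : nat -> R) : Rbar_lt d (CV_radius b) -> Rbar_lt (Rabs u) (CV_radius b).
{ move=> H. apply: Rbar_lt_trans H. by []. }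
have Dp := is_derive_PSeries p u (rad _ Rp). have Dq := is_derive_PSeries q u (rad _ Rq).
have Hs' := saddle'_pos x.
have He0 : 0 < Rmin d e - Rabs x by lra.
have near (f : R -> R -> Prop) : (forall y, Rabs y < Rmin d e -> f y (exp y)) ->
   locally x (fun y => f y (exp y)).
{ move=> Hf. exists (mkposreal _ He0) => y. rewrite /ball /= /AbsRing_ball /abs /minus /plus /opp /= => Hy.
  apply: Hf. move: Hy. split_Rabs; lra. }
have Vp : PSeries (PS_derive p) u * saddle' x = exp x.
{ have H1 := is_derive_comp _ _ _ _ _ Dp (is_derive_saddle x).
  have H2 : is_derive (fun y => PSeries p (saddle y)) x (exp x).
  { apply: (is_derive_ext_loc exp); last exact: is_derive_exp.
    apply: (near (fun y z => z = PSeries p (saddle y))) => y Hy.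
    have := Hx y ltac:(lra). rewrite Ht; last by apply: Hse; lra. by move=> [-> _]. }
  have := is_derive_unique _ _ _ H1. rewrite (is_derive_unique _ _ _ H2) /scal /= /mult /= => ->. ring. }
have Vq : PSeries (PS_derive q) u = 0.
{ have H1 := is_derive_comp _ _ _ _ _ Dq (is_derive_saddle x).
  have H2 : is_derive (fun y => PSeries q (saddle y)) x 0.
  { apply: (is_derive_ext_loc (fun _ => 0)); last exact: (is_derive_const (V := R_NormedModule) 0 x).
    apply: (near (fun y z => 0 = PSeries q (saddle y))) => y Hy.
    have := Hx y ltac:(lra). rewrite Ht; last by apply: Hse; lra. by move=> [_ ->]. }
  have := is_derive_unique _ _ _ H1. rewrite (is_derive_unique _ _ _ H2) /scal /= /mult /= => E.
  apply: (Rmult_eq_reg_l (saddle' x)); lra. }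
have Hlim (b : nat -> R) (f : R -> R) : Rbar_lt d (CV_radius b) ->
  (forall y, Rabs y < d -> y <> u -> f y = (PSeries b y - PSeries b u) / (y - u)) ->
  is_lim f u (PSeries (PS_derive b) u).
{ move=> Rb Hf. have Db := is_derive_PSeries b u (rad _ Rb). move/is_derive_Reals: Db => Db.
  apply is_lim_spec => eps. have [k Hk] := Db eps (cond_pos eps).
  have Hm : 0 < Rmin k (d - Rabs u) by apply: Rmin_pos; [exact: cond_pos | lra].
  exists (mkposreal _ Hm) => y. rewrite /ball /= /AbsRing_ball /abs /minus /plus /opp /= => Hy Hyu.
  have H1 := Rmin_l k (d - Rabs u). have H2 := Rmin_r k (d - Rabs u).
  rewrite Hf //; last by move: Hy; split_Rabs; lra.
  have Hy' : Rabs (y - u) < k by apply: Rlt_le_trans Hy _.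
  have := Hk (y - u) ltac:(lra) Hy'.
  by rewrite (_ : u + (y - u) = y); last ring. }
have Cdiv y : y <> u -> ((t (RtoC y) - t (RtoC u)) / (RtoC y - RtoC u))%C
   = (Re (t (RtoC y) - t (RtoC u))%C / (y - u), Im (t (RtoC y) - t (RtoC u))%C / (y - u)) :> C.
{ move=> Hy. have Hyu : y - u <> 0 by lra.
  rewrite -RtoC_minus /Cdiv -RtoC_inv //.
  apply: Ceq; rewrite /Re /Im /=; rewrite /Rdiv; ring. }
(* [C_lim] takes the limit of each component along the horizontal line through the point, so real
   difference quotients determine the derivative. *)
rewrite /C_derive /C_lim.
have L1 := Hlim p (fun y => fst ((t (RtoC y) - t (RtoC u)) / (RtoC y - RtoC u))%C) Rp.
have L2 := Hlim q (fun y => snd ((t (RtoC y) - t (RtoC u)) / (RtoC y - RtoC u))%C) Rq.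
have {}L1 := L1 ltac:(move=> y Hy Hyu; rewrite Cdiv // !Ht //).
have {}L2 := L2 ltac:(move=> y Hy Hyu; rewrite Cdiv // !Ht //).
apply: Ceq; rewrite /Re /Im [fst (RtoC _)]/= [snd (RtoC _)]/=.
- rewrite [fst (_, _)]/=. rewrite (is_lim_unique _ _ _ L1) /= -Vp. field. lra.
- rewrite [snd (_, _)]/=. by rewrite (is_lim_unique _ _ _ L2) /= Vq.
Qed.

Definition saddle_weight (a nu x : R) : C :=
  (RtoC (exp ((a + nu) * x)) / (RtoC (exp (a * x)) - t0_pow a a))%C.

Lemma saddle_fun_weight (a : R) (t : C -> C) : is_saddle_inverse t ->
  exists d, 0 < d /\ forall x nu, Rabs x < d ->
    saddle_weight a nu x = (RtoC (saddle' x) * saddle_fun a nu t (RtoC (saddle x)))%C.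
Proof.
move=> /saddle_inverse_derive [d [Hd H]]. exists d. split => // x nu Hx.
have [H1 H2] := H x Hx. have Hs := saddle'_pos x.
rewrite /saddle_fun /saddle_weight H1 H2 !Cpower_exp.
rewrite (_ : (a + nu) * x = (a + nu - 1) * x + x); last ring.
rewrite exp_plus RtoC_mult RtoC_div /Cdiv; last lra.
have Hn : RtoC (saddle' x) <> RtoC 0 by move=> E; have := f_equal Re E; rewrite /Re /=; lra.
transitivity (RtoC (exp ((a + nu - 1) * x)) * RtoC (exp x) * / (RtoC (exp (a * x)) - t0_pow a a) * (RtoC (saddle' x) * / RtoC (saddle' x)))%C.
- rewrite Cinv_r //. ring.
- ring.
Qed.

(** * Taylor expansions uniform in nu *)

(* [uexp n K d f]: the family [f nu] has a Taylor expansion of order [n] in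
   powers of [saddle x], with bounds uniform in [|nu| <= K] and [|x| < d]. *)
Fixpoint uexp (n : nat) (K d : R) (f : R -> R -> C) : Prop :=
  match n with
  | O => exists b, forall nu x, Rabs nu <= K -> Rabs x < d -> Cmod (f nu x) <= b
  | S m => exists (alpha : R -> C) (g : R -> R -> C) (b : R),
      (forall nu, Rabs nu <= K -> Cmod (alpha nu) <= b) /\
      (forall nu x, Rabs nu <= K -> Rabs x < d ->
         f nu x = (alpha nu + RtoC (saddle x) * g nu x)%C) /\
      uexp m K d g
  end.

Lemma uexp_ext (n : nat) (K d : R) (f g : R -> R -> C) :
  (forall nu x, Rabs nu <= K -> Rabs x < d -> f nu x = g nu x) ->
  uexp n K d f -> uexp n K d g.
Proof.
case: n => [|n] H /=.
- move=> [b Hb]. exists b => nu x Hn Hx. rewrite -H //. exact: Hb.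
- move=> [al [h [b [H1 [H2 H3]]]]]. exists al, h, b. split => //. split => // nu x Hn Hx. rewrite -H //. exact: H2.
Qed.

Lemma uexp_mono (n : nat) (K d d' : R) (f : R -> R -> C) : d' <= d ->
  uexp n K d f -> uexp n K d' f.
Proof.
move=> Hd. elim: n f => [|n IH] f /=.
- move=> [b Hb]. exists b => nu x Hn Hx. apply: Hb => //. lra.
- move=> [al [h [b [H1 [H2 H3]]]]]. exists al, h, b. split => //. split; last exact: IH.
  move=> nu x Hn Hx. apply: H2 => //. lra.
Qed.

Definition saddle_small (d : R) : Prop := forall x, Rabs x < d -> Rabs (saddle x) <= 1.

Lemma uexp_bounded (n : nat) (K d : R) (f : R -> R -> C) : saddle_small d ->
  uexp n K d f -> uexp 0 K d f.
Proof.
move=> Hd. elim: n f => [|n IH] f //.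
move=> [al [h [b [H1 [H2 /IH [b' H3]]]]]]. exists (b + b') => nu x Hn Hx.
rewrite H2 //. apply: Rle_trans (Cmod_triangle _ _) _. rewrite Cmod_mult Cmod_R.
have := H1 nu Hn. have := H3 nu x Hn Hx. have := Hd x Hx. have := Rabs_pos (saddle x).
have := Cmod_ge_0 (h nu x). nra.
Qed.

Lemma uexp_pred (n : nat) (K d : R) (f : R -> R -> C) : saddle_small d ->
  uexp (S n) K d f -> uexp n K d f.
Proof.
move=> Hd. elim: n f => [|n IH] f; first exact: uexp_bounded.
move=> [al [h [b [H1 [H2 H3]]]]]. exists al, h, b. split => //. split => //. exact: IH.
Qed.

Lemma uexp_const (n : nat) (K d b : R) (al : R -> C) :
  (forall nu, Rabs nu <= K -> Cmod (al nu) <= b) -> uexp n K d (fun nu _ => al nu).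
Proof.
elim: n al b => [|n IH] al b H; first by exists b => nu x Hn _; exact: H.
exists al, (fun _ _ => RtoC 0), b. split => //. split; first by move=> nu x _ _; ring.
apply: (IH (fun _ => RtoC 0) 0) => nu _. rewrite Cmod_0. lra.
Qed.

Lemma uexp_plus (n : nat) (K d : R) (f g : R -> R -> C) :
  uexp n K d f -> uexp n K d g -> uexp n K d (fun nu x => f nu x + g nu x)%C.
Proof.
elim: n f g => [|n IH] f g /=.
- move=> [b Hb] [b' Hb']. exists (b + b') => nu x Hn Hx. apply: Rle_trans (Cmod_triangle _ _) _.
  have := Hb nu x Hn Hx. have := Hb' nu x Hn Hx. lra.
- move=> [al [h [b [H1 [H2 H3]]]]] [al' [h' [b' [H1' [H2' H3']]]]].
  exists (fun nu => al nu + al' nu)%C, (fun nu x => h nu x + h' nu x)%C, (b + b').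
  split; last split; last exact: IH.
  + move=> nu Hn. apply: Rle_trans (Cmod_triangle _ _) _. have := H1 nu Hn. have := H1' nu Hn. lra.
  + move=> nu x Hn Hx. rewrite H2 // H2' //. ring.
Qed.

Lemma uexp_scal (n : nat) (K d b0 : R) (c : R -> C) (f : R -> R -> C) :
  (forall nu, Rabs nu <= K -> Cmod (c nu) <= b0) ->
  uexp n K d f -> uexp n K d (fun nu x => c nu * f nu x)%C.
Proof.
move=> Hc. elim: n f => [|n IH] f /=.
- move=> [b Hb]. exists (b0 * b) => nu x Hn Hx. rewrite Cmod_mult.
  apply: Rmult_le_compat; try exact: Cmod_ge_0; [exact: Hc | exact: Hb].
- move=> [al [h [b [H1 [H2 H3]]]]].
  exists (fun nu => c nu * al nu)%C, (fun nu x => c nu * h nu x)%C, (b0 * b).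
  split; last split; last exact: IH.
  + move=> nu Hn. rewrite Cmod_mult.
    apply: Rmult_le_compat; try exact: Cmod_ge_0; [exact: Hc | exact: H1].
  + move=> nu x Hn Hx. rewrite H2 //. ring.
Qed.

(** With [s = saddle x], [f g = alpha alpha' + s (alpha h' + h g)]. In the last product [g] stands
    undivided against a factor of lower order, whence [uexp_pred]. *)
Lemma uexp_mult (n : nat) (K d : R) (f g : R -> R -> C) : saddle_small d ->
  uexp n K d f -> uexp n K d g -> uexp n K d (fun nu x => f nu x * g nu x)%C.
Proof.
move=> Hd. elim: n f g => [|n IH] f g.
- move=> [b Hb] [b' Hb']. exists (b * b') => nu x Hn Hx. rewrite Cmod_mult.
  apply: Rmult_le_compat; try exact: Cmod_ge_0; [exact: Hb | exact: Hb'].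
- move=> Hf Hg. have Hg' := uexp_pred n K d g Hd Hg.
  move: Hf => [al [h [b [H1 [H2 H3]]]]]. move: Hg => [al' [h' [b' [H1' [H2' H3']]]]].
  exists (fun nu => al nu * al' nu)%C, (fun nu x => al nu * h' nu x + h nu x * g nu x)%C, (b * b').
  split; last split.
  + move=> nu Hn. rewrite Cmod_mult.
    apply: Rmult_le_compat; try exact: Cmod_ge_0; [exact: H1 | exact: H1'].
  + move=> nu x Hn Hx. rewrite H2 // H2' //. ring.
  + apply: uexp_plus; [exact: (uexp_scal _ _ _ b) | exact: IH].
Qed.

Lemma uexp_saddle (n : nat) (K d : R) : saddle_small d ->
  uexp n K d (fun _ x => RtoC (saddle x)).
Proof.
case: n => [|n] Hd.
- exists 1 => nu x _ Hx. rewrite Cmod_R. exact: Hd.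
- exists (fun _ => RtoC 0), (fun _ _ => RtoC 1), 0. split; last split.
  + move=> nu _. rewrite Cmod_0. lra.
  + move=> nu x _ _. ring.
  + apply: (uexp_const n K d 1) => nu _. rewrite Cmod_1. lra.
Qed.

Lemma PSeries_locally_bounded (b : nat -> R) (e : R) : 0 < e -> Rbar_lt e (CV_radius b) ->
  exists d, 0 < d /\ forall u, Rabs u < d -> Rabs (PSeries b u) <= Rabs (b 0%nat) + 1.
Proof.
move=> He Hb.
have HC : continuous (PSeries b) 0.
{ apply: ex_derive_continuous. eexists. apply: is_derive_PSeries. apply: Rbar_lt_trans Hb. rewrite /= Rabs_R0. lra. }
have [d Hd] := proj1 (filterlim_locally _ _) HC (mkposreal 1 Rlt_0_1).
exists d. split; first exact: cond_pos. move=> u Hu. have := Hd u.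
rewrite PSeries_0 /ball /= /AbsRing_ball /abs /minus /plus /opp /= Ropp_0 Rplus_0_r => H.
have {H} := H Hu. split_Rabs; lra.
Qed.

Lemma PSeries_decr (b : nat -> R) (e u : R) : Rbar_lt e (CV_radius b) -> Rabs u < e ->
  PSeries b u = b 0%nat + u * PSeries (PS_decr_1 b) u.
Proof.
move=> Hb Hu. apply: PSeries_decr_1. apply: CV_radius_inside. apply: Rbar_lt_trans Hb. exact: Hu.
Qed.

Lemma uexp_PSeries (n : nat) (K e : R) (b : nat -> R) : 0 < e -> Rbar_lt e (CV_radius b) ->
  exists d, 0 < d /\ uexp n K d (fun _ x => RtoC (PSeries b (saddle x))).
Proof.
move=> He. elim: n b => [|n IH] b Hb.
- have [d [Hd H]] := PSeries_locally_bounded b e He Hb.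
  have [d' [Hd' H']] := saddle_abs_lt d Hd. exists d'. split => //.
  exists (Rabs (b 0%nat) + 1) => nu x _ Hx. rewrite Cmod_R. apply: H. exact: H'.
- have [d [Hd H]] := IH (PS_decr_1 b) ltac:(by rewrite CV_radius_decr_1).
  have [d' [Hd' H']] := saddle_abs_lt e He. exists (Rmin d d'). split; first exact: Rmin_pos.
  exists (fun _ => RtoC (b 0%nat)), (fun _ x => RtoC (PSeries (PS_decr_1 b) (saddle x))), (Rabs (b 0%nat)).
  split; last split.
  + move=> nu _. rewrite Cmod_R. lra.
  + move=> nu x _ Hx. have := Rmin_r d d' => Hm. rewrite (PSeries_decr b e) //; last by apply: H'; lra.
    by rewrite RtoC_plus RtoC_mult.
  + apply: uexp_mono H. exact: Rmin_l.
Qed.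

(** These tails of the exponential series form a family closed under removing the constant term and
    dividing by [z], which an induction on the order of [uexp] needs; [m = 0] is [exp] itself. *)
Definition exp_tail (m : nat) (z : R) : R := PSeries (fun k => / INR (fact (k + m))) z.

Lemma exp_tail_radius (m : nat) : CV_radius (fun k => / INR (fact (k + m))) = p_infty.
Proof.
elim: m => [|m IH].
- rewrite -[RHS]exp_radius. apply: CV_radius_ext => k. by rewrite Nat.add_0_r.
- rewrite -[RHS]IH -[RHS]CV_radius_decr_1. apply: CV_radius_ext => k. rewrite /PS_decr_1. do 3 f_equal. lia.
Qed.

Lemma exp_tail_rec (m : nat) (z : R) : exp_tail m z = / INR (fact m) + z * exp_tail (S m) z.
Proof.
rewrite /exp_tail (PSeries_decr _ (Rabs z + 1)); last lra; last by rewrite exp_tail_radius.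
rewrite Nat.add_0_l. do 2 f_equal. apply: PSeries_ext => k. rewrite /PS_decr_1. do 3 f_equal. lia.
Qed.

Lemma exp_tail_0 (z : R) : exp_tail 0 z = exp z.
Proof. rewrite exp_Reals. apply: PSeries_ext => k. by rewrite Nat.add_0_r. Qed.

(** [w x] is [x / saddle x], so [nu x = saddle x * (nu w x)]: each factor [nu x] split off by
    [exp_tail_rec] provides one power of [saddle x] and a coefficient [nu] bounded by [K]. At order
    0 the interval is cut by [K + 1] so that [nu x] stays where the tail is bounded. *)
Lemma uexp_exp_tail (n m : nat) (K d0 : R) (w : R -> R) : 0 <= K -> 0 < d0 -> saddle_small d0 ->
  (forall x, Rabs x < d0 -> x = saddle x * w x) ->
  uexp n K d0 (fun _ x => RtoC (w x)) ->
  exists d, 0 < d <= d0 /\ uexp n K d (fun nu x => RtoC (exp_tail m (nu * x))).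
Proof.
move=> HK Hd0 Hs Hw. elim: n m => [|n IH] m Hu.
- have [d [Hd H]] := PSeries_locally_bounded (fun k => / INR (fact (k + m))) 1 Rlt_0_1 ltac:(by rewrite exp_tail_radius).
  have Hp : 0 < d / (K + 1) by apply: Rdiv_lt_0_compat; lra.
  exists (Rmin d0 (d / (K + 1))). split; first by split; [exact: Rmin_pos | exact: Rmin_l].
  exists (Rabs (/ INR (fact (0 + m))) + 1) => nu x Hn Hx. rewrite Cmod_R. apply: H.
  have := Rmin_r d0 (d / (K + 1)) => Hm. rewrite Rabs_mult.
  have H1 : Rabs x * (K + 1) < d.
  { have : Rabs x < d / (K + 1) by lra. move=> H1. apply (Rmult_lt_compat_r (K + 1)) in H1; last lra.
    by rewrite /Rdiv Rmult_assoc Rinv_l in H1; lra. }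
  have := Rabs_pos x. have := Rabs_pos nu. nra.
- have Hu' := uexp_pred _ _ _ _ Hs Hu.
  have [d [Hd H]] := IH (S m) Hu'. exists d. split => //.
  exists (fun _ => RtoC (/ INR (fact m))), (fun nu x => RtoC nu * (RtoC (w x) * RtoC (exp_tail (S m) (nu * x))))%C, (Rabs (/ INR (fact m))).
  split; last split.
  + move=> nu _. rewrite Cmod_R. lra.
  + move=> nu x Hn Hx. rewrite exp_tail_rec {1}(Hw x); last lra.
    rewrite RtoC_plus !RtoC_mult. ring.
  + apply: (uexp_scal _ _ _ K). { move=> nu Hn. by rewrite Cmod_R. }
    apply: uexp_mult => //.
    * move=> x Hx. apply: Hs. lra.
    * apply: uexp_mono Hu'. lra.
Qed.

(** [1 / (u - u0)] is [- 1 / u0] plus [u] times [1 / u0] times itself, so it reproduces itself at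
    every order; it is bounded on the real axis because [u0] is at distance at least [m] from it. *)
Lemma uexp_pole (n : nat) (K d m : R) (u0 : C) : 0 < m ->
  (forall u : R, m <= Cmod (RtoC u - u0)) ->
  uexp n K d (fun _ x => / (RtoC (saddle x) - u0))%C.
Proof.
move=> Hm Hu0.
have Hn (u : R) : (RtoC u - u0)%C <> RtoC 0. { apply Cmod_gt_0. have := Hu0 u. lra. }
have H0 : u0 <> RtoC 0. { move=> E. apply: (Hn 0). rewrite E. ring. }
elim: n => [|n IH].
- exists (/ m) => nu x _ _. rewrite Cmod_inv; last exact: Hn. exact: (Rinv_le_contravar _ _ Hm (Hu0 _)).
- exists (fun _ => - / u0)%C, (fun _ x => / u0 * / (RtoC (saddle x) - u0))%C, (Cmod (- / u0)).
  split; last split.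
  + move=> nu _. exact: Rle_refl.
  + move=> nu x _ _. field. split; [exact: Hn | exact: H0].
  + apply: (uexp_scal _ _ _ (Cmod (/ u0)) (fun _ => / u0)%C) => // nu _. exact: Rle_refl.
Qed.

Lemma Csum_shift (f : nat -> C) (n : nat) : Csum f (S n) = (f 0%nat + Csum (fun k => f (S k)) n)%C.
Proof. elim: n => [|n IH]; first by rewrite /=; ring. rewrite [LHS]/= -/(Csum f (S n)) IH /=. ring. Qed.

Lemma Csum_ext (f g : nat -> C) (n : nat) : (forall k, (k < n)%nat -> f k = g k) -> Csum f n = Csum g n.
Proof. elim: n => [|n IH] H //=. rewrite IH; last by move=> k Hk; apply: H; lia. rewrite H //. Qed.

Lemma Csum_scal (c : C) (f : nat -> C) (n : nat) : Csum (fun k => c * f k)%C n = (c * Csum f n)%C.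
Proof. elim: n => [|n IH] /=; first by ring. rewrite IH. ring. Qed.

Lemma Csum_plus (f g : nat -> C) (n : nat) : Csum (fun k => f k + g k)%C n = (Csum f n + Csum g n)%C.
Proof. elim: n => [|n IH] /=; first by ring. rewrite IH. ring. Qed.

Lemma uexp_taylor (n : nat) (K d : R) (f : R -> R -> C) : uexp n K d f ->
  exists (al : R -> nat -> C) (b : R), 0 <= b /\
    (forall nu r, Rabs nu <= K -> Cmod (al nu r) <= b) /\
    (forall nu x, Rabs nu <= K -> Rabs x < d ->
      Cmod (f nu x - Csum (fun r => al nu r * RtoC (saddle x ^ r))%C n) <= b * Rabs (saddle x) ^ n).
Proof.
elim: n f => [|n IH] f /=.
- move=> [b Hb]. exists (fun _ _ => RtoC 0), (Rabs b). split; first exact: Rabs_pos.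
  split; first by move=> nu r _; rewrite Cmod_0; exact: Rabs_pos.
  move=> nu x Hn Hx. rewrite Rmult_1_r (_ : (f nu x - 0)%C = f nu x); last by ring.
  apply: Rle_trans (Hb nu x Hn Hx) _. exact: Rle_abs.
- move=> [al [h [b [H1 [H2 /IH [al' [b' [Hb' [H3 H4]]]]]]]]].
  exists (fun nu r => match r with O => al nu | S k => al' nu k end), (Rmax b b').
  split; first by apply: Rle_trans Hb' (Rmax_r _ _).
  split.
  + move=> nu [|k] Hn; [apply: Rle_trans (H1 nu Hn) (Rmax_l _ _) | apply: Rle_trans (H3 nu k Hn) (Rmax_r _ _)].
  + move=> nu x Hn Hx.
    rewrite -/(Csum (fun r => match r with O => al nu | S k => al' nu k end * RtoC (saddle x ^ r))%C (S n)).
    rewrite Csum_shift H2 //.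
    rewrite (_ : forall z w v : C, (al nu + RtoC (saddle x) * z - (al nu * w + v))%C = (al nu * (1 - w) + (RtoC (saddle x) * z - v))%C); last by move=> *; ring.
    rewrite (Csum_ext _ (fun k => RtoC (saddle x) * (al' nu k * RtoC (saddle x ^ k)))%C); last by move=> k _; rewrite /= RtoC_mult; ring.
    rewrite Csum_scal.
    rewrite (_ : forall z w : C, (al nu * (1 - RtoC (saddle x ^ 0)) + (RtoC (saddle x) * z - RtoC (saddle x) * w))%C = (RtoC (saddle x) * (z - w))%C); last by move=> *; rewrite /=; ring.
    rewrite Cmod_mult Cmod_R. have := H4 nu x Hn Hx. have := Rabs_pos (saddle x).
    have := pow_le _ n (Rabs_pos (saddle x)). have := Rmax_r b b'.
    move=> M1 M2 M3 M4. rewrite (Rmult_comm (Rmax b b')) Rmult_assoc. apply: Rmult_le_compat_l => //.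
    rewrite Rmult_comm. apply: Rle_trans M4 _. exact: Rmult_le_compat_r.
Qed.

(** Counterpart of [uexp] for a single function with prescribed coefficients [b]; constant and
    interval may depend on the function. [uexp] leaves its coefficients anonymous, and comparison
    with [texp] identifies them. *)
Definition texp (n : nat) (f : R -> C) (b : nat -> C) : Prop :=
  exists M d, 0 < d /\ forall x, Rabs x < d ->
    Cmod (f x - Csum (fun r => b r * RtoC (saddle x ^ r))%C n) <= M * Rabs (saddle x) ^ n.

Lemma texp_step (n : nat) (f g : R -> C) (b : nat -> C) (d : R) : 0 < d ->
  (forall x, Rabs x < d -> f x = (b 0%nat + RtoC (saddle x) * g x)%C) ->
  texp n g (fun r => b (S r)) -> texp (S n) f b.
Proof.
move=> Hd Hf [M [d' [Hd' Hg]]]. exists M, (Rmin d d'). split; first exact: Rmin_pos.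
move=> x Hx. have Hm1 := Rmin_l d d'. have Hm2 := Rmin_r d d'.
rewrite Csum_shift Hf; last lra.
rewrite (Csum_ext _ (fun k => RtoC (saddle x) * (b (S k) * RtoC (saddle x ^ k)))%C); last by move=> k _; rewrite /= RtoC_mult; ring.
rewrite Csum_scal.
rewrite (_ : forall z w : C, (b 0%nat + RtoC (saddle x) * z - (b 0%nat * RtoC (saddle x ^ 0) + RtoC (saddle x) * w))%C = (RtoC (saddle x) * (z - w))%C); last by move=> *; rewrite /=; ring.
rewrite Cmod_mult Cmod_R. have H := Hg x ltac:(lra).
rewrite /= -Rmult_assoc (Rmult_comm M) Rmult_assoc. apply: Rmult_le_compat_l => //. exact: Rabs_pos.
Qed.

Lemma texp_plus (n : nat) (f g : R -> C) (b b' : nat -> C) :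
  texp n f b -> texp n g b' -> texp n (fun x => f x + g x)%C (fun r => b r + b' r)%C.
Proof.
move=> [M [d [Hd H]]] [M' [d' [Hd' H']]]. exists (M + M'), (Rmin d d'). split; first exact: Rmin_pos.
move=> x Hx. have Hm1 := Rmin_l d d'. have Hm2 := Rmin_r d d'.
rewrite (Csum_ext _ (fun r => b r * RtoC (saddle x ^ r) + b' r * RtoC (saddle x ^ r))%C); last by move=> k _; ring.
rewrite Csum_plus (_ : forall z w : C, (f x + g x - (z + w))%C = ((f x - z) + (g x - w))%C); last by move=> *; ring.
apply: Rle_trans (Cmod_triangle _ _) _. rewrite Rmult_plus_distr_r.
apply: Rplus_le_compat; [apply: H; lra | apply: H'; lra].
Qed.

Lemma texp_scal (n : nat) (c : C) (f : R -> C) (b : nat -> C) :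
  texp n f b -> texp n (fun x => c * f x)%C (fun r => c * b r)%C.
Proof.
move=> [M [d [Hd H]]]. exists (Cmod c * M), d. split => // x Hx.
rewrite (Csum_ext _ (fun r => c * (b r * RtoC (saddle x ^ r)))%C); last by move=> k _; ring.
rewrite Csum_scal (_ : forall z w : C, (c * z - c * w)%C = (c * (z - w))%C); last by move=> *; ring.
rewrite Cmod_mult Rmult_assoc. apply: Rmult_le_compat_l; [exact: Cmod_ge_0 | exact: H].
Qed.

Definition pseries_pair (b : nat -> C) (u : R) : C :=
  (PSeries (fun k => Re (b k)) u, PSeries (fun k => Im (b k)) u).

Lemma pseries_pairE (b : nat -> C) (u : R) : pseries_pair b u =
  (RtoC (PSeries (fun k => Re (b k)) u) + Ci * RtoC (PSeries (fun k => Im (b k)) u))%C.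
Proof.
rewrite /pseries_pair. move: (PSeries _ u) (PSeries _ u) => p q.
apply: Ceq; rewrite /Re /Im /=; ring.
Qed.

Lemma Cminus_eq_0 (z w : C) : (z - w)%C = RtoC 0 -> z = w.
Proof. move=> H. rewrite (_ : z = ((z - w) + w)%C); last by ring. rewrite H. ring. Qed.

Lemma texp_pseries (n : nat) (e : R) (b : nat -> C) : 0 < e ->
  Rbar_lt e (CV_radius (fun k => Re (b k))) -> Rbar_lt e (CV_radius (fun k => Im (b k))) ->
  texp n (fun x => pseries_pair b (saddle x)) b.
Proof.
move=> He. elim: n b => [|n IH] b Hr Hi.
- have [d1 [Hd1 H1]] := PSeries_locally_bounded _ e He Hr.
  have [d2 [Hd2 H2]] := PSeries_locally_bounded _ e He Hi.
  have [d [Hd H]] := saddle_abs_lt (Rmin d1 d2) ltac:(exact: Rmin_pos).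
  exists (Rabs (Re (b 0%nat)) + 1 + (Rabs (Im (b 0%nat)) + 1)), d. split => // x Hx.
  have Hm1 := Rmin_l d1 d2. have Hm2 := Rmin_r d1 d2. have Hs := H x Hx.
  rewrite /= Rmult_1_r (_ : forall z : C, (z - 0)%C = z); last by move=> *; ring.
  apply: Rle_trans (Cmod_le_sum _ _) _. apply: Rplus_le_compat; [apply: H1; lra | apply: H2; lra].
- have [d [Hd H]] := saddle_abs_lt e He.
  apply: (texp_step n _ (fun x => pseries_pair (fun k => b (S k)) (saddle x)) b d) => //.
  + move=> x Hx. have Hs := H x Hx. rewrite /pseries_pair (PSeries_decr _ e _ Hr Hs) (PSeries_decr _ e _ Hi Hs).
    apply: Ceq; rewrite /Re /Im /PS_decr_1 /=; ring.
  + apply: IH.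
    * by rewrite -(CV_radius_decr_1 (fun k => Re (b k))) in Hr.
    * by rewrite -(CV_radius_decr_1 (fun k => Im (b k))) in Hi.
Qed.

Lemma texp_pole (n : nat) (u0 : C) : (forall u : R, (RtoC u - u0)%C <> RtoC 0) ->
  (exists m, 0 < m /\ forall u : R, m <= Cmod (RtoC u - u0)) ->
  texp n (fun x => / (RtoC (saddle x) - u0))%C (fun r => - / u0 ^ S r)%C.
Proof.
move=> Hn [m [Hm Hb]].
have H0 : u0 <> RtoC 0. { move=> E. apply: (Hn 0). rewrite E. ring. }
(* Removing one term multiplies [1 / (u - u0)] by [1 / u0], so the induction has to carry a
   prefactor [1 / u0^k]. *)
suff H : forall k, texp n (fun x => - / u0 ^ k * (- / (RtoC (saddle x) - u0)))%C (fun r => - / u0 ^ (S r + k))%C.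
{ have := H 0%nat. move=> [M [d [Hd HH]]]. exists M, d. split => // x Hx. have := HH x Hx.
  rewrite (_ : (- / u0 ^ 0 * - / (RtoC (saddle x) - u0))%C = (/ (RtoC (saddle x) - u0))%C).
  - by rewrite (Csum_ext _ (fun r => - / u0 ^ S r * RtoC (saddle x ^ r))%C) // => k _; rewrite Nat.add_0_r.
  - rewrite /=. field. exact: Hn. }
elim: n => [|n IH] k.
- exists (Cmod (/ u0 ^ k) * / m), 1. split; first lra. move=> x _.
  rewrite /= Rmult_1_r (_ : forall z : C, (z - 0)%C = z); last by move=> *; ring.
  rewrite Cmod_mult !Cmod_opp. apply: Rmult_le_compat_l; first exact: Cmod_ge_0.
  rewrite Cmod_inv; last exact: Hn. exact: (Rinv_le_contravar _ _ Hm (Hb _)).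
- have Hk : (u0 ^ k)%C <> RtoC 0 by apply: Cpow_nz.
  apply: (texp_step n _ (fun x => - / u0 ^ (S k) * (- / (RtoC (saddle x) - u0)))%C _ 1); first lra.
  + move=> x _. rewrite (_ : (1 + k = S k)%nat) // Cpow_S. field. repeat split => //; exact: Hn.
  + have := IH (S k). move=> [M [d [Hd HH]]]. exists M, d. split => // x Hx.
    have := HH x Hx. by rewrite (Csum_ext _ (fun r => - / u0 ^ (S (S r) + k) * RtoC (saddle x ^ r))%C) // => r _; rewrite (_ : (S r + S k = S (S r) + k)%nat) //; lia.
Qed.

Lemma Csum_bound (b : nat -> C) (n : nat) : exists M, 0 <= M /\ forall x, Rabs (saddle x) <= 1 ->
  Cmod (Csum (fun r => b r * RtoC (saddle x ^ r))%C n) <= M.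
Proof.
elim: n => [|n [M [HM H]]]; first by exists 0; split; [lra | move=> x _; rewrite Cmod_0; lra].
exists (M + Cmod (b n)). split; first by have := Cmod_ge_0 (b n); lra.
move=> x Hx. rewrite /=. apply: Rle_trans (Cmod_triangle _ _) _.
apply: Rplus_le_compat; first exact: H. rewrite Cmod_mult Cmod_R -RPow_abs.
have : Rabs (saddle x) ^ n <= 1 by rewrite -(pow1 n); apply: pow_incr; split => //; exact: Rabs_pos.
have := Cmod_ge_0 (b n). have := pow_le _ n (Rabs_pos (saddle x)). nra.
Qed.

(** Uniqueness of Taylor coefficients: the constant term is [O(u)], hence 0, and the rest is divided
    by [u = saddle x], which is nonzero for [x > 0]. *)
Lemma Csum_zero_coeffs (n : nat) (b : nat -> C) (M d : R) : 0 < d ->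
  (forall x, 0 < x < d -> Cmod (Csum (fun r => b r * RtoC (saddle x ^ r))%C n) <= M * Rabs (saddle x) ^ n) ->
  forall r, (r < n)%nat -> b r = RtoC 0.
Proof.
move=> Hd. elim: n b => [|n IH] b H r Hr; first by lia.
have E x : Csum (fun r => b r * RtoC (saddle x ^ r))%C (S n) =
   (b 0%nat + RtoC (saddle x) * Csum (fun r => b (S r) * RtoC (saddle x ^ r)) n)%C.
{ rewrite Csum_shift -Csum_scal. f_equal; first by rewrite /=; ring.
  apply: Csum_ext => k _. rewrite /= RtoC_mult. ring. }
have Hb0 : b 0%nat = RtoC 0.
{ have [M' [HM' HM]] := Csum_bound (fun r => b (S r)) n.
  apply: Cmod_eq_0. case: (Cmod_ge_0 (b 0%nat)) => // Hp. exfalso.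
  have HMM : 0 < Rabs M + M' + 1 by have := Rabs_pos M; lra.
  have [e [He Hse]] := saddle_abs_lt (Rmin 1 (Cmod (b 0%nat) / (Rabs M + M' + 1))) ltac:(by apply: Rmin_pos; [lra | exact: Rdiv_lt_0_compat]).
  have Hm := Rmin_l d e. have Hm' := Rmin_r d e. have Hmp : 0 < Rmin d e by exact: Rmin_pos.
  pose x := Rmin d e / 2. have Hx : 0 < x < d by rewrite /x; lra.
  have Hs := Hse x ltac:(rewrite Rabs_pos_eq /x; lra).
  have S1 := Rlt_le_trans _ _ _ Hs (Rmin_l _ _). have S2 := Rlt_le_trans _ _ _ Hs (Rmin_r _ _).
  have HH := H x Hx. have HX := HM x ltac:(lra).
  rewrite E in HH.
  have H2 : Cmod (b 0%nat) <= Rabs (saddle x) * (Rabs M + M').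
  { rewrite (_ : b 0%nat = ((b 0%nat + RtoC (saddle x) * Csum (fun r => b (S r) * RtoC (saddle x ^ r)) n) + - (RtoC (saddle x) * Csum (fun r => b (S r) * RtoC (saddle x ^ r)) n))%C); last by ring.
    apply: Rle_trans (Cmod_triangle _ _) _. rewrite Cmod_opp (Cmod_mult (RtoC _)) Cmod_R.
    have Hpow : Rabs (saddle x) ^ n <= 1 by rewrite -(pow1 n); apply: pow_incr; split; [exact: Rabs_pos | lra].
    have Hpow0 := pow_le _ n (Rabs_pos (saddle x)). have Hsp := Rabs_pos (saddle x).
    have H3 : M * Rabs (saddle x) ^ S n <= Rabs (saddle x) * Rabs M.
    { rewrite /=. have := Rle_abs M. have := Rabs_pos M. move=> M1 M2.
      apply: (Rle_trans _ (Rabs M * (Rabs (saddle x) * Rabs (saddle x) ^ n))).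
      - apply: Rmult_le_compat_r => //. exact: Rmult_le_pos.
      - rewrite Rmult_comm Rmult_assoc. apply: Rmult_le_compat_l => //. nra. }
    rewrite Rmult_plus_distr_l. apply: Rplus_le_compat; first exact: Rle_trans HH H3.
    exact: Rmult_le_compat_l. }
  have H4 : Rabs (saddle x) * (Rabs M + M' + 1) < Cmod (b 0%nat).
  { apply (Rmult_lt_compat_r _ _ _ HMM) in S2. by rewrite /Rdiv Rmult_assoc Rinv_l in S2; lra. }
  have := Rabs_pos (saddle x). lra. }
case: r Hr => [|r] Hr //.
apply: (IH (fun r => b (S r))); last lia.
move=> x Hx. have := H x Hx. rewrite E Hb0 Cplus_0_l Cmod_mult Cmod_R /=.
have Hs : 0 < Rabs (saddle x) by apply: Rabs_pos_lt; have := saddle_pos x ltac:(lra); lra.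
rewrite -Rmult_assoc (Rmult_comm M) Rmult_assoc => HH.
exact: Rmult_le_reg_l HH.
Qed.

Lemma Csum_minus (f g : nat -> C) (n : nat) : Csum (fun k => f k - g k)%C n = (Csum f n - Csum g n)%C.
Proof. elim: n => [|n IH] /=; first by ring. rewrite IH. ring. Qed.

Definition watson_coeff (a : R) (c0 : C) (B : R -> nat -> C) (nu : R) (r : nat) : C :=
  (t0_pow a nu / RtoC a * (B nu r - / (Ci * c0) ^ S r))%C.

Lemma pole_distance (c0 : C) : 0 < Re c0 -> forall u : R, Re c0 <= Cmod (RtoC u - Ci * c0).
Proof.
move=> Hc u. have := Rmax_Cmod (RtoC u - Ci * c0)%C.
have := Rmax_r (Rabs (fst (RtoC u - Ci * c0)%C)) (Rabs (snd (RtoC u - Ci * c0)%C)).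
rewrite (_ : snd (RtoC u - Ci * c0)%C = - Re c0); last by rewrite /Re /=; ring.
rewrite Rabs_Ropp (Rabs_pos_eq (Re c0)); lra.
Qed.

(** [is_B_coeffs] gives each [nu] its own neighbourhood, without control in [nu]. The uniform
    expansion is therefore built from [B 0] and the factor [e^(nu x)]. It comes with bounded but
    unknown coefficients [al], which are equal to [watson_coeff] because, for each fixed [nu], both
    expansions hold on some common interval. *)
Lemma saddle_weight_expansion (a K : R) (c : R -> C) (t : C -> C) (B : R -> nat -> C) (n : nat) :
  0 < a < 1 -> 0 <= K -> 0 < Re (c (omega a)) -> is_saddle_inverse t -> is_B_coeffs a c t B ->
  exists d b, 0 < d /\ 0 <= b /\
    (forall nu r, Rabs nu <= K -> (r < n)%nat -> Cmod (watson_coeff a (c (omega a)) B nu r) <= b) /\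
    (forall nu x, Rabs nu <= K -> Rabs x < d ->
      Cmod (saddle_weight a nu x - RtoC (saddle' x) *
          Csum (fun r => watson_coeff a (c (omega a)) B nu r * RtoC (saddle x ^ r))%C n)
       <= b * (Rabs (saddle x) ^ n * saddle' x)).
Proof.
move=> Ha HK Hc Ht HB. set c0 := c (omega a) in Hc *.
pose u0 := (Ci * c0)%C.
have Hdist := pole_distance c0 Hc.
have Hn (u : R) : (RtoC u - u0)%C <> RtoC 0. { apply Cmod_gt_0. have := Hdist u. rewrite -/u0. lra. }
have Hs' x : RtoC (saddle' x) <> RtoC 0.
{ have := saddle'_pos x. move=> H E. have := f_equal Re E. rewrite /Re /=. lra. }
pose F nu x := (saddle_weight a nu x / RtoC (saddle' x))%C.
have [dw [Hdw Hw]] := saddle_fun_weight a t Ht.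
have Hloc nu : exists d e, 0 < d /\ 0 < e /\
   Rbar_lt e (CV_radius (fun k => Re (B nu k))) /\ Rbar_lt e (CV_radius (fun k => Im (B nu k))) /\
   forall x, Rabs x < d -> F nu x = (t0_pow a nu / RtoC a * (/ (RtoC (saddle x) - u0) + pseries_pair (B nu) (saddle x)))%C.
{ have [e [He [R1 [R2 H]]]] := pseries_on_reals (B nu) (fun u s => saddle_fun a nu t u =
        (t0_pow a nu / RtoC a * (/ (u - Ci * c (omega a)) + s))%C) (HB nu).
  have [d [Hd Hd']] := saddle_abs_lt e He.
  exists (Rmin d dw), e. split; first exact: Rmin_pos. split => //. split => //. split => //.
  move=> x Hx. have Hm1 := Rmin_l d dw. have Hm2 := Rmin_r d dw.
  rewrite /F Hw; last lra. rewrite H; last by apply: Hd'; lra.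
  rewrite -/c0 -/u0 /pseries_pair /Cdiv.
  rewrite (_ : forall z w v : C, (z * w * v)%C = (w * (z * v))%C); last by move=> *; ring.
  rewrite Cinv_r //. ring. }
have Hu : exists d, 0 < d /\ uexp n K d F.
{ have [d1 [e [Hd1 [He [R1 [R2 H1]]]]]] := Hloc 0.
  have [p [q [dt [Hdt [Rp [Rq [Htu Htx]]]]]]] : exists p q d, 0 < d /\ Rbar_lt d (CV_radius p) /\ Rbar_lt d (CV_radius q) /\
    (forall u : R, Rabs u < d -> t (RtoC u) = (PSeries p u, PSeries q u)) /\
    (forall x : R, Rabs x < d -> t (RtoC (saddle x)) = RtoC (exp x)).
  { have [d [p [q H]]] := saddle_inverse_on_reals t Ht. by exists p, q, d. }
  have [ds [Hds Hsmall]] := saddle_abs_lt (Rmin 1 dt) ltac:(by apply: Rmin_pos; lra).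
  have Hm1 := Rmin_l 1 dt. have Hm2 := Rmin_r 1 dt.
  have P0 : p 0%nat = 1.
  { have H := Htx 0 ltac:(rewrite Rabs_R0; lra). rewrite saddle_0 in H. rewrite Htu in H; last by rewrite Rabs_R0; lra.
    have := f_equal Re H. rewrite /Re /= PSeries_0 exp_0. by []. }
  (* This is [x / saddle x]. Writing [e^x = t = 1 + u p1(u)] with [p1] the shifted series,
     [u^2 / 2 = e^x - 1 - x] gives [x = u (p1(u) - u / 2)]. *)
  pose w x := PSeries (PS_decr_1 p) (saddle x) + - / 2 * saddle x.
  pose d2 := Rmin ds dt.
  have Hd2 : 0 < d2 by exact: Rmin_pos. have Hm3 := Rmin_l ds dt. have Hm4 := Rmin_r ds dt.
  have Hwx x : Rabs x < d2 -> x = saddle x * w x.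
  { move=> Hx. have Hsx := Hsmall x ltac:(rewrite /d2 in Hx; lra).
    have H := Htx x ltac:(rewrite /d2 in Hx; lra). rewrite Htu in H; last lra.
    have := f_equal Re H. rewrite /Re /= (PSeries_decr p dt) //; last lra. rewrite P0 => H2.
    have := saddle_sq x. rewrite /w. nra. }
  have [d3 [Hd3 U3]] := uexp_PSeries n K dt (PS_decr_1 p) Hdt ltac:(by rewrite CV_radius_decr_1).
  have [d4 [Hd4 U4]] := uexp_PSeries n K e (fun k => Re (B 0 k)) He R1.
  have [d5 [Hd5 U5]] := uexp_PSeries n K e (fun k => Im (B 0 k)) He R2.
  pose d6 := Rmin (Rmin d1 d2) (Rmin d3 (Rmin d4 d5)).
  have Hd6 : 0 < d6 by rewrite /d6; repeat apply: Rmin_pos.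
  have Hd6' : d6 <= d1 /\ d6 <= d2 /\ d6 <= d3 /\ d6 <= d4 /\ d6 <= d5.
  { rewrite /d6. have := Rmin_l (Rmin d1 d2) (Rmin d3 (Rmin d4 d5)). have := Rmin_r (Rmin d1 d2) (Rmin d3 (Rmin d4 d5)).
    have := Rmin_l d1 d2. have := Rmin_r d1 d2. have := Rmin_l d3 (Rmin d4 d5). have := Rmin_r d3 (Rmin d4 d5).
    have := Rmin_l d4 d5. have := Rmin_r d4 d5. lra. }
  have Hd2s : d2 <= ds by exact: Rmin_l.
  have Hss : saddle_small d6. { move=> x Hx. have := Hsmall x ltac:(lra). lra. }
  have Uw : uexp n K d6 (fun _ x => RtoC (w x)).
  { apply: (uexp_ext n K d6 (fun _ x => RtoC (PSeries (PS_decr_1 p) (saddle x)) + RtoC (- / 2) * RtoC (saddle x))%C).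
    { move=> nu x _ _. by rewrite -RtoC_mult -RtoC_plus. }
    apply: uexp_plus; first by apply: uexp_mono U3; lra.
    apply: (uexp_scal _ _ _ (Cmod (RtoC (- / 2))) (fun _ => RtoC (- / 2))); first by move=> nu _; exact: Rle_refl.
    exact: uexp_saddle. }
  have [d7 [Hd7 U7]] := uexp_exp_tail n 0 K d6 w HK Hd6 Hss (fun x Hx => Hwx x ltac:(lra)) Uw.
  exists d7. split; first lra.
  apply: (uexp_ext n K d7 (fun nu x => RtoC (exp_tail 0 (nu * x)) *
    (t0_pow a 0 / RtoC a * (/ (RtoC (saddle x) - u0) + (RtoC (PSeries (fun k => Re (B 0 k)) (saddle x)) + Ci * RtoC (PSeries (fun k => Im (B 0 k)) (saddle x))))))%C).
  { move=> nu x Hnu Hx. rewrite exp_tail_0.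
    have E : F nu x = (RtoC (exp (nu * x)) * F 0 x)%C.
    { rewrite /F /saddle_weight (_ : (a + nu) * x = nu * x + (a + 0) * x); last ring. rewrite exp_plus RtoC_mult /Cdiv. ring. }
    rewrite E H1; last lra. by rewrite pseries_pairE. }
  apply: uexp_mult => //; first by move=> x Hx; apply: Hss; lra.
  apply: (uexp_scal _ _ _ (Cmod (t0_pow a 0 / RtoC a)) (fun _ => t0_pow a 0 / RtoC a)%C); first by move=> nu _; exact: Rle_refl.
  apply: uexp_plus; first exact: (uexp_pole n K d7 (Re c0) u0 Hc Hdist).
  apply: uexp_plus; first by apply: uexp_mono U4; lra.
  apply: (uexp_scal _ _ _ (Cmod Ci) (fun _ => Ci)); first by move=> nu _; exact: Rle_refl.
  apply: uexp_mono U5; lra. }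
have [d [Hd Hu']] := Hu.
have [al [b [Hb [Hal Hexp]]]] := uexp_taylor n K d F Hu'.
have Hid nu r : Rabs nu <= K -> (r < n)%nat -> al nu r = watson_coeff a c0 B nu r.
{ move=> Hnu. have [d1 [e [Hd1 [He [R1 [R2 H1]]]]]] := Hloc nu.
  have T := texp_scal n (t0_pow a nu / RtoC a)%C _ _ (texp_plus n _ _ _ _ (texp_pole n u0 Hn (ex_intro _ (Re c0) (conj Hc Hdist))) (texp_pseries n e (B nu) He R1 R2)).
  have [M [d2 [Hd2 HM]]] := T.
  have Hmin : 0 < Rmin d (Rmin d1 d2) by repeat apply: Rmin_pos.
  move=> Hr. apply: Cminus_eq_0.
  apply: (Csum_zero_coeffs n (fun r => al nu r - watson_coeff a c0 B nu r)%C (b + M) _ Hmin _ r Hr) => x Hx.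
  have m1 := Rmin_l d (Rmin d1 d2). have m2 := Rmin_r d (Rmin d1 d2). have m3 := Rmin_l d1 d2. have m4 := Rmin_r d1 d2.
  have Hxa : Rabs x = x by rewrite Rabs_pos_eq; lra.
  have V1 := Hexp nu x Hnu ltac:(lra). have V2 := HM x ltac:(lra).
  rewrite -H1 in V2; last lra.
  rewrite (Csum_ext _ (fun r => al nu r * RtoC (saddle x ^ r) - watson_coeff a c0 B nu r * RtoC (saddle x ^ r))%C); last by move=> k _; ring.
  rewrite Csum_minus.
  rewrite (Csum_ext _ (fun r => watson_coeff a c0 B nu r * RtoC (saddle x ^ r))%C) in V2; last first.
  { move=> k _. rewrite /watson_coeff -/u0. ring. }
  rewrite (_ : forall z w : C, (z - w)%C = ((F nu x - w) + - (F nu x - z))%C); last by move=> *; ring.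
  apply: Rle_trans (Cmod_triangle _ _) _. rewrite Cmod_opp. lra. }
exists d, b. split => //. split => //. split.
- move=> nu r Hnu Hr. rewrite -Hid //. exact: Hal.
- move=> nu x Hnu Hx. have H := Hexp nu x Hnu Hx. have Hp := saddle'_pos x.
  rewrite (Csum_ext _ (fun r => watson_coeff a c0 B nu r * RtoC (saddle x ^ r))%C) in H; last by move=> k Hk; rewrite Hid.
  rewrite (_ : forall z : C, (saddle_weight a nu x - RtoC (saddle' x) * z)%C = (RtoC (saddle' x) * (F nu x - z))%C).
  + rewrite Cmod_mult Cmod_R (Rabs_pos_eq (saddle' x)); last lra. rewrite -Rmult_assoc Rmult_comm.
    apply: Rmult_le_compat_r => //. lra.
  + move=> z. rewrite /F. field. exact: Hs'.
Qed.

(** * Watson's lemma *)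

Lemma Cexp_i (y : R) : Cexp (Ci * RtoC y)%C = (cos y, sin y).
Proof.
rewrite /Cexp (_ : Re (Ci * RtoC y)%C = 0); last by rewrite /Re /=; ring.
rewrite (_ : Im (Ci * RtoC y)%C = y); last by rewrite /Im /=; ring.
by rewrite exp_0 !Rmult_1_l.
Qed.

Lemma Cmod_Cexp_i (y : R) : Cmod (Cexp (Ci * RtoC y)%C) = 1.
Proof.
rewrite Cexp_i. have H := Cmod2_alt (cos y, sin y). rewrite /Re /Im /= in H.
have := sin2_cos2 y. rewrite /Rsqr => H2.
have := Cmod_ge_0 (cos y, sin y). nra.
Qed.

Lemma Rabs_Im_le_Cmod (z : C) : Rabs (Im z) <= Cmod z.
Proof.
have := Rmax_Cmod z. have := Rmax_r (Rabs (fst z)) (Rabs (snd z)). rewrite /Im. lra.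
Qed.

Lemma t0_pow_self (a : R) : 0 < a -> t0_pow a a = (- cos (a * PI), sin (a * PI)).
Proof.
move=> Ha. rewrite /t0_pow Cexp_i /omega.
rewrite (_ : a * (PI * (1 - a) / a) = PI - a * PI); last by field; lra.
by rewrite sin_PI_x (_ : cos (PI - a * PI) = - cos (a * PI)); last by rewrite cos_minus cos_PI sin_PI; ring.
Qed.

(** The imaginary part of the denominator is the constant [- sin (a PI)], so the pole stays off the
    line of integration. *)
Lemma weight_den_ge (a x : R) : 0 < a < 1 ->
  sin (a * PI) <= Cmod (RtoC (exp (a * x)) - t0_pow a a).
Proof.
move=> Ha. rewrite t0_pow_self; last lra.
have := Rabs_Im_le_Cmod (RtoC (exp (a * x)) - ((- cos (a * PI))%R, sin (a * PI)))%C.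
rewrite (_ : Im (RtoC (exp (a * x)) - ((- cos (a * PI))%R, sin (a * PI)))%C = - sin (a * PI)); last by rewrite /Im /=; ring.
rewrite Rabs_Ropp Rabs_pos_eq //. apply: Rlt_le. exact: sin_aPI_pos.
Qed.

Lemma Cmod_saddle_weight_le (a nu x : R) : 0 < a < 1 ->
  Cmod (saddle_weight a nu x) <= / sin (a * PI) * exp ((a + nu) * x).
Proof.
move=> Ha. have Hs := sin_aPI_pos a Ha. have Hd := weight_den_ge a x Ha.
have Hn : (RtoC (exp (a * x)) - t0_pow a a)%C <> RtoC 0 by apply Cmod_gt_0; lra.
rewrite /saddle_weight Cmod_div // Cmod_R Rabs_pos_eq; last by apply: Rlt_le; exact: exp_pos.
rewrite /Rdiv Rmult_comm. apply: Rmult_le_compat_r; first by apply: Rlt_le; exact: exp_pos.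
exact: Rinv_le_contravar.
Qed.

Lemma saddle_exponent_far (d x : R) : 0 < d -> d <= Rabs x ->
  Rmin (exp d - 1 - d) (exp (- d) - 1 + d) <= exp x - 1 - x.
Proof.
move=> Hd Hx. case: (Rle_dec 0 x) => H.
- rewrite Rabs_pos_eq // in Hx. apply: Rle_trans (Rmin_l _ _) _.
  have E : exp x = exp d * exp (x - d) by rewrite -exp_plus; f_equal; ring.
  have := exp_ineq1_le (x - d). have := exp_ineq1_le d => H1 H2. rewrite E. nra.
- rewrite Rabs_left in Hx; last lra. apply: Rle_trans (Rmin_r _ _) _.
  have E : exp x = exp (- d) * exp (x + d) by rewrite -exp_plus; f_equal; ring.
  have H1 := exp_ineq1_le (x + d). have H2 := exp_pos (- d).
  have H3 : exp (- d) <= 1 by rewrite -exp_0; apply: exp_le; lra.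
  rewrite E. nra.
Qed.

Lemma saddle_exponent_far_pos (d : R) : 0 < d -> 0 < Rmin (exp d - 1 - d) (exp (- d) - 1 + d).
Proof.
move=> Hd. apply: Rmin_pos.
- have := exp_ineq1 d ltac:(lra). lra.
- have := exp_ineq1 (- d) ltac:(lra). lra.
Qed.

Lemma saddle_exponent_ge_0 (x : R) : 0 <= exp x - 1 - x.
Proof. have := exp_ineq1_le x. lra. Qed.

(** [K + 2] is a value of the large parameter at which one integrable majorant serves all
    [|nu| <= K]. Towards [- oo], [e^((K + 2) x)] outweighs a possible growth of [e^((a + nu) x)]
    with more than a factor [e^x] to spare; towards [+ oo] the double exponential wins. *)
Lemma saddle_weight_dominated (a K : R) : 0 < a < 1 -> 0 <= K ->
  exists C, 0 <= C /\ forall nu x, Rabs nu <= K ->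
    Cmod (saddle_weight a nu x) * exp (- (K + 2) * (exp x - 1 - x)) <= C * decay 1 x.
Proof.
move=> Ha HK. have Hs := sin_aPI_pos a Ha.
(* For [x >= 0] the linear coefficient is [(a + nu) + (K + 2) + k], at most
   [(1 + K) + (K + 2) + 1]. *)
have [C HC] := exp_lin_bound (2 * K + 4) (K + 2) ltac:(lra) ltac:(lra).
pose D := / sin (a * PI) * exp (K + 2 + Rmax C 0).
have HD : 0 < D by apply: Rmult_lt_0_compat; [exact: Rinv_0_lt_compat | exact: exp_pos].
exists (4 * D). split; first lra. move=> nu x Hnu.
have Hnu' : - K <= nu <= K by apply Rabs_le_between.
have Haux k : -1 <= k <= 1 -> Cmod (saddle_weight a nu x) * exp (- (K + 2) * (exp x - 1 - x)) * exp (k * x) <= D.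
{ move=> Hk. rewrite Rmult_assoc -exp_plus.
  apply: (Rle_trans _ (/ sin (a * PI) * exp ((a + nu) * x) * exp (- (K + 2) * (exp x - 1 - x) + k * x))).
  { apply: Rmult_le_compat_r; [exact: Rlt_le (exp_pos _) | exact: Cmod_saddle_weight_le]. }
  rewrite Rmult_assoc -exp_plus /D. apply: Rmult_le_compat_l; first by apply: Rlt_le; exact: Rinv_0_lt_compat.
  apply: exp_le. have := Rmax_l C 0. have := Rmax_r C 0 => M1 M2. have He := exp_pos x.
  case: (Rle_dec 0 x) => Hx.
  - have := HC x. nra.
  - nra. }
apply: le_decay.
- have := Haux 1 ltac:(lra). by rewrite Rmult_1_l.
- have := Haux (-1) ltac:(lra). rewrite (_ : -1 * x = - (1 * x)) //. ring.
- apply: Rmult_le_pos; [exact: Cmod_ge_0 | exact: Rlt_le (exp_pos _)].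
Qed.

Lemma Rpow_le_1_plus (s : R) (r n : nat) : (r <= n)%nat -> 0 <= s -> s ^ r <= 1 + s ^ n.
Proof.
move=> Hr Hs. have := pow_le s n Hs. case: (Rle_dec s 1) => H.
- have : s ^ r <= 1 by rewrite -(pow1 r); apply: pow_incr. lra.
- have := Rle_pow s r n ltac:(lra) Hr. lra.
Qed.

Lemma Csum_saddle_bound (b : nat -> C) (M x : R) (m n : nat) : (m <= n)%nat ->
  0 <= M -> (forall r, (r < m)%nat -> Cmod (b r) <= M) ->
  Cmod (Csum (fun r => b r * RtoC (saddle x ^ r))%C m) <= INR m * M * (1 + Rabs (saddle x) ^ n).
Proof.
move=> Hmn HM. elim: m Hmn => [|m IH] Hm Hb; first by rewrite /= Cmod_0; lra.
rewrite S_INR /=. apply: Rle_trans (Cmod_triangle _ _) _.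
have H1 := IH ltac:(lia) (fun r Hr => Hb r ltac:(lia)).
have H2 : Cmod (b m * RtoC (saddle x ^ m)) <= M * (1 + Rabs (saddle x) ^ n).
{ rewrite Cmod_mult Cmod_R -RPow_abs. apply: Rmult_le_compat; [exact: Cmod_ge_0 | exact: pow_le (Rabs_pos _) | apply: Hb; lia |].
  apply: Rpow_le_1_plus; [lia | exact: Rabs_pos]. }
lra.
Qed.

Lemma integral_R_Csum (X : R) (kappa : C) (b : nat -> C) (m : nat -> R) (n : nat) :
  (forall r, integral_R (moment_fun X r) (m r)) ->
  integral_R (fun x => exp (- X * (exp x - 1 - x)) *
      Im (kappa * (RtoC (saddle' x) * Csum (fun r => b r * RtoC (saddle x ^ r)) n))%C)
    (Im (kappa * Csum (fun r => b r * RtoC (m r)) n)%C).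
Proof.
move=> Hm. elim: n => [|n IH].
- apply: (integral_R_ext (fun x => 0 * moment_fun X 0 x)).
  { move=> x. rewrite [Csum _ 0]/= (_ : (kappa * (RtoC (saddle' x) * 0))%C = RtoC 0); last by ring. rewrite /Im /=. ring. }
  rewrite [Csum _ 0]/= (_ : (kappa * 0)%C = RtoC 0); last by ring. rewrite (_ : Im (RtoC 0) = 0) //. have := integral_R_scal 0 _ _ (Hm 0%nat). by rewrite Rmult_0_l.
- rewrite [Csum _ (S n)]/= (_ : Im (kappa * (Csum (fun r => b r * RtoC (m r)) n + b n * RtoC (m n)))%C =
    Im (kappa * Csum (fun r => b r * RtoC (m r)) n)%C + Im (kappa * b n)%C * m n); last first.
  { rewrite Cmult_plus_distr_l Cmult_assoc /Im /=. ring. }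
  apply: integral_R_ext (integral_R_plus _ _ _ _ IH (integral_R_scal (Im (kappa * b n)%C) _ _ (Hm n))) => x. rewrite [Csum _ (S n)]/=.
  rewrite (_ : (kappa * (RtoC (saddle' x) * (Csum (fun r => b r * RtoC (saddle x ^ r)) n + b n * RtoC (saddle x ^ n))))%C =
     (kappa * (RtoC (saddle' x) * Csum (fun r => b r * RtoC (saddle x ^ r)) n) + (kappa * b n) * RtoC (saddle' x * saddle x ^ n))%C); last first.
  { rewrite RtoC_mult. ring. }
  rewrite /moment_fun /Im /=. ring.
Qed.

Lemma Csum_even (b : nat -> C) (n : nat) : (forall k, b (2 * k + 1)%nat = RtoC 0) ->
  Csum b (2 * n) = Csum (fun k => b (2 * k)%nat) n.
Proof.
move=> Hb. elim: n => [|n IH] //.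
rewrite (_ : (2 * S n = S (S (2 * n)))%nat); last lia.
rewrite -[Csum b (S (S (2 * n)))]/(Csum b (2 * n) + b (2 * n)%nat + b (S (2 * n)))%C.
rewrite IH (_ : (S (2 * n) = 2 * n + 1)%nat); last lia. rewrite Hb /=. ring.
Qed.

Lemma moment_size (X : R) (n : nat) : 0 < X ->
  rising (1 / 2) n * / (X / 2) ^ n * sqrt (2 * PI / X) =
  rising (1 / 2) n * 2 ^ n * sqrt (2 * PI) * Rpower X (- INR n - 1 / 2).
Proof.
move=> HX. have HPI := PI_RGT_0.
rewrite /Rminus Rpower_plus Rpower_Ropp Rpower_pow // (_ : - (1 / 2) = - / 2); last field.
rewrite Rpower_Ropp Rpower_sqrt // sqrt_div_alt //.
have H1 : sqrt X <> 0 by apply: Rgt_not_eq; exact: sqrt_lt_R0.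
have H2 : X ^ n <> 0 by apply: pow_nonzero; lra.
have H3 : (2 : R) ^ n <> 0 by apply: pow_nonzero; lra.
rewrite /Rdiv Rpow_mult_distr pow_inv. field. by repeat split.
Qed.

(** This is [exp_lin_bound] at [y = ln X], exponentiated. *)
Lemma exp_decay_Rpower (e p : R) : 0 < e -> 0 <= p ->
  exists C, 0 <= C /\ forall X, 0 < X -> exp (- e * X) <= C * Rpower X (- p).
Proof.
move=> He Hp. have [C HC] := exp_lin_bound p e Hp He.
exists (exp C). split; first by apply: Rlt_le; exact: exp_pos.
move=> X HX. rewrite /Rpower -exp_plus. apply: exp_le. have := HC (ln X). rewrite exp_ln //. lra.
Qed.

(** For [|x| < d] the Taylor polynomial of order [2 n] errs by at most [b] times the integrand of
    the moment of order [2 n], and that moment has size [X^(- n - 1/2)]. Elsewhere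
    [e^x - 1 - x >= h0], so passing from the fixed parameter [X0] to [X] gains [e^(- (X - X0) h0)].
    Since the polynomial is integrated over the whole line, its tail is covered by this second
    estimate too. *)
Lemma watson (a K : R) (c : R -> C) (t : C -> C) (B : R -> nat -> C) (n : nat) :
  0 < a < 1 -> 0 <= K -> 0 < Re (c (omega a)) -> is_saddle_inverse t -> is_B_coeffs a c t B ->
  exists M, forall nu X kappa l, Rabs nu <= K -> K + 2 <= X -> Cmod kappa <= 1 ->
    integral_R (fun x => exp (- X * (exp x - 1 - x)) * Im (kappa * saddle_weight a nu x)%C) l ->
    Rabs (l - Im (kappa * Csum (fun k => watson_coeff a (c (omega a)) B nu (2 * k) *
             RtoC (rising (1 / 2) k * / (X / 2) ^ k * sqrt (2 * PI / X))) n)%C)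
    <= M * Rpower X (- INR n - 1 / 2).
Proof.
move=> Ha HK Hc Ht HB.
have [d [b [Hd [Hb [Hal Hnear]]]]] := saddle_weight_expansion a K c t B (2 * n) Ha HK Hc Ht HB.
have [C1 [HC1 Hdom]] := saddle_weight_dominated a K Ha HK.
set X0 := K + 2 in Hdom *. have HX0 : 0 < X0 by rewrite /X0; lra.
have Hh0 := saddle_exponent_far_pos d Hd. set h0 := Rmin _ _ in Hh0.
have [m00 Hm00] : exists m, integral_R (moment_fun X0 0) m by eexists; exact: moment_0.
have [m0n Hm0n] : exists m, integral_R (moment_fun X0 (2 * n)) m by eexists; exact: moment_even.
have [C2 [HC2 Hexp]] := exp_decay_Rpower h0 (INR n + 1 / 2) Hh0 ltac:(have := pos_INR n; lra).
pose q := INR (2 * n) * b.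
have Hq : 0 <= q by apply: Rmult_le_pos => //; exact: pos_INR.
(* Integral of the majorant at parameter [X0] for the weight and for the polynomial where
   [|x| >= d]; [/ 1] is the integral of [decay 1]. *)
pose T := C1 * / 1 + q * (m00 + m0n).
have HT : 0 <= T.
{ have P0 : 0 <= m00. { apply: (integral_R_ge_0 _ _ _ Hm00) => x. rewrite /moment_fun /= Rmult_1_l. apply: Rmult_le_pos; apply: Rlt_le; [exact: saddle'_pos | exact: exp_pos]. }
  have P1 : 0 <= m0n.
  { apply: (integral_R_ge_0 _ _ _ Hm0n) => x. rewrite /moment_fun pow_mult.
    apply: Rmult_le_pos; last exact: Rlt_le (exp_pos _). apply: Rmult_le_pos; last exact: Rlt_le (saddle'_pos _).
    apply: pow_le. exact: pow2_ge_0. }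
  rewrite /T Rinv_1 Rmult_1_r. apply: Rplus_le_le_0_compat => //. apply: Rmult_le_pos => //. lra. }
exists (b * (rising (1 / 2) n * 2 ^ n * sqrt (2 * PI)) + exp (X0 * h0) * T * C2).
move=> nu X kappa l Hnu HX Hkap Hl.
have HXp : 0 < X by lra.
pose m r := RInt_gen (moment_fun X r) (Rbar_locally m_infty) (Rbar_locally p_infty).
have Hm r : integral_R (moment_fun X r) (m r).
{ have [v Hv] : exists v, integral_R (moment_fun X r) v.
  { have [E|E] := Nat.Even_or_Odd r; have [k Hk] := E; rewrite Hk; eexists; [exact: moment_even | exact: moment_odd]. }
  rewrite /m (is_RInt_gen_unique (V := R_CompleteNormedModule) _ _ Hv). exact: Hv. }
have Em k : m (2 * k)%nat = rising (1 / 2) k * / (X / 2) ^ k * sqrt (2 * PI / X).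
{ exact: (integral_R_unique _ _ _ (Hm _) (moment_even X k HXp)). }
have Om k : m (2 * k + 1)%nat = 0.
{ exact: (integral_R_unique _ _ _ (Hm _) (moment_odd X k HXp)). }
set al := watson_coeff a (c (omega a)) B nu.
have HS := integral_R_Csum X kappa al m (2 * n) Hm.
(* The odd moments vanish, so [2 n] Taylor coefficients leave [n] terms. *)
rewrite Csum_even in HS; last by move=> k; rewrite Om; ring.
rewrite (Csum_ext _ (fun k => al (2 * k)%nat * RtoC (rising (1 / 2) k * / (X / 2) ^ k * sqrt (2 * PI / X)))%C) in HS; last by move=> k _; rewrite Em.
have HD := integral_R_minus _ _ _ _ Hl HS.
pose E := exp (- (X - X0) * h0).
have HE : 0 < E by exact: exp_pos.
have HG := integral_R_plus _ _ _ _ (integral_R_scal b _ _ (Hm (2 * n)%nat))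
  (integral_R_scal E _ _ (integral_R_plus _ _ _ _ (integral_R_scal C1 _ _ (integral_decay 1 Rlt_0_1))
     (integral_R_scal q _ _ (integral_R_plus _ _ _ _ Hm00 Hm0n)))).
have Hbound := integral_R_le _ _ _ _ _ HD HG.
have Hpt x : Rabs (exp (- X * (exp x - 1 - x)) * Im (kappa * saddle_weight a nu x)%C -
     exp (- X * (exp x - 1 - x)) * Im (kappa * (RtoC (saddle' x) * Csum (fun r => al r * RtoC (saddle x ^ r)) (2 * n)))%C)
  <= b * moment_fun X (2 * n) x + E * (C1 * decay 1 x + q * (moment_fun X0 0 x + moment_fun X0 (2 * n) x)).
{ set S := Csum _ _.
  have Hs' := saddle'_pos x. have Hh := saddle_exponent_ge_0 x.
  have HeX := exp_pos (- X * (exp x - 1 - x)). have HeX0 := exp_pos (- X0 * (exp x - 1 - x)).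
  have Hsn : 0 <= saddle x ^ (2 * n). { rewrite pow_mult. apply: pow_le. exact: pow2_ge_0. }
  have Hsn' : Rabs (saddle x) ^ (2 * n) = saddle x ^ (2 * n). { by rewrite RPow_abs Rabs_pos_eq. }
  have HA : Rabs (exp (- X * (exp x - 1 - x)) * Im (kappa * saddle_weight a nu x)%C -
     exp (- X * (exp x - 1 - x)) * Im (kappa * (RtoC (saddle' x) * S))%C)
     <= exp (- X * (exp x - 1 - x)) * Cmod (saddle_weight a nu x - RtoC (saddle' x) * S)%C.
  { rewrite (_ : _ - _ = exp (- X * (exp x - 1 - x)) * Im (kappa * (saddle_weight a nu x - RtoC (saddle' x) * S))%C).
    - rewrite Rabs_mult Rabs_pos_eq; last lra. apply: Rmult_le_compat_l; first lra.
      apply: Rle_trans (Rabs_Im_le_Cmod _) _. rewrite Cmod_mult.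
      have := Cmod_ge_0 (saddle_weight a nu x - RtoC (saddle' x) * S)%C. have := Cmod_ge_0 kappa. nra.
    - rewrite /Im /=. ring. }
  apply: Rle_trans HA _.
  have P0 : 0 <= moment_fun X0 0 x. { rewrite /moment_fun. apply: Rmult_le_pos; last lra. apply: Rmult_le_pos; rewrite /=; lra. }
  have P1 : 0 <= moment_fun X0 (2 * n) x. { rewrite /moment_fun. apply: Rmult_le_pos; last lra. apply: Rmult_le_pos; lra. }
  have P2 : 0 <= moment_fun X (2 * n) x. { rewrite /moment_fun. apply: Rmult_le_pos; last lra. apply: Rmult_le_pos; lra. }
  have P3 : 0 <= decay 1 x. { apply: Rlt_le. apply: Rinv_0_lt_compat. apply: pow_lt. exact: decay_den_pos. }
  have P4 : 0 <= C1 * decay 1 x + q * (moment_fun X0 0 x + moment_fun X0 (2 * n) x).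
  { apply: Rplus_le_le_0_compat; apply: Rmult_le_pos => //. lra. }
  case: (Rlt_dec (Rabs x) d) => Hx.
  - have H := Hnear nu x Hnu Hx. rewrite -/S in H.
    apply (Rmult_le_compat_l _ _ _ (Rlt_le _ _ HeX)) in H.
    have Hrw : exp (- X * (exp x - 1 - x)) * (b * (Rabs (saddle x) ^ (2 * n) * saddle' x)) = b * moment_fun X (2 * n) x by rewrite Hsn' /moment_fun; ring.
    rewrite Hrw in H. have := Rmult_le_pos _ _ (Rlt_le _ _ HE) P4. lra.
  - have Hfar := saddle_exponent_far d x Hd ltac:(lra). rewrite -/h0 in Hfar.
    have HEE : exp (- X * (exp x - 1 - x)) <= E * exp (- X0 * (exp x - 1 - x)).
    { rewrite /E -exp_plus. apply: exp_le. have : (X - X0) * h0 <= (X - X0) * (exp x - 1 - x) by apply: Rmult_le_compat_l; lra. lra. }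
    have HCm := Cmod_ge_0 (saddle_weight a nu x - RtoC (saddle' x) * S)%C.
    apply: (Rle_trans _ (E * (exp (- X0 * (exp x - 1 - x)) * Cmod (saddle_weight a nu x - RtoC (saddle' x) * S)%C))).
    { rewrite -Rmult_assoc. exact: Rmult_le_compat_r. }
    apply: (Rle_trans _ (E * (C1 * decay 1 x + q * (moment_fun X0 0 x + moment_fun X0 (2 * n) x)))).
    2:{ have := Rmult_le_pos _ _ Hb P2. lra. }
    apply: Rmult_le_compat_l; first lra.
    have Htri : Cmod (saddle_weight a nu x - RtoC (saddle' x) * S)%C <= Cmod (saddle_weight a nu x) + saddle' x * (q * (1 + saddle x ^ (2 * n))).
    { apply: Rle_trans (Cmod_triangle _ _) _. apply: Rplus_le_compat_l.
      rewrite Cmod_opp Cmod_mult Cmod_R Rabs_pos_eq; last lra. apply: Rmult_le_compat_l; first lra.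
      rewrite -Hsn'. apply: Csum_saddle_bound => // r Hr. exact: Hal. }
    apply (Rmult_le_compat_l _ _ _ (Rlt_le _ _ HeX0)) in Htri. apply: Rle_trans Htri _.
    have := Hdom nu x Hnu. rewrite Rmult_comm => HH.
    rewrite Rmult_plus_distr_l. apply: Rplus_le_compat => //.
    right. rewrite /moment_fun /=. ring. }
have {}Hbound := Hbound Hpt.
apply: Rle_trans Hbound _.
rewrite Em moment_size // -/T Rmult_plus_distr_r -Rmult_assoc. apply: Rplus_le_compat_l.
have HEX : E = exp (X0 * h0) * exp (- h0 * X) by rewrite /E -exp_plus; f_equal; ring.
rewrite HEX. have := Hexp X HXp. rewrite (_ : - (INR n + 1 / 2) = - INR n - 1 / 2); last ring.
move=> HH. have He0 := exp_pos (X0 * h0).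
rewrite (_ : exp (X0 * h0) * exp (- h0 * X) * T = (exp (X0 * h0) * T) * exp (- h0 * X)); last ring.
rewrite (Rmult_assoc _ C2). apply: Rmult_le_compat_l => //. apply: Rmult_le_pos; lra.
Qed.

(** * The error function *)

Lemma c_branch_sq (c : R -> C) (w : R) : is_c_branch c -> 0 < w ->
  (c w ^ 2)%C = (2 * (1 - cos w), 2 * (w - sin w)).
Proof.
move=> [H _] Hw. have E := H w Hw. rewrite Cexp_i in E.
rewrite (_ : (c w ^ 2)%C = (2 * (/ 2 * c w ^ 2))%C).
- rewrite E. apply: Ceq; rewrite /Re /Im /=; ring.
- field.
Qed.

(** Half the imaginary part of [c w ^ 2] is [w - sin w], which is positive; hence [c w] touches
    neither axis. *)
Lemma c_branch_re_im (c : R -> C) (w : R) : is_c_branch c -> 0 < w ->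
  Re (c w) * Im (c w) = w - sin w /\ 0 < Re (c w) * Im (c w).
Proof.
move=> Hc Hw. have E := c_branch_sq c w Hc Hw.
have H : Re (c w) * Im (c w) = w - sin w.
{ have := f_equal Im E. case: (c w) => x y. rewrite /Re /Im /=. lra. }
split => //. rewrite H. have := sin_lt_x w Hw. lra.
Qed.

Lemma c_branch_re_near_0 (c : R -> C) : is_c_branch c -> exists d, 0 < d /\ forall w, 0 < w < d -> 0 < Re (c w).
Proof.
move=> [_ [_ [K [d [Hd H]]]]].
have HK := Rabs_pos K.
(* The last entry makes [K w^6 <= w / 2], so that the leading term [w] decides the sign of the real
   part. *)
pose e := Rmin (Rmin d 1) (/ (2 * (Rabs K + 1))).
have Hi : 0 < / (2 * (Rabs K + 1)) by apply: Rinv_0_lt_compat; lra.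
exists e. split; first by repeat apply: Rmin_pos => //; lra.
move=> w [Hw Hwe].
have Hw1 : w < d /\ w < 1 /\ w < / (2 * (Rabs K + 1)).
{ move: Hwe. rewrite /e. have := Rmin_l (Rmin d 1) (/ (2 * (Rabs K + 1))). have := Rmin_r (Rmin d 1) (/ (2 * (Rabs K + 1))).
  have := Rmin_l d 1. have := Rmin_r d 1. lra. }
have HH := H w ltac:(lra).
have E : (w + Ci * w ^ 2 / 6 - w ^ 3 / 36 - Ci * w ^ 4 / 270 + w ^ 5 / 2592)%C =
   (w - w ^ 3 / 36 + w ^ 5 / 2592, w ^ 2 / 6 - w ^ 4 / 270).
{ rewrite -!RtoC_pow. apply: Ceq; rewrite /Re /Im /=; field. }
rewrite E in HH.
have H2 := re_le_Cmod (c w - (w - w ^ 3 / 36 + w ^ 5 / 2592, w ^ 2 / 6 - w ^ 4 / 270)%R)%C.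
have E2 : Re (c w - (w - w ^ 3 / 36 + w ^ 5 / 2592, w ^ 2 / 6 - w ^ 4 / 270)%R)%C = Re (c w) - (w - w ^ 3 / 36 + w ^ 5 / 2592).
{ rewrite /Re /=. ring. }
rewrite E2 in H2.
have H3 : Rabs (Re (c w) - (w - w ^ 3 / 36 + w ^ 5 / 2592)) <= K * w ^ 6 by lra.
have Hw2 : w ^ 2 <= 1 by nra.
have Hw6 : K * w ^ 6 <= w / 2.
{ have H6 : w ^ 6 <= w * w.
  { rewrite (_ : w ^ 6 = w * w * (w ^ 2 * w ^ 2)); last ring. have Hw0 := pow2_ge_0 w. have H4 : w ^ 2 * w ^ 2 <= 1 by nra. nra. }
  have H7 : w * (2 * (Rabs K + 1)) <= 1.
  { apply Rlt_le. apply: (Rlt_le_trans _ (/ (2 * (Rabs K + 1)) * (2 * (Rabs K + 1)))); last by right; apply: Rinv_l; lra.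
    apply: Rmult_lt_compat_r; lra. }
  have H8 : K * w ^ 6 <= Rabs K * (w * w).
  { have := Rle_abs K. have := pow_lt w 6 Hw. nra. }
  nra. }
have Hw3 : w ^ 3 / 36 <= w / 36. { rewrite (_ : w ^ 3 = w * w ^ 2); last ring. nra. }
have Hw5 := pow_lt w 5 Hw.
move: H3. split_Rabs; lra.
Qed.

(** [Re c] is continuous and without zeros, and it is positive near 0, where the expansion selects
    the branch; the intermediate value theorem excludes a negative value. *)
Lemma c_branch_re_pos (c : R -> C) (w : R) : is_c_branch c -> 0 < w -> 0 < Re (c w).
Proof.
move=> Hc Hw.
case: (Rlt_dec 0 (Re (c w))) => // Hn. exfalso.
have [_ Hnz] := c_branch_re_im c w Hc Hw.
have Hneg : Re (c w) < 0. { case: (Req_dec (Re (c w)) 0) => H; last lra. rewrite H in Hnz. lra. }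
have [d [Hd Hd']] := c_branch_re_near_0 c Hc.
pose w0 := Rmin d w / 2.
have Hm : 0 < Rmin d w by exact: Rmin_pos. have := Rmin_l d w. have := Rmin_r d w => M1 M2.
have H0 := Hd' w0 ltac:(rewrite /w0; lra).
have HC x : w0 <= x <= w -> continuity_pt (fun x => - Re (c x)) x.
{ move=> Hx. have Hx0 : 0 < x by rewrite /w0 in Hx; lra.
  apply continuity_pt_filterlim. apply: (continuous_opp (V := R_NormedModule) (fun x => Re (c x))).
  have [_ [HCc _]] := Hc. have := HCc x Hx0. move=> H.
  apply: (continuous_comp (V := C_UniformSpace) c (fun z : C => fst z)) => //.
  case: (c x) => u v. exact: (continuous_fst (U := R_UniformSpace) (V := R_UniformSpace) u v). }
have [z [Hz1 Hz2]] := IVT_interv (fun x => - Re (c x)) w0 w HC ltac:(rewrite /w0; lra) ltac:(lra) ltac:(lra).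
have [_ H] := c_branch_re_im c z Hc ltac:(rewrite /w0 in Hz1; lra).
rewrite (_ : Re (c z) = 0) in H; last lra. lra.
Qed.

Lemma c_branch_im_pos (c : R -> C) (w : R) : is_c_branch c -> 0 < w -> 0 < Im (c w).
Proof.
move=> Hc Hw. have H1 := c_branch_re_pos c w Hc Hw. have [_ H2] := c_branch_re_im c w Hc Hw. nra.
Qed.

(** * Integration by parts for erfc along a horizontal ray *)

Definition cderive (f : R -> C) (s : R) (l : C) : Prop :=
  is_derive (fun s => Re (f s)) s (Re l) /\ is_derive (fun s => Im (f s)) s (Im l).

Lemma is_derive_cross (u v p q : R -> R) (s e u' v' p' q' : R) :
  is_derive u s u' -> is_derive v s v' -> is_derive p s p' -> is_derive q s q' ->
  is_derive (fun s => u s * p s + e * (v s * q s)) s (u' * p s + u s * p' + e * (v' * q s + v s * q')).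
Proof.
move=> U V P Q. auto_derive; first by repeat split; eexists; eassumption.
rewrite (is_derive_unique _ _ _ U) (is_derive_unique _ _ _ V) (is_derive_unique _ _ _ P) (is_derive_unique _ _ _ Q). ring.
Qed.

Lemma cderive_mult (f g : R -> C) (s : R) (lf lg : C) : cderive f s lf -> cderive g s lg ->
  cderive (fun s => f s * g s)%C s (lf * g s + f s * lg)%C.
Proof.
move=> [F1 F2] [G1 G2]. split.
- apply: (is_derive_ext (fun s => Re (f s) * Re (g s) + -1 * (Im (f s) * Im (g s)))); first by move=> u; rewrite /Re /Im /=; ring.
  have := is_derive_cross _ _ _ _ _ (-1) _ _ _ _ F1 F2 G1 G2.
  rewrite (_ : Re (lf * g s + f s * lg)%C = Re lf * Re (g s) + Re (f s) * Re lg + -1 * (Im lf * Im (g s) + Im (f s) * Im lg)) //.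
  rewrite /Re /Im /=. ring.
- apply: (is_derive_ext (fun s => Re (f s) * Im (g s) + 1 * (Im (f s) * Re (g s)))); first by move=> u; rewrite /Re /Im /=; ring.
  have := is_derive_cross _ _ _ _ _ 1 _ _ _ _ F1 F2 G2 G1.
  rewrite (_ : Im (lf * g s + f s * lg)%C = Re lf * Im (g s) + Re (f s) * Im lg + 1 * (Im lf * Re (g s) + Im (f s) * Re lg)) //.
  rewrite /Re /Im /=. ring.
Qed.

Lemma is_derive_exp_trig (u v : R -> R) (s u' v' : R) : is_derive u s u' -> is_derive v s v' ->
  is_derive (fun s => exp (u s) * cos (v s)) s (exp (u s) * cos (v s) * u' - exp (u s) * sin (v s) * v') /\
  is_derive (fun s => exp (u s) * sin (v s)) s (exp (u s) * cos (v s) * v' + exp (u s) * sin (v s) * u').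
Proof.
move=> U V.
split; (auto_derive; first by repeat split; eexists; eassumption);
  rewrite (is_derive_unique _ _ _ U) (is_derive_unique _ _ _ V); ring.
Qed.

Lemma cderive_Cexp (f : R -> C) (s : R) (l : C) : cderive f s l ->
  cderive (fun s => Cexp (f s)) s (Cexp (f s) * l)%C.
Proof.
move=> [F1 F2]. exact: (is_derive_exp_trig _ _ _ _ _ F1 F2).
Qed.

(** The family of integrands that repeated integration by parts of [erfc] creates along the ray. *)
Definition erfc_term (xi : C) (n : nat) (s : R) : C :=
  (Cexp (- (xi + RtoC s) ^ 2) * (/ (xi + RtoC s)) ^ n)%C.

Lemma cderive_inv_shift (xi : C) (s : R) : (xi + RtoC s)%C <> RtoC 0 ->
  cderive (fun s => / (xi + RtoC s))%C s (- (/ (xi + RtoC s)) ^ 2)%C.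
Proof.
case: xi => x y Hn.
have H : (x + s) ^ 2 + y ^ 2 <> 0.
{ move=> E. apply: Hn. have E1 : x + s = 0 by nra. have E2 : y = 0 by nra.
  apply: Ceq; rewrite /Re /Im /=; lra. }
have H' : (x + s) * ((x + s) * 1) + (y + 0) * ((y + 0) * 1) <> 0.
{ move=> E. apply: H. rewrite -E. ring. }
split; rewrite /Re /Im /=; auto_derive => //.
- field. move=> E. apply: H. lra.
- field. move=> E. apply: H. lra.
Qed.

Lemma cderive_inv_pow (xi : C) (n : nat) (s : R) : (xi + RtoC s)%C <> RtoC 0 ->
  cderive (fun s => (/ (xi + RtoC s)) ^ n)%C s (- RtoC (INR n) * (/ (xi + RtoC s)) ^ S n)%C.
Proof.
move=> Hn. elim: n => [|n IH].
- rewrite /= (_ : (- 0 * (/ (xi + RtoC s) * 1))%C = RtoC 0); last by ring.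
  split; rewrite /Re /Im /=; exact: is_derive_const.
- have := cderive_mult _ _ _ _ _ (cderive_inv_shift xi s Hn) IH.
  rewrite (_ : (- RtoC (INR (S n)) * (/ (xi + RtoC s)) ^ S (S n))%C =
     (- (/ (xi + RtoC s)) ^ 2 * (/ (xi + RtoC s)) ^ n + / (xi + RtoC s) * (- RtoC (INR n) * (/ (xi + RtoC s)) ^ S n))%C) //.
  rewrite S_INR RtoC_plus !Cpow_S. ring.
Qed.

Lemma cderive_erfc_term (xi : C) (n : nat) (s : R) : (xi + RtoC s)%C <> RtoC 0 ->
  cderive (erfc_term xi (S n)) s
    (- (2 * erfc_term xi n s + RtoC (INR (S n)) * erfc_term xi (S (S n)) s))%C.
Proof.
move=> Hn.
have H1 : cderive (fun s => - (xi + RtoC s) ^ 2)%C s (- 2 * (xi + RtoC s))%C.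
{ case: xi {Hn} => x y. split; rewrite /Re /Im /=; auto_derive => //; ring. }
have := cderive_mult _ _ _ _ _ (cderive_Cexp _ _ _ H1) (cderive_inv_pow xi (S n) s Hn).
rewrite /erfc_term.
rewrite (_ : (- (2 * (Cexp (- (xi + RtoC s) ^ 2) * (/ (xi + RtoC s)) ^ n) +
     RtoC (INR (S n)) * (Cexp (- (xi + RtoC s) ^ 2) * (/ (xi + RtoC s)) ^ S (S n))))%C =
   (Cexp (- (xi + RtoC s) ^ 2) * (- 2 * (xi + RtoC s)) * (/ (xi + RtoC s)) ^ S n +
    Cexp (- (xi + RtoC s) ^ 2) * (- RtoC (INR (S n)) * (/ (xi + RtoC s)) ^ S (S n)))%C) //.
rewrite !Cpow_S. field. exact: Hn.
Qed.

Lemma erfc_term_0 (xi : C) (s : R) : erfc_term xi 0 s = Cexp (- (xi + RtoC s) ^ 2)%C.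
Proof. exact: Cmult_1_r. Qed.

Lemma cderive_erfc_term_0 (xi : C) (s : R) :
  cderive (erfc_term xi 0) s (erfc_term xi 0 s * (- 2 * (xi + RtoC s)))%C.
Proof.
have H1 : cderive (fun s => - (xi + RtoC s) ^ 2)%C s (- 2 * (xi + RtoC s))%C.
{ case: xi => x y. split; rewrite /Re /Im /=; auto_derive => //; ring. }
have [A1 A2] := cderive_Cexp _ _ _ H1.
rewrite erfc_term_0. split.
- by apply: (is_derive_ext (fun s => Re (Cexp (- (xi + RtoC s) ^ 2)))); first by move=> u; rewrite erfc_term_0.
- by apply: (is_derive_ext (fun s => Im (Cexp (- (xi + RtoC s) ^ 2)))); first by move=> u; rewrite erfc_term_0.
Qed.

Lemma continuous_erfc_term (xi : C) (n : nat) (s : R) : Im xi <> 0 ->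
  continuous (fun s => Re (erfc_term xi n s)) s /\ continuous (fun s => Im (erfc_term xi n s)) s.
Proof.
move=> Hi.
have Hn : (xi + RtoC s)%C <> RtoC 0 by move=> E; apply: Hi; have := f_equal Im E; rewrite /Im /=; lra.
have H : exists l, cderive (erfc_term xi n) s l.
{ case: n => [|n]; eexists; [exact: cderive_erfc_term_0 | exact: cderive_erfc_term]. }
have [l [H1 H2]] := H. split; apply: ex_derive_continuous; eexists; eassumption.
Qed.

Lemma Cmod_Cexp (z : C) : Cmod (Cexp z) = exp (Re z).
Proof.
rewrite (_ : z = (RtoC (Re z) + Ci * RtoC (Im z))%C); last by case: z => x y; apply: Ceq; rewrite /Re /Im /=; ring.
rewrite Cexp_plus Cmod_mult Cmod_Cexp_i Cexp_RtoC Cmod_R Rabs_pos_eq; last by apply: Rlt_le; exact: exp_pos.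
rewrite Rmult_1_r. f_equal. rewrite /Re /=. ring.
Qed.

Lemma Cmod_shift_ge (xi : C) (s : R) : 0 < Re xi -> 0 <= s -> Cmod xi <= Cmod (xi + RtoC s).
Proof.
move=> Hr Hs.
have H1 := Cmod2_alt xi. have H2 := Cmod2_alt (xi + RtoC s)%C.
have E1 : Re (xi + RtoC s)%C = Re xi + s by rewrite /Re /=.
have E2 : Im (xi + RtoC s)%C = Im xi by rewrite /Im /=; ring.
rewrite E1 E2 in H2. have := Cmod_ge_0 xi. have := Cmod_ge_0 (xi + RtoC s)%C.
move=> P1 P2. apply: Rnot_lt_le => H. nra.
Qed.

(** The real part of [(xi + s)^2] exceeds that of [xi^2] by [2 s Re xi + s^2], and
    [|xi + s| >= |xi|]; both use [Re xi > 0] and [s >= 0]. *)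
Lemma erfc_term_bound (xi : C) (n : nat) (s : R) : 0 < Re xi -> 0 <= s ->
  Cmod (erfc_term xi n s) <= Cmod (Cexp (- xi ^ 2)) * / Cmod xi ^ n * (4 * decay (2 * Re xi) s).
Proof.
move=> Hr Hs.
have Hx : 0 < Cmod xi. { have := re_le_Cmod xi. have := Rle_abs (Re xi). lra. }
have Hz := Cmod_shift_ge xi s Hr Hs.
have Hn : (xi + RtoC s)%C <> RtoC 0 by apply Cmod_gt_0; lra.
rewrite /erfc_term Cmod_mult Cmod_pow Cmod_inv //.
have H1 : (/ Cmod (xi + RtoC s)) ^ n <= / Cmod xi ^ n.
{ rewrite -pow_inv. apply: pow_incr. split; first by apply: Rlt_le; apply: Rinv_0_lt_compat; lra.
  exact: Rinv_le_contravar. }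
have H2 : Cmod (Cexp (- (xi + RtoC s) ^ 2)) <= Cmod (Cexp (- xi ^ 2)) * exp (- (2 * Re xi * s)).
{ rewrite !Cmod_Cexp -exp_plus. apply: exp_le.
  rewrite (_ : Re (- (xi + RtoC s) ^ 2)%C = Re (- xi ^ 2)%C - 2 * Re xi * s - s ^ 2); last by case: xi {Hr Hx Hz Hn H1} => x y; rewrite /Re /=; ring.
  have := pow2_ge_0 s. lra. }
have H3 : exp (- (2 * Re xi * s)) <= 4 * 1 * decay (2 * Re xi) s.
{ apply: le_decay; last by apply: Rlt_le; exact: exp_pos.
  - rewrite -exp_plus -exp_0. apply: exp_le. lra.
  - rewrite -exp_plus -exp_0. apply: exp_le. nra. }
have P1 := Cmod_ge_0 (Cexp (- xi ^ 2)).
rewrite (Rmult_comm _ (/ _)) Rmult_assoc (Rmult_comm (Cmod (Cexp (- (xi + RtoC s) ^ 2)))).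
apply: Rmult_le_compat => //; try exact: Cmod_ge_0.
- apply: pow_le. apply: Rlt_le. apply: Rinv_0_lt_compat. lra.
- apply: Rle_trans H2 _. rewrite Rmult_1_r in H3. exact: Rmult_le_compat_l.
Qed.

(** Componentwise, so that the real lemmas on rays apply; [cray_RInt_gen] leads back to the complex
    integral in [Cerfc]. *)
Definition cray (f : R -> C) (l : C) : Prop :=
  is_RInt_gen (fun s => Re (f s)) (at_point 0) (Rbar_locally p_infty) (Re l) /\
  is_RInt_gen (fun s => Im (f s)) (at_point 0) (Rbar_locally p_infty) (Im l).

Lemma ray_decay (b : R) : 0 < b ->
  is_RInt_gen (decay b) (at_point 0) (Rbar_locally p_infty) (/ (2 * b)).
Proof.
move=> Hb. rewrite (_ : / (2 * b) = 0 - (- / (1 + exp (b * 0)) / b)); last by rewrite Rmult_0_r exp_0; field; lra.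
apply (is_RInt_gen_primitive (fun y => - / (1 + exp (b * y)) / b)).
- move=> x. exact: decay_primitive.
- exact: continuous_decay.
- move=> P HP. exact: locally_singleton HP.
- exact: filterlim_decay_primitive_p.
Qed.

Lemma ray_integral_scal (k : R) (f : R -> R) (r l : R) :
  is_RInt_gen f (at_point r) (Rbar_locally p_infty) l ->
  is_RInt_gen (fun x => k * f x) (at_point r) (Rbar_locally p_infty) (k * l).
Proof. exact: (is_RInt_gen_scal f k l). Qed.

Lemma ex_cray_erfc_term (xi : C) (n : nat) : 0 < Re xi -> Im xi <> 0 ->
  exists l, cray (erfc_term xi n) l /\
    Cmod l <= 2 * (Cmod (Cexp (- xi ^ 2)) * / Cmod xi ^ n * / Re xi).
Proof.
move=> Hr Hi. set M := Cmod (Cexp (- xi ^ 2)) * / Cmod xi ^ n.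
have HB f : (forall z, Rabs (f z) <= Cmod z) -> (forall s, continuous (fun s => f (erfc_term xi n s)) s) ->
  exists l, is_RInt_gen (fun s => f (erfc_term xi n s)) (at_point 0) (Rbar_locally p_infty) l /\ Rabs l <= M * / Re xi.
{ move=> Hf Cf.
  have Hb s : 0 <= s -> Rabs (f (erfc_term xi n s)) <= M * 4 * decay (2 * Re xi) s.
  { move=> Hs. apply: Rle_trans (Hf _) _. rewrite Rmult_assoc. exact: erfc_term_bound. }
  have [l Hl] := ex_ray_integral_decay _ 0 (2 * Re xi) (M * 4) ltac:(lra) Cf Hb.
  exists l. split => //.
  have := ray_integral_le 0 _ _ _ _ Hb Hl (ray_integral_scal (M * 4) _ _ _ (ray_decay (2 * Re xi) ltac:(lra))).
  rewrite (_ : M * 4 * / (2 * (2 * Re xi)) = M * / Re xi) //. field. lra. }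
have [l1 [H1 B1]] := HB Re re_le_Cmod (fun s => proj1 (continuous_erfc_term xi n s Hi)).
have [l2 [H2 B2]] := HB Im Rabs_Im_le_Cmod (fun s => proj2 (continuous_erfc_term xi n s Hi)).
exists (l1, l2). split => //. apply: Rle_trans (Cmod_le_sum _ _) _. lra.
Qed.

Lemma cray_unique (f : R -> C) (l l' : C) : cray f l -> cray f l' -> l = l'.
Proof.
move=> [H1 H2] [H1' H2']. apply: Ceq; [exact: ray_integral_unique H1 H1' | exact: ray_integral_unique H2 H2'].
Qed.

Lemma cray_RInt_gen (f : R -> C) (l : C) : cray f l ->
  RInt_gen (V := C_R_CompleteNormedModule) f (at_point 0) (Rbar_locally p_infty) = l.
Proof.
move=> [H1 H2]. apply (is_RInt_gen_unique (V := C_R_CompleteNormedModule)).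
case: l H1 H2 => l1 l2 H1 H2 P [eps HP].
have [Q1 Q2 HQ1 HQ2 HQ] := proj1 (filterlimi_locally _ _) H1 eps.
have [S1 S2 HS1 HS2 HS] := proj1 (filterlimi_locally _ _) H2 eps.
exists (fun x => Q1 x /\ S1 x) (fun x => Q2 x /\ S2 x); [by split | exact: filter_and |].
move=> a b [A1 A2] [B1 B2].
have [y1 [Y1 Z1]] := HQ a b A1 B1. have [y2 [Y2 Z2]] := HS a b A2 B2.
exists (y1, y2). split.
- exact: (is_RInt_fct_extend_pair (U := R_NormedModule) (V := R_NormedModule) f a b y1 y2 Y1 Y2).
- apply: HP. by split.
Qed.

Lemma erfc_term_lim (xi : C) (n : nat) : 0 < Re xi ->
  filterlim (fun s => Cmod (erfc_term xi n s)) (Rbar_locally p_infty) (locally 0).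
Proof.
move=> Hr. set M := Cmod (Cexp (- xi ^ 2)) * / Cmod xi ^ n.
have HM : 0 <= M.
{ apply: Rmult_le_pos; first exact: Cmod_ge_0. apply: Rlt_le. apply: Rinv_0_lt_compat. apply: pow_lt.
  have := re_le_Cmod xi. have := Rle_abs (Re xi). lra. }
have Hdec s : 0 <= s -> decay (2 * Re xi) s <= exp (2 * Re xi * - s).
{ move=> Hs. rewrite /decay.
  rewrite (_ : exp (2 * Re xi * - s) = / (exp (2 * Re xi * s / 2)) ^ 2).
  - have P := exp_pos (2 * Re xi * s / 2). have P' := exp_pos (- (2 * Re xi * s / 2)).
    apply: Rinv_le_contravar; first exact: pow_lt. apply: pow_incr. lra.
  - rewrite -exp_INR_mult -exp_Ropp. f_equal. rewrite /=. field. }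
have Hl : filterlim (fun s => M * 4 * exp (2 * Re xi * - s)) (Rbar_locally p_infty) (locally (M * 4 * 0)).
{ apply: (is_lim_scal_l (fun s => exp (2 * Re xi * - s)) (M * 4) p_infty 0).
  apply: (filterlim_comp _ _ _ Ropp (fun v => exp (2 * Re xi * v)) _ (Rbar_locally m_infty)); last by apply: filterlim_exp_m; lra.
  exact (is_lim_opp (fun x => x) p_infty p_infty (is_lim_id p_infty)). }
apply filterlim_locally => eps.
have [N HN] := proj1 (filterlim_locally _ _) Hl eps.
exists (Rmax N 0) => s Hs. have := Rmax_l N 0. have := Rmax_r N 0 => U1 U2.
have := HN s ltac:(lra). have B := erfc_term_bound xi n s Hr ltac:(lra). have D := Hdec s ltac:(lra).
rewrite /ball /= /AbsRing_ball /abs /minus /plus /opp /= Rmult_0_r Ropp_0 !Rplus_0_r.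
have P := exp_pos (2 * Re xi * - s).
rewrite (Rabs_pos_eq (M * 4 * _)); last by apply: Rmult_le_pos; lra.
rewrite Rabs_pos_eq; last exact: Cmod_ge_0.
move=> H. apply: Rle_lt_trans B _. apply: Rle_lt_trans H. rewrite -/M Rmult_assoc. apply: Rmult_le_compat_l => //. lra.
Qed.

(** The derivative of [erfc_term xi (S n)] is integrated over the ray; the boundary value at
    infinity vanishes, and the one at 0 is the main term. *)
Lemma cray_erfc_step (xi : C) (n : nat) (l l2 : C) : 0 < Re xi -> Im xi <> 0 ->
  cray (erfc_term xi n) l -> cray (erfc_term xi (S (S n))) l2 ->
  l = (erfc_term xi (S n) 0 / 2 - RtoC (INR (S n) / 2) * l2)%C.
Proof.
move=> Hr Hi [A1 A2] [B1 B2].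
have Hn s : (xi + RtoC s)%C <> RtoC 0 by move=> E; apply: Hi; have := f_equal Im E; rewrite /Im /=; lra.
have HL (f : C -> R) : (forall z, Rabs (f z) <= Cmod z) ->
   filterlim (fun s => f (erfc_term xi (S n) s)) (Rbar_locally p_infty) (locally 0).
{ move=> Hf. apply filterlim_locally => eps.
  have [N HN] := proj1 (filterlim_locally _ _) (erfc_term_lim xi (S n) Hr) eps.
  exists N => s Hs. have := HN s Hs. have := Hf (erfc_term xi (S n) s).
  rewrite /ball /= /AbsRing_ball /abs /minus /plus /opp /= Ropp_0 !Rplus_0_r.
  rewrite (Rabs_pos_eq (Cmod _)); last exact: Cmod_ge_0. lra. }
have key (f : C -> R) : (forall z, Rabs (f z) <= Cmod z) -> (forall (k k' : R) z z', f (- (RtoC k * z + RtoC k' * z'))%C = - (k * f z + k' * f z')) ->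
  (forall s, is_derive (fun s => f (erfc_term xi (S n) s)) s (f (- (2 * erfc_term xi n s + RtoC (INR (S n)) * erfc_term xi (S (S n)) s))%C)) ->
  (forall m s, continuous (fun s => f (erfc_term xi m s)) s) ->
  forall v v2, is_RInt_gen (fun s => f (erfc_term xi n s)) (at_point 0) (Rbar_locally p_infty) v ->
  is_RInt_gen (fun s => f (erfc_term xi (S (S n)) s)) (at_point 0) (Rbar_locally p_infty) v2 ->
  2 * v + INR (S n) * v2 = f (erfc_term xi (S n) 0).
{ move=> Hf Hlin HD HC v v2 Hv Hv2.
  have H1 := ray_integral_lin (INR (S n)) _ _ _ _ _ (ray_integral_scal 2 _ _ _ Hv) Hv2.
  have H2 : is_RInt_gen (fun s => -1 * f (- (2 * erfc_term xi n s + RtoC (INR (S n)) * erfc_term xi (S (S n)) s))%C) (at_point 0) (Rbar_locally p_infty) (-1 * (0 - f (erfc_term xi (S n) 0))).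
  { apply: ray_integral_scal. apply (is_RInt_gen_primitive (fun s => f (erfc_term xi (S n) s))) => //.
    - move=> s. apply: (continuous_ext (fun s => - (2 * f (erfc_term xi n s) + INR (S n) * f (erfc_term xi (S (S n)) s)))); first by move=> u; rewrite Hlin.
      apply: (continuous_opp (V := R_NormedModule)). apply: (continuous_plus (V := R_NormedModule)).
      + apply: (continuous_scal_r 2 (fun s => f (erfc_term xi n s))). exact: HC.
      + apply: (continuous_scal_r (INR (S n)) (fun s => f (erfc_term xi (S (S n)) s))). exact: HC.
    - move=> P HP. exact: locally_singleton HP.
    - exact: HL. }
  have HP s : 2 * f (erfc_term xi n s) + INR (S n) * f (erfc_term xi (S (S n)) s) =
     -1 * f (- (2 * erfc_term xi n s + RtoC (INR (S n)) * erfc_term xi (S (S n)) s))%C by rewrite Hlin; ring.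
  have H3 := ray_integral_ext _ _ _ _ HP H1.
  have := ray_integral_unique _ _ _ _ H3 H2. lra. }
have LR (k k' : R) (z z' : C) : Re (- (RtoC k * z + RtoC k' * z'))%C = - (k * Re z + k' * Re z') by rewrite /Re /=; ring.
have LI (k k' : R) (z z' : C) : Im (- (RtoC k * z + RtoC k' * z'))%C = - (k * Im z + k' * Im z') by rewrite /Im /=; ring.
have KR := key Re re_le_Cmod LR (fun s => proj1 (cderive_erfc_term xi n s (Hn s)))
  (fun m s => proj1 (continuous_erfc_term xi m s Hi)) _ _ A1 B1.
have KI := key Im Rabs_Im_le_Cmod LI (fun s => proj2 (cderive_erfc_term xi n s (Hn s)))
  (fun m s => proj2 (continuous_erfc_term xi m s Hi)) _ _ A2 B2.
have E : erfc_term xi (S n) 0 = (2 * l + RtoC (INR (S n)) * l2)%C.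
{ apply: Ceq; [rewrite -KR | rewrite -KI]; rewrite /Re /Im /=; ring. }
rewrite E RtoC_div; last lra. field.
Qed.

Lemma Csum_S (f : nat -> C) (n : nat) : Csum f (S n) = (Csum f n + f n)%C.
Proof. by []. Qed.

(** On iteration the factors [(2 N + 1) / 2 = 1 / 2 + N] multiply up to [rising (1 / 2) N]. The
    remainder is kept as an exact integral and estimated only afterwards. *)
Lemma cray_erfc_expansion (xi l : C) (N : nat) : 0 < Re xi -> Im xi <> 0 ->
  cray (erfc_term xi 0) l ->
  exists l', cray (erfc_term xi (2 * N)) l' /\
  l = (Csum (fun k => RtoC ((-1) ^ k * rising (1 / 2) k) * (erfc_term xi (2 * k + 1) 0 / 2)) N
       + RtoC ((-1) ^ N * rising (1 / 2) N) * l')%C.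
Proof.
move=> Hr Hi Hl. elim: N => [|N [l' [Hl' E]]].
- exists l. split => //. rewrite /= Rmult_1_l. ring.
- have [l2 [Hl2 _]] := ex_cray_erfc_term xi (S (S (2 * N))) Hr Hi.
  exists l2. split; first by rewrite (_ : (2 * S N = S (S (2 * N)))%nat) //; lia.
  have Es := cray_erfc_step xi (2 * N) l' l2 Hr Hi Hl' Hl2.
  rewrite E Es Csum_S [rising _ (S N)]/= [(-1) ^ S N]/= (_ : (2 * N + 1 = S (2 * N))%nat); last lia.
  rewrite (_ : INR (S (2 * N)) / 2 = 1 / 2 + INR N); last by rewrite S_INR mult_INR /=; field.
  rewrite !RtoC_mult (_ : RtoC (-1) = Copp (RtoC 1)); last by apply: Ceq; rewrite /Re /Im /=; ring.
  ring.
Qed.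

(** * The exponentially small expansion *)

Lemma cos_sin_sub_PI (u : R) (m : nat) :
  cos (u - INR m * PI) = (-1) ^ m * cos u /\ sin (u - INR m * PI) = (-1) ^ m * sin u.
Proof.
elim: m => [|m [IH1 IH2]]; first by rewrite /= Rmult_0_l Rminus_0_r !Rmult_1_l.
rewrite S_INR (_ : u - (INR m + 1) * PI = (u - INR m * PI) - PI); last ring.
rewrite (cos_minus (u - INR m * PI)) (sin_minus (u - INR m * PI)) cos_PI sin_PI IH1 IH2 /=. split; ring.
Qed.

Lemma pow_m1_sq (m : nat) : (-1) ^ m * (-1) ^ m = 1.
Proof. rewrite -Rpow_mult_distr (_ : -1 * -1 = 1); last ring. exact: pow1. Qed.

(** The shift by [ln X] puts the saddle point at [y = 0]. As [x = X^a], the denominator becomes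
    [1 + e^(- a y) e^(- i a pi)], and this is [e^(- a y) (e^(a y) - t_0^a)] because
    [t_0^a = - e^(- i a pi)]. *)
Lemma remainder_saddle (a x : R) (m : nat) : 0 < a < 1 -> 0 < x -> (0 < m)%nat ->
  exists l, integral_R (fun y => exp (- bigX a x * (exp y - 1 - y)) *
        Im (Cexp (Ci * RtoC (- (omega a * (a * INR m)))) * saddle_weight a (a * INR m - bigX a x) y)%C) l /\
    mittag_leffler a (- x) - algebraic_part a m x = exp (- bigX a x) / PI * l.
Proof.
move=> Ha Hx Hm. have HPI := PI_RGT_0. have HPa := PI_lt_PI_div a Ha.
have [l [Hl E]] := mittag_leffler_remainder a x m Ha Hx Hm.
set X := bigX a x. have HX : 0 < X by exact: exp_pos.
have Hlx : ln x = a * ln X. { rewrite /X /bigX /Rpower ln_exp. field. lra. }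
have Hxe : x = exp (a * ln X) by rewrite -Hlx exp_ln.
have HC y : continuous (fun y => gIm 1 (a * INR m) x (- a) y PI) y.
{ apply: continuous_gIm_r. apply: hankel_dSq_neq => //; lra. }
have Hs := integral_R_shift _ (ln X) _ HC Hl.
have Hxm : (- x) ^ m <> 0 by apply: pow_nonzero; lra.
exists (/ ((- x) ^ m * exp (- X)) * l). split; last first.
{ rewrite E. have He := exp_pos (- X). field. repeat split; lra. }
apply: integral_R_ext (integral_R_scal _ _ _ Hs) => y.
have HD := hankel_dSq_neq x a (y + ln X) PI Ha ltac:(lra) ltac:(lra).
have Exy : x * exp (- a * (y + ln X)) = exp (- a * y).
{ rewrite {1}Hxe -exp_plus. f_equal. ring. }
have EM : gMod 1 (a * INR m) (y + ln X) PI = x ^ m * exp (- X) * (exp (- X * (exp y - 1 - y)) * exp ((a * INR m - X) * y)).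
{ have Exm : x ^ m = exp (INR m * (a * ln X)) by rewrite exp_INR_mult -Hxe.
  rewrite Exm /gMod cos_PI -!exp_plus. f_equal. rewrite (exp_plus y) exp_ln //. ring. }
have EA : gArg 1 (a * INR m) (y + ln X) PI = a * INR m * PI by rewrite /gArg sin_PI; ring.
(* The sign of [(- x)^m] is absorbed into the phase: [omega a = pi - a pi], so
   [(-1)^m e^(i a m pi) = e^(- i omega a m)]. *)
have Ek : - (omega a * (a * INR m)) = a * INR m * PI - INR m * PI by rewrite /omega; field; lra.
have [Ec Esn] := cos_sin_sub_PI (a * INR m * PI) m.
have EW : (RtoC (exp (a * y)) - t0_pow a a)%C =
   (exp (a * y) * dRe x (- a) (y + ln X) PI, exp (a * y) * dIm x (- a) (y + ln X) PI).
{ rewrite t0_pow_self; last lra. rewrite /dRe /dIm Exy (Ropp_mult_distr_l_reverse a PI) cos_neg sin_neg.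
  have E1 : exp (a * y) * exp (- a * y) = 1 by rewrite -exp_plus -exp_0; f_equal; ring.
  apply: Ceq; rewrite /Re /Im /=.
  - rewrite Rmult_plus_distr_l -Rmult_assoc E1. ring.
  - rewrite -Rmult_assoc E1. ring. }
rewrite /saddle_weight EW Ek Cexp_i Ec Esn /gIm EM EA.
rewrite (_ : (a + (a * INR m - X)) * y = a * y + (a * INR m - X) * y); last ring. rewrite (exp_plus (a * y)).
rewrite (_ : (- x) ^ m = (-1) ^ m * x ^ m); last by rewrite -Rpow_mult_distr; f_equal; ring.
move: HD. rewrite /dSq. move: (dRe x (- a) (y + ln X) PI) (dIm x (- a) (y + ln X) PI) => A D HD.
have He1 := exp_pos (a * y). have He2 := exp_pos (- X). have Hx1 := pow_lt x m Hx.
have Hs1 := pow_m1_sq m. set sg := (-1) ^ m in Hs1 *.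
have Hsg : sg <> 0 by apply: pow_nonzero; lra.
rewrite (_ : Im _ = sg * exp ((a * INR m - X) * y) * ((A * sin (a * INR m * PI) - D * cos (a * INR m * PI)) / (A * A + D * D))); last first.
{ rewrite /Im /=. field. repeat split; try lra.
  rewrite (_ : _ + _ = exp (a * y) * exp (a * y) * (A * A + D * D)); last ring.
  apply: Rmult_integral_contrapositive_currified => //. nra. }
rewrite (_ : / (sg * x ^ m * exp (- X)) = sg * / (x ^ m * exp (- X))); last first.
{ apply: (Rmult_eq_reg_l sg) => //. rewrite -Rmult_assoc Hs1. field. repeat split; lra. }
field. repeat split; lra.
Qed.

Lemma Ci_pow_odd (c0 : C) (k : nat) : ((Ci * c0) ^ S (2 * k))%C = (Ci * RtoC ((-1) ^ k) * c0 ^ S (2 * k))%C.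
Proof.
elim: k => [|k IH]; first by rewrite /= ; ring.
rewrite (_ : (S (2 * S k) = S (S (S (2 * k))))%nat); last lia.
rewrite Cpow_S (Cpow_S _ (S (2 * k))) IH (Cpow_S c0 (S (S (2 * k)))) (Cpow_S c0 (S (2 * k))).
rewrite [(-1) ^ S k]/= RtoC_mult.
have E : (Ci * Ci)%C = RtoC (-1) by apply: Ceq; rewrite /Re /Im /=; ring.
rewrite -E. ring.
Qed.

Lemma RtoC_neq_0 (r : R) : r <> 0 -> RtoC r <> RtoC 0.
Proof. move=> H E. apply: H. by have := f_equal Re E. Qed.

(** From [c^2 / 2 = 1 + i omega - e^(i omega)] and [e^(i pi / a) = - e^(i omega)] the terms with
    [e^(i omega)] cancel: the Gaussian factor of [erfc] brings its prefactor down to the size of the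
    saddle contribution. *)
Lemma phase_identity (a X : R) (c : R -> C) : 0 < a < 1 -> 0 <= X -> is_c_branch c ->
  (Cexp (RtoC X * Cexp (Ci * RtoC (PI / a))) * Cexp (- (c (omega a) * RtoC (sqrt (X / 2))) ^ 2))%C =
  Cexp (- RtoC X - Ci * RtoC (omega a * X)).
Proof.
move=> Ha HX Hc. have HPI := PI_RGT_0.
have Hw : 0 < omega a. { rewrite /omega. apply: Rdiv_lt_0_compat; nra. }
rewrite -Cexp_plus. f_equal.
rewrite Cpow_mult_l -RtoC_pow pow2_sqrt; last lra. rewrite (c_branch_sq c _ Hc Hw) Cexp_i.
have Ew : PI / a = omega a + PI by rewrite /omega; field; lra.
rewrite Ew cos_plus sin_plus cos_PI sin_PI.
apply: Ceq; rewrite /Re /Im /=; field.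
Qed.

(** On the left stands a term of the asymptotic series of [erfc], on the right the contribution of
    [(i c)^(- 2 k - 1)] to the Laplace integral. The signs match because [i / (i c)^(2 k + 1) =
    (-1)^k / c^(2 k + 1)]. *)
Lemma expansion_term (a X : R) (c0 : C) (k : nat) : 0 < a -> 0 < X -> c0 <> RtoC 0 ->
  (RtoC (2 / a) * (RtoC ((-1) ^ k * rising (1 / 2) k / sqrt PI) * ((/ (c0 * RtoC (sqrt (X / 2)))) ^ (2 * k + 1) / 2)))%C =
  (RtoC (/ (PI * a)) * (Ci * (/ (Ci * c0) ^ S (2 * k)) * RtoC (rising (1 / 2) k * / (X / 2) ^ k * sqrt (2 * PI / X))))%C.
Proof.
move=> Ha HX Hc. have HPI := PI_RGT_0.
have Hq : 0 < sqrt (X / 2) by apply: sqrt_lt_R0; lra.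
have Hp : 0 < sqrt PI by apply: sqrt_lt_R0; lra.
have Hq0 := RtoC_neq_0 _ (Rgt_not_eq _ _ Hq).
have Eq2 : sqrt (X / 2) ^ S (2 * k) = sqrt (X / 2) * (X / 2) ^ k.
{ rewrite /= -/(2 * k)%nat pow_mult pow2_sqrt //. lra. }
have EpiX : sqrt (2 * PI / X) = sqrt PI / sqrt (X / 2).
{ rewrite -sqrt_div_alt; last lra. f_equal. field. lra. }
have Epi : PI = sqrt PI * sqrt PI by rewrite sqrt_sqrt; lra.
have Hck : (c0 ^ S (2 * k))%C <> RtoC 0 by apply: Cpow_nz.
have HXk : (X / 2) ^ k <> 0 by apply: pow_nonzero; lra.
have Hs : (-1) ^ k <> 0 by apply: pow_nonzero; lra.
have Hi : Ci <> RtoC 0 by move=> E; have := f_equal Im E; rewrite /Im /=; lra.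
rewrite Ci_pow_odd (_ : (2 * k + 1 = S (2 * k))%nat); last lia.
rewrite Cpow_inv; last by apply: Cmult_neq_0. rewrite Cpow_mult_l -RtoC_pow Eq2.
have E1 : (Ci * / (Ci * RtoC ((-1) ^ k) * c0 ^ S (2 * k)))%C = (RtoC ((-1) ^ k) * / c0 ^ S (2 * k))%C.
{ have Hs' := RtoC_neq_0 _ Hs.
  have E2 : (RtoC ((-1) ^ k) * RtoC ((-1) ^ k) = 1)%C by rewrite -RtoC_mult pow_m1_sq.
  transitivity (RtoC ((-1) ^ k) * RtoC ((-1) ^ k) * / RtoC ((-1) ^ k) * / c0 ^ S (2 * k))%C.
  - rewrite E2. field. by repeat split.
  - field. by repeat split. }
rewrite E1.
have Hqk : sqrt (X / 2) * (X / 2) ^ k <> 0 by apply: Rmult_integral_contrapositive_currified => //; lra.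
rewrite (_ : (/ (c0 ^ S (2 * k) * RtoC (sqrt (X / 2) * (X / 2) ^ k)) / 2)%C = (RtoC (/ (sqrt (X / 2) * (X / 2) ^ k) / 2) * / c0 ^ S (2 * k))%C); last first.
{ rewrite RtoC_div; last lra. rewrite RtoC_inv //. field. split => //. exact: RtoC_neq_0. }
rewrite !Cmult_assoc -!RtoC_mult.
rewrite (_ : forall (r s1 : R) (z : C), (RtoC r * z * RtoC s1)%C = (RtoC (r * s1)%R * z)%C); last by move=> *; rewrite RtoC_mult; ring.
f_equal. f_equal. rewrite EpiX {2}Epi. field. repeat split; lra.
Qed.

Lemma rising_pos (n : nat) : 0 < rising (1 / 2) n.
Proof. elim: n => [|n IH] /=; first lra. apply: Rmult_lt_0_compat => //. have := pos_INR n. lra. Qed.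

Lemma half_power_size (X : R) (n : nat) : 0 < X ->
  / ((X / 2) ^ n * sqrt (X / 2)) = 2 ^ n * sqrt 2 * Rpower X (- INR n - 1 / 2).
Proof.
move=> HX.
rewrite /Rminus Rpower_plus Rpower_Ropp Rpower_pow // (_ : - (1 / 2) = - / 2); last field.
rewrite Rpower_Ropp Rpower_sqrt // sqrt_div_alt; last lra.
have H1 : sqrt X <> 0 by apply: Rgt_not_eq; exact: sqrt_lt_R0.
have H2 : X ^ n <> 0 by apply: pow_nonzero; lra.
have H3 : (2 : R) ^ n <> 0 by apply: pow_nonzero; lra.
have H4 : sqrt 2 <> 0 by apply: Rgt_not_eq; apply: sqrt_lt_R0; lra.
rewrite /Rdiv Rpow_mult_distr pow_inv. field. by repeat split.
Qed.

Lemma Cmod_phase (X w : R) : Cmod (Cexp (- RtoC X - Ci * RtoC w)) = exp (- X).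
Proof. rewrite Cmod_Cexp. f_equal. rewrite /Re /=. ring. Qed.

(** [xi = c sqrt (X / 2)] moves along a fixed direction with [Re xi > 0], so the exact remainder is
    at most a constant times [|e^(- xi^2)| |xi|^(- 2 N) / Re xi]; with the exponential prefactor,
    [phase_identity] leaves [e^(- X) X^(- N - 1/2)]. *)
Lemma erfc_expansion (a : R) (c : R -> C) (N : nat) : 0 < a < 1 -> is_c_branch c ->
  exists M, 0 <= M /\ forall X, 0 < X ->
    Cmod (Cexp (RtoC X * Cexp (Ci * RtoC (PI / a))) / 2 * Cerfc (c (omega a) * RtoC (sqrt (X / 2)))
      - Csum (fun k => RtoC ((-1) ^ k * rising (1 / 2) k / sqrt PI) *
           (Cexp (- RtoC X - Ci * RtoC (omega a * X)) * (/ (c (omega a) * RtoC (sqrt (X / 2)))) ^ (2 * k + 1) / 2)) N)%C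
    <= M * (exp (- X) * Rpower X (- INR N - 1 / 2)).
Proof.
move=> Ha Hc. have HPI := PI_RGT_0.
have Hw : 0 < omega a. { rewrite /omega. apply: Rdiv_lt_0_compat; nra. }
have Hr := c_branch_re_pos c _ Hc Hw. have Hi := c_branch_im_pos c _ Hc Hw.
set c0 := c (omega a) in Hr Hi *.
have Hcm : 0 < Cmod c0. { have := re_le_Cmod c0. have := Rle_abs (Re c0). lra. }
have Hsp : 0 < sqrt PI by exact: sqrt_lt_R0.
have Hris := rising_pos N.
pose M0 := rising (1 / 2) N / sqrt PI * 2 * / (Cmod c0 ^ (2 * N) * Re c0).
have HM0 : 0 < M0.
{ have := pow_lt _ (2 * N) Hcm => Hp. rewrite /M0.
  apply: Rmult_lt_0_compat; last by apply: Rinv_0_lt_compat; exact: Rmult_lt_0_compat.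
  apply: Rmult_lt_0_compat; last lra. exact: Rdiv_lt_0_compat. }
have H2N : 0 < 2 ^ N * sqrt 2 by apply: Rmult_lt_0_compat; [apply: pow_lt | apply: sqrt_lt_R0]; lra.
exists (M0 * (2 ^ N * sqrt 2)). split; first by apply: Rlt_le; exact: Rmult_lt_0_compat.
move=> X HX.
have Hq : 0 < sqrt (X / 2) by apply: sqrt_lt_R0; lra.
have Hph := phase_identity a X c Ha (Rlt_le _ _ HX) Hc. rewrite -/c0 in Hph.
set xi := (c0 * RtoC (sqrt (X / 2)))%C in Hph *. set ph := Cexp (- RtoC X - Ci * RtoC (omega a * X)) in Hph *.
set E := Cexp (RtoC X * Cexp (Ci * RtoC (PI / a))) in Hph *.
have Hxr : Re xi = Re c0 * sqrt (X / 2) by rewrite /xi /Re /=; ring.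
have Hxi : Im xi = Im c0 * sqrt (X / 2) by rewrite /xi /Im /=; ring.
have Hr' : 0 < Re xi by rewrite Hxr; exact: Rmult_lt_0_compat.
have Hi' : Im xi <> 0 by rewrite Hxi; apply: Rgt_not_eq; exact: Rmult_lt_0_compat.
have [L [HL _]] := ex_cray_erfc_term xi 0 Hr' Hi'.
have [L' [HL' EL]] := cray_erfc_expansion xi L N Hr' Hi' HL.
have [L2 [HL2 BL]] := ex_cray_erfc_term xi (2 * N) Hr' Hi'.
rewrite (cray_unique _ _ _ HL2 HL') in BL.
have ECerfc : Cerfc xi = (RtoC (2 / sqrt PI) * L)%C.
{ rewrite /Cerfc. f_equal. rewrite -(cray_RInt_gen _ _ HL).
  f_equal. apply: functional_extensionality => s. by rewrite erfc_term_0. }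
have Hterm n : (E * erfc_term xi n 0 = ph * (/ xi) ^ n)%C.
{ rewrite /erfc_term Cplus_0_r Cmult_assoc Hph. by []. }
have Hsp' := RtoC_neq_0 _ (Rgt_not_eq _ _ Hsp).
have EE : (E / 2 * Cerfc xi)%C = (Csum (fun k => RtoC ((-1) ^ k * rising (1 / 2) k / sqrt PI) * (ph * (/ xi) ^ (2 * k + 1) / 2)) N
   + RtoC ((-1) ^ N * rising (1 / 2) N / sqrt PI) * (E * L'))%C.
{ rewrite ECerfc EL.
  rewrite (Csum_ext (fun k => RtoC ((-1) ^ k * rising (1 / 2) k / sqrt PI) * (ph * (/ xi) ^ (2 * k + 1) / 2))%C
     (fun k => E * / RtoC (sqrt PI) * (RtoC ((-1) ^ k * rising (1 / 2) k) * (erfc_term xi (2 * k + 1) 0 / 2)))%C).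
  - rewrite Csum_scal !RtoC_div; try lra. field. exact: Hsp'.
  - move=> k _. rewrite -Hterm RtoC_div; last lra. field. exact: Hsp'. }
rewrite EE (_ : forall z w : C, (z + w - z)%C = w); last by move=> *; ring.
rewrite !Cmod_mult Cmod_R.
have H1 : Rabs ((-1) ^ N * rising (1 / 2) N / sqrt PI) = rising (1 / 2) N / sqrt PI.
{ rewrite Rabs_div; last lra. rewrite Rabs_mult -RPow_abs Rabs_Ropp Rabs_R1 pow1 !Rabs_pos_eq; lra. }
have H2 : Cmod E * Cmod (Cexp (- xi ^ 2)) = exp (- X) by rewrite -Cmod_mult Hph Cmod_phase.
have H3 : Cmod xi ^ (2 * N) = Cmod c0 ^ (2 * N) * (X / 2) ^ N.
{ rewrite /xi Cmod_mult Cmod_R Rabs_pos_eq; last lra. rewrite Rpow_mult_distr (pow_mult (sqrt _)) pow2_sqrt; lra. }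
rewrite H1.
apply: (Rle_trans _ (rising (1 / 2) N / sqrt PI * (Cmod E * (2 * (Cmod (Cexp (- xi ^ 2)) * / Cmod xi ^ (2 * N) * / Re xi))))).
{ apply: Rmult_le_compat_l; first by apply: Rlt_le; exact: Rdiv_lt_0_compat.
  apply: Rmult_le_compat_l => //. exact: Cmod_ge_0. }
right. rewrite H3 Hxr.
have Hs := half_power_size X N HX.
have HXN : 0 < (X / 2) ^ N by apply: pow_lt; lra.
have HcN := pow_lt _ (2 * N) Hcm.
transitivity (M0 * ((Cmod E * Cmod (Cexp (- xi ^ 2))) * / ((X / 2) ^ N * sqrt (X / 2)))).
- rewrite /M0. field. repeat split; lra.
- rewrite H2 Hs. ring.
Qed.

(** An exact identity between partial sums: the pole part of each [watson_coeff] matches a term of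
    [erfc] by [expansion_term], the other part matches the term with [B]. The factor
    [e^(i nu omega)] in [watson_coeff] removes [nu] from the phase. *)
Lemma leading_terms_agree (a nu X : R) (c : R -> C) (B : R -> nat -> C) (N : nat) :
  0 < a < 1 -> is_c_branch c -> 0 < X ->
  exp (- X) / PI * Im (Cexp (Ci * RtoC (- (omega a * (X + nu)))) *
      Csum (fun k => watson_coeff a (c (omega a)) B nu (2 * k) *
             RtoC (rising (1 / 2) k * / (X / 2) ^ k * sqrt (2 * PI / X))) N)%C =
  2 / a * Re (Csum (fun k => RtoC ((-1) ^ k * rising (1 / 2) k / sqrt PI) *
           (Cexp (- RtoC X - Ci * RtoC (omega a * X)) * (/ (c (omega a) * RtoC (sqrt (X / 2)))) ^ (2 * k + 1) / 2)) N
    - Ci * Cexp (- RtoC X - Ci * RtoC (omega a * X)) / RtoC (sqrt (2 * PI * X))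
        * Csum (fun k => B nu (2 * k)%nat * RtoC (half_pochhammer k * / (X / 2) ^ k)) N)%C.
Proof.
move=> Ha Hc HX. have HPI := PI_RGT_0.
have Hw : 0 < omega a. { rewrite /omega. apply: Rdiv_lt_0_compat; nra. }
have Hr := c_branch_re_pos c _ Hc Hw. set c0 := c (omega a) in Hr *.
have Hc0 : c0 <> RtoC 0 by move=> E; rewrite E /Re /= in Hr; lra.
set ph := Cexp (- RtoC X - Ci * RtoC (omega a * X)).
set kappa := Cexp (Ci * RtoC (- (omega a * (X + nu)))).
have Ek : (RtoC (exp (- X)) * (kappa * t0_pow a nu) = ph)%C.
{ rewrite /kappa /t0_pow /ph -Cexp_plus -Cexp_RtoC -Cexp_plus. f_equal. apply: Ceq; rewrite /Re /Im /=; ring. }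
have Hs0 : 0 < sqrt (2 * PI * X) by apply: sqrt_lt_R0; apply: Rmult_lt_0_compat; lra.
have Hsm : sqrt (2 * PI / X) = 2 * PI / sqrt (2 * PI * X).
{ rewrite (_ : 2 * PI / X = (2 * PI) ^ 2 / (2 * PI * X)); last by field; lra.
  rewrite sqrt_div_alt; last by apply: Rmult_lt_0_compat; lra. rewrite sqrt_pow2 //. lra. }
have ReZ (r : R) (z : C) : r * Re z = Re (RtoC r * z)%C by rewrite /Re /=; ring.
(* [Im z = Re (- i z)] puts both sides under one real part; the complex numbers themselves are then
   equal, term by term. *)
have ImZ (r : R) (z : C) : r * Im z = Re (RtoC r * (- Ci * z))%C by rewrite /Re /Im /=; ring.
rewrite ReZ ImZ. f_equal.
rewrite (_ : forall z w v : C, (RtoC (2 / a) * (z - w * v))%C = (RtoC (2 / a) * z - (RtoC (2 / a) * w) * v)%C); last by move=> *; ring.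
rewrite (_ : forall z : C, (RtoC (exp (- X) / PI) * (- Ci * (kappa * z)))%C = (RtoC (exp (- X) / PI) * (- Ci) * kappa * z)%C); last by move=> *; ring.
rewrite -!Csum_scal -Csum_minus. apply: Csum_ext => k _.
rewrite half_pochhammer_rising.
have ET := expansion_term a X c0 k (proj1 Ha) HX Hc0.
rewrite (_ : (RtoC (2 / a) * (RtoC ((-1) ^ k * rising (1 / 2) k / sqrt PI) * (ph * (/ (c0 * RtoC (sqrt (X / 2)))) ^ (2 * k + 1) / 2)))%C =
  (ph * (RtoC (2 / a) * (RtoC ((-1) ^ k * rising (1 / 2) k / sqrt PI) * ((/ (c0 * RtoC (sqrt (X / 2)))) ^ (2 * k + 1) / 2))))%C); last by rewrite /Cdiv; ring.
rewrite ET /watson_coeff.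
set mu := rising (1 / 2) k * / (X / 2) ^ k.
rewrite (_ : RtoC (2 / a) = (RtoC (/ (PI * a) * sqrt (2 * PI / X)) * RtoC (sqrt (2 * PI * X)))%C); last first.
{ rewrite -RtoC_mult Hsm. f_equal. field. repeat split; lra. }
have Hs0' := RtoC_neq_0 _ (Rgt_not_eq _ _ Hs0).
rewrite (_ : (RtoC (/ (PI * a) * sqrt (2 * PI / X)) * RtoC (sqrt (2 * PI * X)) * (Ci * ph / RtoC (sqrt (2 * PI * X))))%C =
   (RtoC (/ (PI * a)) * RtoC (sqrt (2 * PI / X)) * Ci * ph)%C); last by rewrite RtoC_mult; field; exact: Hs0'.
rewrite -Ek (_ : RtoC (exp (- X) / PI) = (RtoC (exp (- X)) * RtoC (/ PI))%C); last by rewrite -RtoC_mult.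
rewrite (_ : RtoC (/ (PI * a)) = (RtoC (/ PI) * / RtoC a)%C); last first.
{ rewrite -RtoC_inv; last lra. rewrite -RtoC_mult. f_equal. field. lra. }
rewrite (RtoC_mult mu) /Cdiv. ring.
Qed.

Theorem theorem1 :
  forall (a : R) (M : R -> nat) (c : R -> C) (t : C -> C) (B : R -> nat -> C),
  1 / 3 < a < 1 ->
  (forall x : R, 0 < x -> (0 < M x)%nat) ->
  (exists K : R,
     Rbar_locally p_infty (fun x : R => Rabs (nu_of a M x) <= K)) ->
  is_c_branch c ->
  is_saddle_inverse t ->
  is_B_coeffs a c t B ->
  exists Rm : R -> R,
    (forall x : R, 0 < x ->
       mittag_leffler a (- x) = algebraic_part a (M x) x + Rm x) /\
    (forall N : nat, exists K : R,
       Rbar_locally p_infty (fun x : R =>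
         Rabs (Rm x
               - exp_expansion a (c (omega a)) (B (nu_of a M x)) N (bigX a x))
         <= K * (exp (- bigX a x) * Rpower (bigX a x) (- INR N - 1 / 2)))).
Proof.
move=> a M c t B Ha HM [K HK] Hc Ht HB. have HPI := PI_RGT_0.
have Ha' : 0 < a < 1 by lra.
have Hw : 0 < omega a. { rewrite /omega. apply: Rdiv_lt_0_compat; nra. }
have Hr := c_branch_re_pos c _ Hc Hw.
exists (fun x => mittag_leffler a (- x) - algebraic_part a (M x) x).
split; first by move=> x _; ring.
move=> N. pose K1 := Rmax K 0.
have HK1 : 0 <= K1 by exact: Rmax_r.
have [Mw Hwat] := watson a K1 c t B N Ha' HK1 Hr Ht HB.
have [Me [HMe Herf]] := erfc_expansion a c N Ha' Hc.
exists (Mw / PI + 2 / a * Me).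
have [x0 Hx0] := HK.
(* The threshold secures the bound on [nu], the positivity of [x], and [X >= K1 + 2], the range in
   which [watson] holds. *)
exists (Rmax (Rmax x0 0) (exp (a * ln (K1 + 2)))) => x Hx.
have m1 := Rmax_l (Rmax x0 0) (exp (a * ln (K1 + 2))). have m2 := Rmax_r (Rmax x0 0) (exp (a * ln (K1 + 2))).
have m3 := Rmax_l x0 0. have m4 := Rmax_r x0 0.
have Hxp : 0 < x by lra.
have Hnu : Rabs (nu_of a M x) <= K1 by apply: Rle_trans (Hx0 x _) (Rmax_l _ _); lra.
have HX : K1 + 2 <= bigX a x.
{ rewrite /bigX /Rpower -{1}(exp_ln (K1 + 2)); last lra. apply: exp_le.
  have H1 : a * ln (K1 + 2) <= ln x. { rewrite -(ln_exp (a * ln (K1 + 2))). apply: ln_le; [exact: exp_pos | lra]. }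
  apply: (Rmult_le_reg_l a); first lra. rewrite (_ : a * (1 / a * ln x) = ln x) //. field. lra. }
have [l [Hl ER]] := remainder_saddle a x (M x) Ha' Hxp (HM x Hxp).
set X := bigX a x in HX Hl ER *. set nu := nu_of a M x in Hnu *.
have EaM : a * INR (M x) = X + nu by rewrite /nu /nu_of -/X; ring.
rewrite EaM (_ : X + nu - X = nu) in Hl; last ring.
have HXp : 0 < X by lra.
set P := Rpower X (- INR N - 1 / 2).
have H1 := Hwat nu X _ l Hnu HX (Req_le _ _ (Cmod_Cexp_i _)) Hl. rewrite -/P in H1.
have H2 := Herf X HXp. rewrite -/P in H2.
have H3 := leading_terms_agree a nu X c B N Ha' Hc HXp.
rewrite ER /exp_expansion.
move: H1 H2 H3. set W := Im _. set S := Csum _ N. set T := (_ / 2 * _)%C. set V := (_ / _ * _)%C.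
move=> H1 H2 H3.
have He := exp_pos (- X).
have HRe (z w : C) : Re (z - w)%C = Re z - Re w by rewrite /Re /=; ring.
rewrite HRe in H3. rewrite HRe.
have H4 : Rabs (Re T - Re S) <= Me * (exp (- X) * P).
{ rewrite -HRe. apply: Rle_trans (re_le_Cmod _) H2. }
have Ha2 : 0 < 2 / a by apply: Rdiv_lt_0_compat; lra.
have HeP : 0 < exp (- X) / PI by exact: Rdiv_lt_0_compat.
(* By [H3] the leading terms cancel, which leaves the Watson error [l - W] and the [erfc] error
   [T - S]. *)
rewrite (_ : exp (- X) / PI * l - 2 / a * (Re T - Re V) = exp (- X) / PI * (l - W) - 2 / a * (Re T - Re S)); last lra.
apply: Rle_trans (Rabs_triang _ _) _. rewrite Rabs_Ropp (Rabs_mult (exp (- X) / PI)) (Rabs_mult (2 / a)) (Rabs_pos_eq (exp (- X) / PI)); last lra.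
rewrite (Rabs_pos_eq (2 / a)); last lra.
apply (Rmult_le_compat_l _ _ _ (Rlt_le _ _ HeP)) in H1.
apply (Rmult_le_compat_l _ _ _ (Rlt_le _ _ Ha2)) in H4.
rewrite (_ : (Mw / PI + 2 / a * Me) * (exp (- X) * P) = exp (- X) / PI * (Mw * P) + 2 / a * (Me * (exp (- X) * P))); last by field; lra.
lra.
Qed.
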